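(* Let $\varphi\colon X\to Y$ be a Gorenstein covering map of degree $6$ such that $$\varphi_*\mathcal{O}_X=\mathcal{O}_Y\oplus M\oplus M\oplus\wedge^2M,$$ with $M$ a locally free $\mathcal{O}_Y$-module of rank $2$. Assume that $\varphi$ is defined by a general linear covering homomorphism $\Phi\in\operatorname{CHom}\left((S^2M)^{\oplus3},M^{\oplus2}\right)$, i.e. for a local choice of basis $\{z_i,w_i\}_{i=1,2}$ of $M\oplus M$ it can be written as $$\Phi(S^2(Z))=e_1\widetilde CZ+e_0\widetilde CW,\quad \Phi(S^2(Z,W))=-e_2\widetilde CZ-e_1\widetilde CW,\quad \Phi(S^2(W))=e_3\widetilde CZ+e_2\widetilde CW,$$ with $(e_0,e_1,e_2,e_3)\in k^4\setminus\{\Delta_{tc}(e_0,e_1,e_2,e_3)=0\}$. Then $X$ is an $S_3$-Galois branched cover of $Y$. Furthermore: 1. With a linear change of coordinates, the ideal $\mathcal{I}_X$ can locally be written in the form $$\begin{pmatrix}S^2(Z)-\widetilde CW\\ S^2(Z,W)-\widetilde D\\ S^2(W)-\widetilde CZ\end{pmatrix},\quad \widetilde C=\begin{pmatrix}c_1&c_0\\-c_2&-c_1\\c_3&c_2\end{pmatrix},\quad \widetilde D=\begin{pmatrix}c_1^2-c_0c_2\\ \frac12(c_0c_3-c_1c_2)\\ c_2^2-c_1c_3\end{pmatrix}.$$ 2. $X/\mathbb{Z}_2$ is a triple cover $\varphi_2\colon X/\mathbb{Z}_2\to Y$ such that $\varphi_{2*}\mathcal{O}_{X/\mathbb{Z}_2}=\mathcal{O}_Y\oplus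 M$. 3. $X/\mathbb{Z}_3$ is a double cover $\varphi_3\colon X/\mathbb{Z}_3\to Y$ such that $\varphi_{3*}\mathcal{O}_{X/\mathbb{Z}_3}=\mathcal{O}_Y\oplus\wedge^2M$.
   Context: $k$ is an algebraically closed field of characteristic $0$; schemes are over $k$. A covering map of degree $d$ is a flat and finite morphism $\varphi\colon X\to Y$ with $\varphi_*\mathcal{O}_X$ locally free of rank $d$; it is Gorenstein if all fibres $X_y$ are Gorenstein. An $S_3$-Galois branched cover of $Y$ is a covering map $X\to Y$ with an action of the symmetric group $S_3$ on $X$ over $Y$ with $X/S_3\cong Y$; $\mathbb{Z}_2,\mathbb{Z}_3\subset S_3$ denote the subgroups generated by a transposition and by a $3$-cycle. Notation: $\{z_1,z_2\}$ is a local basis of the first copy of $M$ and $w_i$ is the image of $z_i$ in the second copy; $Z=(z_1,z_2)^t$, $W=(w_1,w_2)^t$, $S^2(Z)=(z_1^2,z_1z_2,z_2^2)^t$, $S^2(Z,W)=(z_1w_1,\frac12(z_1w_2+z_2w_1),z_2w_2)^t$, $S^2(W)=(w_1^2,w_1w_2,w_2^2)^t$ (together a local basis of $(S^2M)^{\oplus3}\subset\operatorname{Sym}^2(M\oplus M)$, $S^2M=\operatorname{Sym}^2M$). $\widetilde C=\begin{pmatrix}c_1&c_0\\-c_2&-c_1\\c_3&c_2\end{pmatrix}$ with $c_0,\dots,c_3$ local sections of $\mathcal{O}_Y$. Equations between vectors are read entrywise. Also $$\Delta_{tc}(e_0,e_1,e_2,e_3)=e_0^2e_3^2+4e_0e_2^3-3e_1^2e_2^2+4e_1^3e_3-6e_0e_1e_2e_3.$$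 $\operatorname{CHom}((S^2M)^{\oplus3},M^{\oplus2})$ denotes the morphisms $\Phi\colon(S^2M)^{\oplus3}\to M^{\oplus2}$ that determine a cover: writing $q_j$ for the local basis of $(S^2M)^{\oplus3}$ above, there are (uniquely determined by $\Phi$) local sections $d_j$ of $\mathcal{O}_Y$ such that $\mathcal{O}_Y[z_1,z_2,w_1,w_2]/\langle q_j-\Phi(q_j)-d_j\rangle$ is a flat deformation of $\mathcal{O}_Y[z_1,z_2,w_1,w_2]/\langle q_j\rangle$. This means: in $\mathcal{O}_Y[t,z_1,z_2,w_1,w_2]/\langle q_j-\Phi(q_j)t-d_jt^2\rangle$ the element $t$ is a non-zero-divisor, and reduction modulo $t$ gives $\mathcal{O}_Y[z_1,z_2,w_1,w_2]/\langle q_j\rangle$. $\varphi$ is defined by $\Phi$ if locally $\varphi_*\mathcal{O}_X=\mathcal{O}_Y[z_1,z_2,w_1,w_2]/\mathcal{I}_X$ with $\mathcal{I}_X=\langle q_j-\Phi(q_j)-d_j\rangle$. *)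

(* Defs.v *)
From HB Require Import structures.
From mathcomp Require Import all_boot all_order all_algebra all_fingroup.
From mathcomp Require Import mathcomp_extra boolp classical_sets functions topology.
(* The notations of mpoly.v clash with those of topology.v. *)
From mathcomp Require mpoly.
Import -(notations) mpoly.
Set Implicit Arguments.
Unset Strict Implicit.
Unset Printing Implicit Defensive.
Import GRing.Theory.
Local Open Scope classical_set_scope.
Local Open Scope ring_scope.

(** * Open subsets *)

Record opens (T : topologicalType) := Opens {
  oset :> set T;
  open_oset : open oset }.

Definition in_opens (T : topologicalType) (V : opens T) (x : T) : Prop :=
  oset V x.
Coercion in_opens : opens >-> Funclass.

Lemma open_preim (S T : topologicalType) (f : S -> T) (V : opens T) :
  continuous f -> open (f @^-1` V).
Proof. by move=> /continuousP; apply; exact: open_oset. Qed.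

Definition opreim (S T : topologicalType) (f : S -> T) (cf : continuous f)
  (V : opens T) : opens S := Opens (@open_preim S T f V cf).

(** * Schemes over k *)

(* Rings of sections may be the zero ring (e.g. over the empty set), hence
   [comPzRingType]. *)
Record space (k : fieldType) := Space {
  pts :> topologicalType;
  sec : opens pts -> comPzRingType;
  res : forall U V : opens pts, V `<=` U -> {rmorphism sec U -> sec V};
  scal : forall U : opens pts, {rmorphism k -> sec U};
  res_scal : forall (U V : opens pts) (h : V `<=` U) (a : k),
    res h (scal U a) = scal V a;
  res_id : forall (U : opens pts) (h : U `<=` U) (s : sec U), res h s = s;
  res_comp : forall (U V W : opens pts) (hUV : V `<=` U) (hVW : W `<=` V)
    (hUW : W `<=` U) (s : sec U), res hVW (res hUV s) = res hUW s;
  sec_glue : forall (I : Type) (F : I -> opens pts) (U : opens pts)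
      (hF : forall i, F i `<=` U), U `<=` \bigcup_i F i ->
    forall s : forall i, sec (F i),
      (forall i j (W : opens pts) (hi : W `<=` F i) (hj : W `<=` F j),
         res hi (s i) = res hj (s j)) ->
    exists! t : sec U, forall i, res (hF i) t = s i }.

(* For x in U: the germ of s at x is a unit of the stalk. *)
Definition unit_near k (X : space k) (U : opens X) (s : sec U) (x : X) : Prop :=
  exists (V : opens X) (h : V `<=` U), V x /\ exists t, res h s * t = 1.

Lemma open_unit_near k (X : space k) (U : opens X) (s : sec U) :
  open [set x | unit_near s x].
Proof.
rewrite openE => x [V [h [Vx Vs]]].
apply: (filterS _ (open_nbhs_nbhs (conj (open_oset V) Vx))) => y Vy.
by exists V, h.
Qed.

(* D(s) *)
Definition basic k (X : space k) (U : opens X) (s : sec U) : opens X :=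
  Opens (open_unit_near s).

Lemma basic_sub k (X : space k) (U : opens X) (s : sec U) : basic s `<=` U.
Proof. by move=> x [V [h [Vx _]]]; exact: h. Qed.

Definition prime_ideal (R : comPzRingType) (P : R -> Prop) : Prop :=
  [/\ P 0, forall a b, P a -> P b -> P (a + b), forall a b, P b -> P (a * b),
      ~ P 1 & forall a b, P (a * b) -> P a \/ P b].

(* The canonical map from U to Spec (sec U), which sends x to the ideal of the
   sections vanishing at x, is well defined, bijective, a homeomorphism, and an
   isomorphism of structure sheaves: the sections over D(s) are the localization
   of [sec U] at s (that s becomes invertible over D(s) follows from gluing). *)
Definition affine k (X : space k) (U : opens X) : Prop :=
  [/\ forall x, U x -> prime_ideal (fun s : sec U => ~ unit_near s x),
      forall P : sec U -> Prop, prime_ideal P ->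
        exists! x, U x /\ (forall s, P s <-> ~ unit_near s x),
      forall (V : opens X) x, V `<=` U -> V x ->
        exists s : sec U, unit_near s x /\ basic s `<=` V &
      forall s : sec U,
        (forall a, res (@basic_sub k X U s) a = 0 ->
           exists n, s ^+ n * a = 0) /\
        (forall b : sec (basic s), exists (a : sec U) (n : nat),
           res (@basic_sub k X U s) a = res (@basic_sub k X U s) s ^+ n * b)].

Record scheme (k : fieldType) := Scheme {
  scheme_space :> space k;
  locally_affine : forall x : scheme_space,
    exists U : opens scheme_space, U x /\ affine U }.

(** * Morphisms of schemes over k *)

(* [pull_local] says that the homomorphisms of stalks are local. *)
Record smorphism k (X Y : space k) := Smorphism {
  mpt :> X -> Y;
  mpt_cont : continuous mpt;
  pull : forall V : opens Y, {rmorphism sec V -> sec (opreim mpt_cont V)};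
  pull_scal : forall V a, pull V (scal V a) = scal (opreim mpt_cont V) a;
  pull_res : forall (U V : opens Y) (h : V `<=` U)
    (h' : opreim mpt_cont V `<=` opreim mpt_cont U) (s : sec U),
    pull V (res h s) = res h' (pull U s);
  pull_local : forall (V : opens Y) (s : sec V) (x : X),
    V (mpt x) -> unit_near (pull V s) x -> unit_near s (mpt x) }.

Definition preim k (X Y : space k) (f : smorphism X Y) (V : opens Y) : opens X :=
  opreim (@mpt_cont k X Y f) V.

Lemma preim_sub k (X Y : space k) (f : smorphism X Y) (U V : opens Y) :
  V `<=` U -> preim f V `<=` preim f U.
Proof. by move=> h x; exact: h. Qed.

(* The open sets on which f^# s and g^# s live are propositionally, not
   definitionally, equal; the sections are compared after restriction. *)
Definition eqmor k (X Y : space k) (f g : smorphism X Y) : Prop :=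
  (forall x, f x = g x) /\
  (forall (V : opens Y) (s : sec V) (W : opens X)
     (hf : W `<=` preim f V) (hg : W `<=` preim g V),
     res hf (pull f V s) = res hg (pull g V s)).

Lemma mid_cont (T : topologicalType) : continuous (@id T).
Proof. by move=> x; exact: cvg_id. Qed.

Section Identity.
Variables (k : fieldType) (X : space k).

Let mid_res (V : opens X) : opreim (@mid_cont X) V `<=` V := fun _ => id.

Definition mid_pull (V : opens X) :
    {rmorphism sec V -> sec (opreim (@mid_cont X) V)} := res (@mid_res V).

Lemma mid_pull_scal V a : mid_pull V (scal V a) = scal (opreim (@mid_cont X) V) a.
Proof. exact: res_scal. Qed.

Lemma mid_pull_res (U V : opens X) (h : V `<=` U)
    (h' : opreim (@mid_cont X) V `<=` opreim (@mid_cont X) U) (s : sec U) :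
  mid_pull V (res h s) = res h' (mid_pull U s).
Proof. by rewrite /mid_pull !(res_comp _ _ (h : opreim (@mid_cont X) V `<=` U)). Qed.

Lemma mid_pull_local (V : opens X) (s : sec V) (x : X) :
  V x -> unit_near (mid_pull V s) x -> unit_near s x.
Proof.
move=> Vx [W [h [Wx [t st]]]]; exists W, h; split=> //; exists t.
by rewrite -st /mid_pull (res_comp _ _ (h : W `<=` V)).
Qed.

Definition mid : smorphism X X :=
  Smorphism mid_pull_scal mid_pull_res mid_pull_local.
End Identity.

Section Composition.
Variables (k : fieldType) (X Y Z : space k).
Variables (g : smorphism Y Z) (f : smorphism X Y).

Lemma mcomp_cont : continuous (g \o f).
Proof.
by move=> x; apply: continuous_comp; [exact: (@mpt_cont _ _ _ f)|
  exact: (@mpt_cont _ _ _ g)].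
Qed.

Let mcomp_sub (V : opens Z) : opreim mcomp_cont V `<=` preim f (preim g V) :=
  fun _ => id.

Definition mcomp_pull (V : opens Z) :
    {rmorphism sec V -> sec (opreim mcomp_cont V)} :=
  res (@mcomp_sub V) \o (pull f (preim g V) \o pull g V).

Lemma mcomp_pull_scal V a : mcomp_pull V (scal V a) = scal (opreim mcomp_cont V) a.
Proof. by rewrite /mcomp_pull /= !pull_scal res_scal. Qed.

Lemma mcomp_pull_res (U V : opens Z) (h : V `<=` U)
    (h' : opreim mcomp_cont V `<=` opreim mcomp_cont U) (s : sec U) :
  mcomp_pull V (res h s) = res h' (mcomp_pull U s).
Proof.
rewrite /mcomp_pull /= (pull_res h (preim_sub (f := g) h)).
rewrite (pull_res _ (preim_sub (f := f) (preim_sub (f := g) h))).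
by rewrite !(res_comp _ _ (h' : opreim mcomp_cont V `<=` preim f (preim g U))).
Qed.

Lemma mcomp_pull_local (V : opens Z) (s : sec V) (x : X) :
  V ((g \o f) x) -> unit_near (mcomp_pull V s) x -> unit_near s ((g \o f) x).
Proof.
move=> Vx [W [h [Wx [t st]]]]; apply: pull_local => //; apply: pull_local => //.
exists W, h; split=> //; exists t.
by rewrite -st /mcomp_pull /= (res_comp _ _ (h : W `<=` preim f (preim g V))).
Qed.

Definition mcomp : smorphism X Z :=
  Smorphism mcomp_pull_scal mcomp_pull_res mcomp_pull_local.
End Composition.

(** * Covering maps *)

Definition finite_morphism k (X Y : space k) (f : smorphism X Y) : Prop :=
  forall y : Y, exists V : opens Y,
    [/\ V y, affine V, affine (preim f V) &
        exists (n : nat) (b : 'I_n -> sec (preim f V)),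
          forall s, exists a : 'I_n -> sec V, s = \sum_i pull f V (a i) * b i].

Definition direct_image_locally_free k (X Y : space k) (f : smorphism X Y)
    (d : nat) : Prop :=
  forall y : Y, exists (U : opens Y) (b : 'I_d -> sec (preim f U)), U y /\
    forall (V : opens Y) (h : V `<=` U) (s : sec (preim f V)),
      exists! a : 'rV[sec V]_d,
        s = \sum_i pull f V (a 0 i) * res (preim_sub (f := f) h) (b i).

(* A finite morphism is affine, hence it is flat as soon as the direct image of
   the structure sheaf is locally free. *)
Definition covering_map k (X Y : space k) (f : smorphism X Y) (d : nat) : Prop :=
  finite_morphism f /\ direct_image_locally_free f d.

(* F is the ring of the fibre over the point of Spec R given by the prime p:
   the localization of B / pB at the image of R \ p. *)
Definition fibre_ring (R B F : comPzRingType) (f : {rmorphism R -> B})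
    (p : R -> Prop) (pi : {rmorphism B -> F}) : Prop :=
  [/\ forall r, ~ p r -> exists u, pi (f r) * u = 1,
      forall x : F, exists (b : B) (r : R), ~ p r /\ x * pi (f r) = pi b &
      forall b : B, pi b = 0 <-> exists (r : R) (n : nat) (q : 'I_n -> R)
          (c : 'I_n -> B),
        [/\ ~ p r, forall i, p (q i) & f r * b = \sum_i f (q i) * c i]].

(* An Artinian ring is Gorenstein (its local rings have finite injective
   dimension over themselves) iff it is an injective module over itself. *)
Definition self_injective (F : comPzRingType) : Prop :=
  forall (N N' : lmodType F) (i : {linear N -> N'}) (u : {linear N -> F^o}),
    injective i -> exists v : {linear N' -> F^o}, forall x, v (i x) = u x.

Definition gorenstein_fibres k (X Y : space k) (f : smorphism X Y) : Prop :=
  forall (y : Y) (V : opens Y), V y -> affine V -> affine (preim f V) ->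
  forall (F : comPzRingType) (pi : {rmorphism sec (preim f V) -> F}),
    fibre_ring (pull f V) (fun s => ~ unit_near s y) pi -> self_injective F.

(** * Group actions and quotients *)

(* A right action, as in 'S_n the product s * t is "s, then t". *)
Definition action_over k (X Y : space k) (f : smorphism X Y)
    (gT : finGroupType) (act : gT -> smorphism X X) : Prop :=
  [/\ eqmor (act 1%g) (mid X),
      forall s t, eqmor (act (s * t)%g) (mcomp (act t) (act s)) &
      forall s, eqmor (mcomp f (act s)) f].

Definition invariant_section k (X : space k) (gT : finGroupType)
    (act : gT -> smorphism X X) (H : {set gT}) (W : opens X) (s : sec W) : Prop :=
  forall g, g \in H -> forall (W' : opens X)
    (h : W' `<=` W) (h' : W' `<=` preim (act g) W),
    res h' (pull (act g) W s) = res h s.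

(* q : X -> Z is the quotient of X by the subgroup H, as a ringed space. *)
Definition is_quotient k (X Z : space k) (gT : finGroupType)
    (act : gT -> smorphism X X) (H : {group gT}) (q : smorphism X Z) : Prop :=
  [/\ forall z, exists x, q x = z,
      forall x x', q x = q x' <-> exists2 g, g \in H & x' = act g x,
      forall A : set Z, open (q @^-1` A) -> open A,
      forall V : opens Z, injective (pull q V) &
      forall (V : opens Z) (s : sec (preim q V)),
        invariant_section act H s <-> exists t, pull q V t = s].

Definition galois_branched_cover k (X Y : space k) (f : smorphism X Y)
    (gT : finGroupType) (act : gT -> smorphism X X) : Prop :=
  [/\ exists d, covering_map f d, action_over f act &
      is_quotient act [set: gT]%G f].

(** * Sheaves of modules *)

Record modsheaf k (Y : space k) := Modsheaf {
  msec : forall U : opens Y, lmodType (sec U);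
  mres : forall U V : opens Y, V `<=` U -> msec U -> msec V;
  mresD : forall (U V : opens Y) (h : V `<=` U) (m n : msec U),
    mres h (m + n) = mres h m + mres h n;
  mresZ : forall (U V : opens Y) (h : V `<=` U) (a : sec U) (m : msec U),
    mres h (a *: m) = res h a *: mres h m;
  mres_id : forall (U : opens Y) (h : U `<=` U) (m : msec U), mres h m = m;
  mres_comp : forall (U V W : opens Y) (hUV : V `<=` U) (hVW : W `<=` V)
    (hUW : W `<=` U) (m : msec U), mres hVW (mres hUV m) = mres hUW m;
  msec_glue : forall (I : Type) (F : I -> opens Y) (U : opens Y)
      (hF : forall i, F i `<=` U), U `<=` \bigcup_i F i ->
    forall m : forall i, msec (F i),
      (forall i j (W : opens Y) (hi : W `<=` F i) (hj : W `<=` F j),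
         mres hi (m i) = mres hj (m j)) ->
    exists! t : msec U, forall i, mres (hF i) t = m i }.

Definition is_basis k (Y : space k) (M : modsheaf Y) (U : opens Y) (n : nat)
    (b : 'I_n -> msec M U) : Prop :=
  forall (V : opens Y) (h : V `<=` U) (m : msec M V),
    exists! a : 'rV[sec V]_n, m = \sum_i a 0 i *: mres h (b i).

Definition locally_free k (Y : space k) (M : modsheaf Y) (n : nat) : Prop :=
  forall y : Y, exists (U : opens Y) (b : 'I_n -> msec M U), U y /\ is_basis b.

Record modhom k (Y : space k) (M N : modsheaf Y) := Modhom {
  hom :> forall U : opens Y, {linear msec M U -> msec N U};
  hom_res : forall (U V : opens Y) (h : V `<=` U) (m : msec M U),
    hom V (mres h m) = mres h (hom U m) }.

(* A homomorphism M -> f_* O_X of O_Y-modules. *)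
Record pushhom k (X Y : space k) (f : smorphism X Y) (M : modsheaf Y) := Pushhom {
  phom :> forall U : opens Y, msec M U -> sec (preim f U);
  phomD : forall (U : opens Y) (m n : msec M U),
    phom (m + n) = phom m + phom n;
  phomZ : forall (U : opens Y) (a : sec U) (m : msec M U),
    phom (a *: m) = pull f U a * phom m;
  phom_res : forall (U V : opens Y) (h : V `<=` U) (m : msec M U),
    phom (mres h m) = res (preim_sub (f := f) h) (phom m) }.

Record alternating k (Y : space k) (M N : modsheaf Y) := Alternating {
  alt :> forall U : opens Y, msec M U -> msec M U -> msec N U;
  altD : forall (U : opens Y) (m m' n : msec M U),
    alt (m + m') n = alt m n + alt m' n;
  altZ : forall (U : opens Y) (a : sec U) (m n : msec M U),
    alt (a *: m) n = a *: alt m n;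
  altDr : forall (U : opens Y) (m n n' : msec M U),
    alt m (n + n') = alt m n + alt m n';
  altZr : forall (U : opens Y) (a : sec U) (m n : msec M U),
    alt m (a *: n) = a *: alt m n;
  alt_diag : forall (U : opens Y) (m : msec M U), alt m m = 0;
  alt_res : forall (U V : opens Y) (h : V `<=` U) (m n : msec M U),
    alt (mres h m) (mres h n) = mres h (alt m n) }.

(* (L, w) is the second exterior power of M: w is the universal alternating
   bilinear map. *)
Definition is_wedge2 k (Y : space k) (M L : modsheaf Y) (w : alternating M L) :
    Prop :=
  forall (N : modsheaf Y) (u : alternating M N),
    (exists v : modhom L N, forall U m n, v U (w U m n) = u U m n) /\
    (forall v v' : modhom L N,
       (forall U m n, v U (w U m n) = v' U (w U m n)) -> forall U l, v U l = v' U l).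

(* f_* O_X = O_Y (+) M, where O_Y is embedded by the structure map of the
   O_Y-algebra f_* O_X. *)
Definition splits_as k (X Y : space k) (f : smorphism X Y) (M : modsheaf Y) :
    Prop :=
  exists j : pushhom f M, forall U : opens Y,
    bijective (fun v : sec U * msec M U => pull f U v.1 + j U v.2).

(* f_* O_X = O_Y (+) M (+) M (+) L *)
Definition splits_by k (X Y : space k) (f : smorphism X Y) (M L : modsheaf Y)
    (jz jw : pushhom f M) (jl : pushhom f L) : Prop :=
  forall U : opens Y,
    bijective (fun v : sec U * msec M U * msec M U * msec L U =>
      pull f U v.1.1.1 + jz U v.1.1.2 + jw U v.1.2 + jl U v.2).

(** * The algebra of covering homomorphisms *)

Definition mx_of_rows (R : comPzRingType) (m n : nat) (s : seq (seq R)) :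
  'M[R]_(m, n) := \matrix_(i, j) nth 0 (nth [::] s i) j.

(* x = (z_1, z_2, w_1, w_2)^t *)
Section Relations.
Variables (P : comPzRingType) (half : P).

Definition S2 (z : 'cV[P]_2) : 'cV[P]_3 :=
  let z1 := z ord0 0 in let z2 := z ord_max 0 in
  mx_of_rows 3 1 [:: [:: z1 ^+ 2]; [:: z1 * z2]; [:: z2 ^+ 2]].

Definition S2mixed (z w : 'cV[P]_2) : 'cV[P]_3 :=
  let z1 := z ord0 0 in let z2 := z ord_max 0 in
  let w1 := w ord0 0 in let w2 := w ord_max 0 in
  mx_of_rows 3 1
    [:: [:: z1 * w1]; [:: half * (z1 * w2 + z2 * w1)]; [:: z2 * w2]].

Definition quadrics (x : 'cV[P]_(2 + 2)) : 'cV[P]_(3 + 3 + 3) :=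
  let z := usubmx x in let w := dsubmx x in
  col_mx (col_mx (S2 z) (S2mixed z w)) (S2 w).

Definition ideal_of n (g : 'cV[P]_n) (p : P) : Prop :=
  exists a : 'rV[P]_n, p = (a *m g) 0 0.
End Relations.

Section LocalForms.
Variable R : comPzRingType.
Implicit Types (c e : 'I_4 -> R).

Let i1 : 'I_4 := inord 1.
Let i2 : 'I_4 := inord 2.
Let i3 : 'I_4 := inord 3.

Definition Ctilde c : 'M[R]_(3, 2) :=
  mx_of_rows 3 2 [:: [:: c i1; c ord0]; [:: - c i2; - c i1]; [:: c i3; c i2]].

Definition Dtilde (half : R) c : 'cV[R]_3 :=
  mx_of_rows 3 1 [:: [:: c i1 ^+ 2 - c ord0 * c i2];
                     [:: half * (c ord0 * c i3 - c i1 * c i2)];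
                     [:: c i2 ^+ 2 - c i1 * c i3]].

Definition Delta_tc e : R :=
  e ord0 ^+ 2 * e i3 ^+ 2 + 4%:R * e ord0 * e i2 ^+ 3
  - 3%:R * e i1 ^+ 2 * e i2 ^+ 2 + 4%:R * e i1 ^+ 3 * e i3
  - 6%:R * e ord0 * e i1 * e i2 * e i3.

(* Matrices of homomorphisms (S^2 M)^3 -> M^2: the nine rows are indexed by
   [quadrics], the four columns by z_1, z_2, w_1, w_2. *)
Definition linear_Phi_mx e c : 'M[R]_(3 + 3 + 3, 2 + 2) :=
  let C := Ctilde c in
  col_mx (col_mx (row_mx (e i1 *: C) (e ord0 *: C))
                 (row_mx (- e i2 *: C) (- e i1 *: C)))
         (row_mx (e i3 *: C) (e i2 *: C)).

Definition normal_Phi_mx c : 'M[R]_(3 + 3 + 3, 2 + 2) :=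
  let C := Ctilde c in
  col_mx (col_mx (row_mx 0 C) (row_mx 0 0)) (row_mx C 0).

Definition normal_const (half : R) c : 'cV[R]_(3 + 3 + 3) :=
  col_mx (col_mx 0 (Dtilde half c)) 0.
End LocalForms.

Section Presentations.
Variable R : comNzRingType.
Local Notation P := (mpoly.mpoly 4 R).
Local Notation C := (@mpoly.mpolyC 4 R).
Variables (half : R) (A : 'M[R]_(3 + 3 + 3, 2 + 2)) (d : 'cV[R]_(3 + 3 + 3)).

Definition coordinates : 'cV[P]_(2 + 2) :=
  \col_i mpoly.mpolyX R (mpoly.mnm1 i).

Let q : 'cV[P]_(3 + 3 + 3) := quadrics (C half) coordinates.
Let Phi_q : 'cV[P]_(3 + 3 + 3) := map_mx C A *m coordinates.

Definition relations : 'cV[P]_(3 + 3 + 3) := q - Phi_q - map_mx C d.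

(* R[t, z_1, z_2, w_1, w_2] is {poly P} with t = 'X. *)
Definition homogenized_relations : 'cV[{poly P}]_(3 + 3 + 3) :=
  map_mx polyC q - 'X *: map_mx polyC Phi_q
  - 'X ^+ 2 *: map_mx polyC (map_mx C d).

Definition flat_deformation : Prop :=
  (forall p : {poly P}, ideal_of homogenized_relations ('X * p) ->
     ideal_of homogenized_relations p) /\
  (forall p : {poly P},
     (exists s : {poly P}, ideal_of homogenized_relations (p - 'X * s)) <->
     ideal_of q p`_0).

Definition presented_by (B : comNzRingType) (f : {rmorphism R -> B})
    (x : 'I_4 -> B) : Prop :=
  (forall b : B, exists p : P, mpoly.mmap f x p = b) /\
  (forall p : P, mpoly.mmap f x p = 0 <-> ideal_of relations p).
End Presentations.

Definition nzRing (R : comPzRingType) (nz : 1 != 0 :> R) : comNzRingType :=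
  HB.pack_for comNzRingType (GRing.ComPzRing.sort R)
    (GRing.PzSemiRing_isNonZero.Build R nz).

(** * Covers defined by a covering homomorphism *)

(* A homomorphism (S^2 M)^3 -> M^2, given by the three symmetric bilinear maps
   M x M -> M^2 which are its restrictions to the summands (numbered as in
   [quadrics]). *)
Record quadhom k (Y : space k) (M : modsheaf Y) := Quadhom {
  quad :> forall (a : 'I_3) (U : opens Y),
    msec M U -> msec M U -> (msec M U * msec M U)%type;
  quadC : forall a (U : opens Y) (m n : msec M U), quad a m n = quad a n m;
  quadD : forall a (U : opens Y) (m m' n : msec M U),
    quad a (m + m') n = quad a m n + quad a m' n;
  quadZ : forall a (U : opens Y) (r : sec U) (m n : msec M U),
    quad a (r *: m) n = r *: quad a m n;
  quad_res : forall a (U V : opens Y) (h : V `<=` U) (m n : msec M U),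
    quad a (mres h m) (mres h n) =
    (mres h (quad a m n).1, mres h (quad a m n).2) }.

Section Charts.
Variables (k : fieldType) (X Y : space k) (f : smorphism X Y) (M : modsheaf Y).
Variables (jz jw : pushhom f M) (Phi : quadhom M).
Variable U : opens Y.

(* The three basis vectors m_1 m_1, m_1 m_2, m_2 m_2 of S^2 M. *)
Definition S2_index (r : 'I_3) : 'I_2 * 'I_2 :=
  nth (ord0, ord0) [:: (ord0, ord0); (ord0, ord_max); (ord_max, ord_max)] r.

Definition has_matrix (m : 'I_2 -> msec M U)
    (A : 'M[sec U]_(3 + 3 + 3, 2 + 2)) : Prop :=
  let block (a : 'I_3) : 'M[sec U]_(3, 2 + 2) :=
    nth (dsubmx A) [:: usubmx (usubmx A); dsubmx (usubmx A); dsubmx A] a in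
  forall (a r : 'I_3),
    Phi a U (m (S2_index r).1) (m (S2_index r).2) =
    (\sum_l block a r (lshift 2 l) *: m l, \sum_l block a r (rshift 2 l) *: m l).

(* (z_1, z_2, w_1, w_2) as sections of f_* O_X *)
Definition zw (z w : 'I_2 -> sec (preim f U)) (i : 'I_(2 + 2)) :
    sec (preim f U) :=
  match fintype.split i with inl l => z l | inr l => w l end.

(* The equality f_* O_X = O_Y[z, w] / <relations> over U.  Both sides are
   sheaves on U, so it is required on all open subsets; those with zero ring of
   sections are left out, as {mpoly R[4]} needs a nonzero ring. *)
Definition presented_over (x : 'I_(2 + 2) -> sec (preim f U))
    (A : 'M[sec U]_(3 + 3 + 3, 2 + 2)) (d : 'cV[sec U]_(3 + 3 + 3)) : Prop :=
  forall (V : opens Y) (h : V `<=` U)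
    (nzR : 1 != 0 :> sec V) (nzB : 1 != 0 :> sec (preim f V)),
    @presented_by (nzRing nzR) (scal V (2%:R^-1 : k))
      (map_mx (res h) A) (map_mx (res h) d) (nzRing nzB) (pull f V)
      (fun i => res (preim_sub (f := f) h) (x i)).

Definition flat_over (A : 'M[sec U]_(3 + 3 + 3, 2 + 2))
    (d : 'cV[sec U]_(3 + 3 + 3)) : Prop :=
  forall (V : opens Y) (h : V `<=` U) (nzR : 1 != 0 :> sec V),
    @flat_deformation (nzRing nzR) (scal V (2%:R^-1 : k))
      (map_mx (res h) A) (map_mx (res h) d).

(* Over U and in the basis m of M, the homomorphism Phi is the linear one with
   parameters e and c, it determines a cover, with constants d, and f is this
   cover. *)
Definition defined_on (e : 'I_4 -> k) (m : 'I_2 -> msec M U)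
    (c : 'I_4 -> sec U) (d : 'cV[sec U]_(3 + 3 + 3)) : Prop :=
  let A := linear_Phi_mx (fun i => scal U (e i)) c in
  [/\ is_basis m, has_matrix m A, flat_over A d &
      presented_over (zw (fun i => jz U (m i)) (fun i => jw U (m i))) A d].

(* The coordinates Z' = g_11 Z + g_12 W, W' = g_21 Z + g_22 W. *)
Definition changed_zw (g : 'M[k]_2) (m : 'I_2 -> msec M U) :
    'I_(2 + 2) -> sec (preim f U) :=
  let row r i := scal (preim f U) (g r ord0) * jz U (m i)
               + scal (preim f U) (g r ord_max) * jw U (m i) in
  zw (row ord0) (row ord_max).

Definition normal_form_on (x : 'I_(2 + 2) -> sec (preim f U))
    (c : 'I_4 -> sec U) : Prop :=
  presented_over x (normal_Phi_mx c) (normal_const (scal U (2%:R^-1 : k)) c).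
End Charts.

(* Main.v *)
(** A covering homomorphism with constants e is a trace-free commutative product on
    k^2, that is, a binary cubic form, and its discriminant is not zero. As k is
    algebraically closed, a change of basis in GL_2(k) brings the product to
    u u = v, u v = 0, v v = u. Associativity and the freeness of f_* O_X then force
    the constant terms of the relations, which gives the normal form.

    In these coordinates (z, w) |-> (om z, om^2 w), with om a primitive cube root of
    unity, and (z, w) |-> (w, z) preserve the relations and generate an action of S_3
    permuting theta_i = om^i z + om^(-i) w. The summand wedge^2 M embeds by
    m /\ n |-> z(m) w(n) - z(n) w(m); the invariants are O + theta_i(M) for a
    transposition, O + wedge^2 M for a 3-cycle, and O for S_3.

    The quotient X/G carries the quotient topology and the sheaf of invariant
    sections. It is affine over Y because G is transitive on the primes above a prime
    of the invariant ring (prime avoidance), and because basic opens of X contain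
    saturated ones, defined by norms. *)
Require Import Defs.
From HB Require Import structures.
From mathcomp Require Import all_boot all_order all_algebra all_fingroup.
From mathcomp Require Import mathcomp_extra boolp classical_sets functions topology.
From mathcomp Require Import generic_quotient ring.
From mathcomp Require mpoly.
Set Implicit Arguments.
Unset Strict Implicit.
Unset Printing Implicit Defensive.
Import GRing.Theory.
Local Open Scope classical_set_scope.
Local Open Scope ring_scope.
Import Defs.

(** * Sections of sheaves *)

(** The given summand [L] sits in f_* O_X by an unspecified map [jl], not by z(m) w(n) - z(n) w(m).
    The universal property yields this second map [lam], and it has to be shown that [lam] is a
    complement of O + M + M as well. The universal property gives no local basis of [L]; instead [L]
    turns out to be locally cyclic, and a surjective endomorphism of a cyclic module is injective.
    The new decomposition is global, so automorphisms are defined by one global formula and charts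
    serve only to check multiplicativity. A Y-endomorphism of X is recovered from its effect on f_*
    O_X: points are inverse images of primes, and pullbacks of sections are computed on fractions
    b/a of sections over preimages of opens of Y. The difficulty is independence of the fraction. An
    algebra endomorphism is determined on the theta_i(M) and [lam](L), so the group law of the lifts
    is that of S_3 and no relation between generators is verified. Traces divided by the group order
    give lying over, finiteness of the quotients, and the extension of sections from basic opens. *)

Lemma opens_eq (T : topologicalType) (U V : opens T) :
  (forall x, U x <-> V x) -> U = V.
Proof.
case: U V => [U oU] [V oV] h; have UV : U = V by apply/predeqP => x; exact: h.
by case: V / UV oV h => oV _; congr Opens; exact: Prop_irrelevance.
Qed.

Definition opensI (T : topologicalType) (U V : opens T) : opens T :=
  Opens (openI (open_oset U) (open_oset V)).

Lemma opensIl (T : topologicalType) (U V : opens T) : opensI U V `<=` U.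
Proof. by move=> x []. Qed.

Lemma opensIr (T : topologicalType) (U V : opens T) : opensI U V `<=` V.
Proof. by move=> x []. Qed.

Section Sheaf.
Variables (k : fieldType) (X : space k).
Implicit Types (U V W : opens X) (x : X).

Lemma res_irr U V (h h' : V `<=` U) (s : sec U) : res h s = res h' s.
Proof. by rewrite (Prop_irrelevance h h'). Qed.

(** Both [s] and [t] glue the local restrictions of [t], and gluings are unique. *)
Lemma sec_sep U (s t : sec U) :
  (forall x, U x -> exists (V : opens X) (h : V `<=` U),
     V x /\ res h s = res h t) -> s = t.
Proof.
move=> loc; pose I := {x | U x}.
pose F (i : I) : opens X := projT1 (cid (loc _ (projT2 i))).
have FP (i : I) : exists h : F i `<=` U, F i (projT1 i) /\ res h s = res h t.
  exact: projT2 (cid (loc _ (projT2 i))).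
have hF i : F i `<=` U by case: (FP i).
have cov : U `<=` \bigcup_i F i.
  by move=> x Ux; exists (exist _ x Ux) => //; case: (FP (exist _ x Ux)) => h [].
have [i j W hi hj|u [_ uu]] := sec_glue hF cov (s := fun i => res (hF i) t).
  have hW : W `<=` U by move=> x /hi /hF.
  by rewrite !(res_comp _ _ hW).
rewrite -(uu t) // -(uu s) // => i; case: (FP i) => h [_].
by rewrite !(res_irr h (hF i)).
Qed.

(** Descent for a section characterized by a property: the uniqueness hypothesis supplies the
    compatibility on overlaps. It produces inverses of sections and pullbacks along the morphisms
    built from algebra endomorphisms. *)
Lemma local_section U (P : forall V : opens X, sec V -> Prop) :
  (forall V V' (h : V' `<=` V) t, V `<=` U -> P V t -> P V' (res h t)) ->
  (forall V t t', V `<=` U -> P V t -> P V t' -> t = t') ->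
  (forall x, U x -> exists (V : opens X) (t : sec V), [/\ V `<=` U, V x & P V t]) ->
  (forall t : sec U,
    (forall x, U x -> exists (V : opens X) (h : V `<=` U),
       V x /\ P V (res h t)) -> P U t) ->
  exists t : sec U, P U t.
Proof.
move=> Pres Puniq loc Ploc; pose I := {x | U x}.
pose F (i : I) : opens X := projT1 (cid (loc _ (projT2 i))).
have FP (i : I) : exists t : sec (F i), [/\ F i `<=` U, F i (projT1 i) & P (F i) t].
  exact: projT2 (cid (loc _ (projT2 i))).
pose s (i : I) : sec (F i) := projT1 (cid (FP i)).
have sP (i : I) : [/\ F i `<=` U, F i (projT1 i) & P (F i) (s i)].
  exact: projT2 (cid (FP i)).
have hF i : F i `<=` U by case: (sP i).
have cov : U `<=` \bigcup_i F i.
  by move=> x Ux; exists (exist _ x Ux) => //; case: (sP (exist _ x Ux)).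
have [i j W hi hj|u [uP _]] := sec_glue hF cov (s := s).
  apply: Puniq; first by move=> x /hi /hF.
    by apply: Pres => //; case: (sP i).
  by apply: Pres => //; case: (sP j).
exists u; apply: Ploc => x Ux.
exists (F (exist _ x Ux)), (hF _); rewrite uP.
by case: (sP (exist _ x Ux)).
Qed.

Lemma unit_near_res U V (h : V `<=` U) (s : sec U) x :
  V x -> unit_near (res h s) x <-> unit_near s x.
Proof.
move=> Vx; split=> [[W [hW [Wx [t st]]]]|[W [hW [Wx [t st]]]]].
  have hWU : W `<=` U by move=> y /hW /h.
  by exists W, hWU; split=> //; exists t; rewrite -(res_comp h hW).
exists (opensI W V), (@opensIr _ W V); split=> //.
exists (res (@opensIl _ W V) t).
have hU : opensI W V `<=` U by move=> y [/hW].
rewrite (res_comp _ _ hU) -(res_comp hW (@opensIl _ W V)) -rmorphM st.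
by rewrite rmorph1.
Qed.

Lemma unit_nearM U (s t : sec U) x :
  unit_near (s * t) x <-> unit_near s x /\ unit_near t x.
Proof.
split=> [[W [h [Wx [u su]]]]|[[V [h [Vx [u su]]]] [W [h' [Wx [u' su']]]]]].
  split; exists W, h; split=> //; rewrite rmorphM in su.
    by exists (res h t * u); rewrite mulrA.
  by exists (res h s * u); rewrite mulrA [res h t * _]mulrC.
have hI : opensI V W `<=` U by move=> y [/h].
exists (opensI V W), hI; split=> //.
exists (res (@opensIl _ V W) u * res (@opensIr _ V W) u').
rewrite rmorphM mulrACA -(res_comp h (@opensIl _ V W)) -rmorphM su rmorph1.
by rewrite -(res_comp h' (@opensIr _ V W)) -rmorphM su' rmorph1 mulr1.
Qed.

Lemma unit_near1 U x : U x -> unit_near (1 : sec U) x.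
Proof.
move=> Ux; exists U, (@subset_refl _ U); split=> //.
by exists 1; rewrite rmorph1 mulr1.
Qed.

Lemma unit_near_sub U (s : sec U) x : unit_near s x -> U x.
Proof. by case=> V [h [/h]]. Qed.

Lemma unit_nearX U (s : sec U) n x :
  unit_near s x -> unit_near (s ^+ n) x.
Proof.
move=> sx; elim: n => [|n IH]; first exact: unit_near1 (unit_near_sub sx).
by rewrite exprS; apply/unit_nearM.
Qed.

(** Inverses are unique, so the local ones glue. *)
Lemma inverse_glue U (s : sec U) :
  (forall x, U x -> unit_near s x) -> exists t, s * t = 1.
Proof.
move=> su.
pose P (V : opens X) (t : sec V) :=
  V `<=` U /\ forall h : V `<=` U, res h s * t = 1.
have [|||t tP|t [_ tP]] := @local_section U P.
- move=> V V' h t VU [_ tP]; split=> [|h']; first exact: subset_trans h VU.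
  by rewrite -(res_comp VU h) -rmorphM tP rmorph1.
- move=> V t t' VU [_ tP] [_ tP'].
  by rewrite -[t]mulr1 -(tP' VU) mulrA [t * _]mulrC tP mul1r.
- move=> x /su [V [h [Vx [t st]]]]; exists V, t; split=> //; split=> // h'.
  by rewrite -st (res_irr h h').
- split=> // h; rewrite res_id; apply: sec_sep => x /tP [V [h' [Vx [_ tP']]]].
  by exists V, h'; split=> //; rewrite rmorphM rmorph1 tP'.
by exists t; rewrite -(tP (@subset_refl _ U)) res_id.
Qed.

Lemma unit_cancel U (s a b : sec U) :
  (forall x, U x -> unit_near s x) -> s * a = s * b -> a = b.
Proof.
move=> /inverse_glue [t st] sab.
by rewrite -[a]mul1r -[b]mul1r -st [s * t]mulrC -!mulrA sab.
Qed.

Lemma basicE U (s : sec U) x : basic s x <-> unit_near s x.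
Proof. by []. Qed.

End Sheaf.

Section Pull.
Variables (k : fieldType) (X Y : space k) (f : smorphism X Y).

Lemma unit_near_pull (V : opens Y) (s : sec V) x :
  V (f x) -> unit_near (pull f V s) x <-> unit_near s (f x).
Proof.
move=> Vx; split; first exact: pull_local.
case=> W [h [Wx [t st]]]; exists (preim f W), (preim_sub (f := f) h); split=> //.
by exists (pull f W t); rewrite -(pull_res h) -rmorphM st rmorph1.
Qed.

Lemma basic_pull (V : opens Y) (s : sec V) :
  basic (pull f V s) = preim f (basic s).
Proof.
apply: opens_eq => x; split=> [xs|xs].
  by apply/(unit_near_pull (V := V)) => //; exact: (unit_near_sub xs).
by apply/(unit_near_pull (V := V)) => //; exact: (basic_sub xs).
Qed.
End Pull.

(** * Morphisms between schemes affine over a base *)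

Section Affine.
Variables (k : fieldType) (X : space k) (U : opens X).
Hypothesis affU : affine U.

(** Here and in [affine_extend], D(s) is replaced by any open set [W] with the same points, since in
    the applications [W] is a preimage that agrees with [basic s] only propositionally. *)
Lemma affine_zero (s a : sec U) (W : opens X) (hW : W `<=` U) :
  (forall x, W x <-> unit_near s x) -> res hW a = 0 -> exists n, s ^+ n * a = 0.
Proof.
move=> WE; have E : W = basic s by apply: opens_eq.
subst W => a0; case: affU => _ _ _ /(_ s) [+ _]; apply.
by rewrite -a0; exact: res_irr.
Qed.

Lemma affine_extend (s : sec U) (W : opens X) (hW : W `<=` U) :
  (forall x, W x <-> unit_near s x) -> forall b : sec W,
  exists (a : sec U) (n : nat), res hW a = res hW s ^+ n * b.
Proof.
move=> WE; have E : W = basic s by apply: opens_eq.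
subst W => b; case: affU => _ _ _ /(_ s) [_ /(_ b) [a [n e]]].
by exists a, n; rewrite !(res_irr hW (@basic_sub _ _ _ s)).
Qed.

Lemma affine_basic (V : opens X) x : V x -> U x ->
  exists s : sec U, unit_near s x /\ forall y, unit_near s y -> V y.
Proof.
move=> Vx Ux; case: affU => _ _ /(_ (opensI V U) x) + _.
move=> /(_ (@opensIr _ V U) (conj Vx Ux)) [s [sx sV]].
by exists s; split=> // y /sV [].
Qed.

Lemma affine_point_inj x x' : U x -> U x' ->
  (forall s : sec U, unit_near s x <-> unit_near s x') -> x = x'.
Proof.
move=> Ux Ux' xx'; case: affU => primeU /(_ _ (primeU _ Ux)) [z [_ uz]] _ _.
have -> : x = z by apply/esym/uz; split.
by apply: uz; split=> // s; split=> sx sx'; apply: sx; apply/xx'.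
Qed.
End Affine.

Definition affine_morphism k (X Y : space k) (f : smorphism X Y) : Prop :=
  forall y : Y, exists V : opens Y, [/\ V y, affine V & affine (preim f V)].

Lemma finite_affine k (X Y : space k) (f : smorphism X Y) :
  finite_morphism f -> affine_morphism f.
Proof. by move=> fin y; case: (fin y) => V [*]; exists V. Qed.

(** Endomorphisms of the O_Y-algebra f_* O_X: for f affine, the algebraic form of the endomorphisms
    of X over Y, with arrows reversed. *)
Record algend k (X Y : space k) (f : smorphism X Y) := Algend {
  aend :> forall V : opens Y, {rmorphism sec (preim f V) -> sec (preim f V)};
  aend_res : forall (U V : opens Y) (h : V `<=` U) (s : sec (preim f U)),
    aend V (res (preim_sub (f := f) h) s) = res (preim_sub (f := f) h) (aend U s);
  aend_pull : forall (V : opens Y) (a : sec V), aend V (pull f V a) = pull f V a }.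

Section EndoMorphism.
Variables (k : fieldType) (X Y : space k) (f : smorphism X Y).
Hypothesis afff : affine_morphism f.
Variable sigma : algend f.

(** The point x' corresponds to the inverse image under [sigma V] of the prime of x, for one affine
    V around f x. It lies over f x because [sigma] fixes the sections that come from Y; what remains
    is that every other V' gives the same point. *)
Lemma endo_point (x : X) : exists x' : X, f x' = f x /\
  forall (V : opens Y) (s : sec (preim f V)), V (f x) ->
    (unit_near s x' <-> unit_near (sigma V s) x).
Proof.
have [V [Vx affV affW]] := afff (f x); set W := preim f V in affW.
pose P (s : sec W) := ~ unit_near (sigma V s) x.
have primeP : prime_ideal P.
  case: (affW) => /(_ x Vx) [p0 pD pM p1 pp] _ _ _.
  split; rewrite /P ?rmorph0 ?rmorph1 //.
  - by move=> a b; rewrite rmorphD; exact: pD.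
  - by move=> a b; rewrite rmorphM; exact: pM.
  - by move=> a b; rewrite rmorphM; exact: pp.
case: (affW) => _ /(_ P primeP) [x' [[Wx' x'P] _]] _ _.
have xP s : unit_near s x' <-> unit_near (sigma V s) x.
  by rewrite -(notK (unit_near s x')) -x'P notK.
have fx' : f x' = f x.
  apply: (affine_point_inj affV) => // a.
  rewrite -(unit_near_pull a Wx') -(unit_near_pull a (x := x) Vx).
  by rewrite -{2}(aend_pull sigma a); exact: xP.
exists x'; split=> // V' s V'x.
(* Over D(a), which lies in V and V', the section s is a fraction beta / a^n with beta over the
   preimage of V. As [sigma] fixes a, the statement for s reduces to that for beta. *)
have [a [ax aV']] := affine_basic affV V'x Vx.
have hV : basic a `<=` V := @basic_sub _ _ _ a.
have hV' : basic a `<=` V' by [].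
have [|beta [n e]] := affine_extend affW (s := pull f V a) (preim_sub (f := f) hV)
    _ (res (preim_sub (f := f) hV') s).
  by move=> z; rewrite -basic_pull.
have ax' : basic a (f x') by rewrite fx'.
have e' : res (preim_sub (f := f) hV) (sigma V beta) =
    res (preim_sub (f := f) hV) (pull f V a) ^+ n *
    res (preim_sub (f := f) hV') (sigma V' s).
  by rewrite -aend_res e rmorphM rmorphXn /= !aend_res aend_pull.
have u1 z : basic a (f z) ->
    unit_near (res (preim_sub (f := f) hV) (pull f V a) ^+ n) z.
  move=> az; apply: unit_nearX; apply/unit_near_res => //.
  by apply/unit_near_pull => //; exact: (hV (f z)).
rewrite -(unit_near_res (preim_sub (f := f) hV') _ (x := x)) //.
rewrite -(unit_near_res (preim_sub (f := f) hV') _ (x := x')) //.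
have -> : unit_near (res (preim_sub (f:=f) hV') s) x' <-> unit_near beta x'.
  rewrite -(unit_near_res (preim_sub (f := f) hV) _ (x := x')) // e unit_nearM.
  by have := u1 x' ax'; tauto.
rewrite xP -(unit_near_res (preim_sub (f := f) hV) _ (x := x)) // e' unit_nearM.
by have := u1 x ax; tauto.
Qed.

Definition endo_map (x : X) : X := projT1 (cid (endo_point x)).

Lemma endo_mapf x : f (endo_map x) = f x.
Proof. by case: (projT2 (cid (endo_point x))). Qed.

Lemma endo_mapP (V : opens Y) (s : sec (preim f V)) x : V (f x) ->
  unit_near s (endo_map x) <-> unit_near (sigma V s) x.
Proof. by case: (projT2 (cid (endo_point x))) => _; exact. Qed.

Lemma endo_map_cont : continuous endo_map.
Proof.
apply/continuousP => W oW; rewrite openE => x Wx.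
have [V [Vx affV affW]] := afff (f x).
have [|s [sx sW]] := affine_basic affW (V := Opens oW) (Wx : Opens oW (endo_map x)).
  by rewrite /in_opens /= /preimage /= endo_mapf.
have := (endo_mapP s Vx).1 sx => ssx.
apply: (filterS _ (open_nbhs_nbhs (conj (open_unit_near (sigma V s)) ssx))).
move=> y sy; apply: sW; apply/endo_mapP => //.
exact: (unit_near_sub sy).
Qed.

(* The sections over W are locally fractions of sections over preimages of
   opens of Y, on which the pullback has to be sigma. *)
Lemma endo_fraction (W : opens X) (s : sec W) (x : X) : W x ->
  exists (V : opens Y) (a b : sec (preim f V)) (O : opens X)
    (hO : O `<=` W) (hV : O `<=` preim f V),
    [/\ V (f x), O x, forall y, O y -> unit_near a y &
        res hV a * res hO s = res hV b].
Proof.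
move=> Wx; have [V [Vx affV affW]] := afff (f x).
have [a [ax aW]] := affine_basic affW Wx Vx.
have hO : basic a `<=` W := aW.
have [b [n e]] := affine_extend affW (@basic_sub _ _ _ a) (@basicE _ _ _ a)
  (res hO s).
exists V, (a ^+ n), b, (basic a), hO, (@basic_sub _ _ _ a); split=> //.
  by move=> y; exact: unit_nearX.
by rewrite rmorphXn e.
Qed.

(** This makes the pullback independent of the chosen fraction. Near the image of x, some power of a
    section u that is invertible there kills c, up to a denominator from Y. Applying [sigma] turns u
    into a section invertible near x, so [sigma V c] vanishes near x. *)
Lemma endo_zero (V : opens Y) (c : sec (preim f V)) (W O : opens X)
    (hW : W `<=` preim f V) (hO : O `<=` preim f V) :
  res hW c = 0 -> (forall x, O x -> W (endo_map x)) -> res hO (sigma V c) = 0.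
Proof.
move=> c0 OW; apply: sec_sep => x Ox.
have Vx : V (f x) := hO x Ox.
have [V3 [V3x affV affW]] := afff (f x).
have [a [ax aV]] := affine_basic affV Vx V3x.
have h3 : basic a `<=` V3 := @basic_sub _ _ _ a.
have hV : basic a `<=` V by [].
have [|gam [n e]] := affine_extend affW (s := pull f V3 a) (preim_sub (f := f) h3)
    _ (res (preim_sub (f := f) hV) c).
  by move=> z; rewrite -basic_pull.
pose Wa := opensI W (preim f (basic a)).
have Wax : Wa (endo_map x).
  by split; [exact: OW|rewrite /preim /= /preimage /= endo_mapf].
have [|u [ux uW]] := affine_basic affW Wax.
  by rewrite /in_opens /= /preimage /= endo_mapf.
have hu : basic u `<=` preim f V3 := @basic_sub _ _ _ u.
have hua : basic u `<=` preim f (basic a) by move=> y /uW [].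
have huW : basic u `<=` W by move=> y /uW [].
have huV : basic u `<=` preim f V by move=> y /hua /hV.
have gam0 : res hu gam = 0.
  rewrite -(res_comp (preim_sub (f := f) h3) hua) e rmorphM.
  by rewrite !(res_comp _ _ huV) -(res_comp hW huW) c0 rmorph0 mulr0.
have [m um] := affine_zero affW (@basicE _ _ _ u) gam0.
have sum : sigma V3 u ^+ m * sigma V3 gam = 0.
  by rewrite -rmorphXn -rmorphM um rmorph0.
have sux : unit_near (sigma V3 u) x by exact: (endo_mapP u V3x).1 ux.
pose N := opensI (opensI O (preim f (basic a))) (basic (sigma V3 u)).
have NO : N `<=` O by move=> y [[]].
have Na : N `<=` preim f (basic a) by move=> y [[]].
have N3 : N `<=` preim f V3 by move=> y /Na /h3.
have NV : N `<=` preim f V by move=> y /Na /hV.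
exists N, NO; split; first by split; first split.
rewrite (res_comp _ _ NV) rmorph0.
apply: (unit_cancel (s := res N3 (sigma V3 u ^+ m * pull f V3 a ^+ n))).
  move=> y [[Oy ay] uy]; rewrite rmorphM; apply/unit_nearM.
  split; apply/unit_near_res => //; apply: unit_nearX => //.
  by apply/unit_near_pull; [exact: (h3 (f y))|].
rewrite mulr0 rmorphM -mulrA.
have -> : res N3 (pull f V3 a ^+ n) * res NV (sigma V c) = res N3 (sigma V3 gam).
  rewrite -(res_comp (preim_sub (f := f) h3) Na) -(res_comp (preim_sub (f := f) hV) Na).
  rewrite -(res_comp (preim_sub (f := f) h3) Na) -rmorphM -!aend_res e.
  by rewrite !rmorphM !rmorphXn /= !aend_res aend_pull.
by rewrite -rmorphM sum rmorph0.
Qed.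

(** The section t is the pullback of s: every relation a s = b is carried to sigma(a) t = sigma(b).
    Quantifying over all such relations, with a invertible or not, avoids a choice and makes the
    property pass to smaller opens. *)
Definition endo_rel (W : opens X) (s : sec W) (O : opens X) (t : sec O) : Prop :=
  forall (V : opens Y) (a b : sec (preim f V)) (W' O' : opens X)
    (hW : W' `<=` W) (hV : W' `<=` preim f V)
    (hO : O' `<=` O) (hO' : O' `<=` preim f V),
    (forall x, O' x -> W' (endo_map x)) ->
    res hV a * res hW s = res hV b ->
    res hO' (sigma V a) * res hO t = res hO' (sigma V b).

Lemma endo_rel_uniq (W : opens X) (s : sec W) (O : opens X) (t t' : sec O) :
  O `<=` opreim endo_map_cont W -> endo_rel s t -> endo_rel s t' -> t = t'.
Proof.
move=> OW st st'; apply: sec_sep => x Ox.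
have Wx : W (endo_map x) := OW x Ox.
have [V [a [b [W' [hW [hV [Vx W'x au e]]]]]]] := endo_fraction s Wx.
pose N := opensI O (opreim endo_map_cont W').
have NO : N `<=` O by move=> y [].
have NV : N `<=` preim f V.
  by move=> y [_ W'y]; have := hV _ W'y; rewrite /preim /= /preimage /= endo_mapf.
exists N, NO; split=> //.
have NW y : N y -> W' (endo_map y) by case.
apply: (unit_cancel (s := res NV (sigma V a))).
  move=> y Ny; apply/unit_near_res => //; apply/endo_mapP; first exact: (NV y).
  by apply: au; exact: NW.
by rewrite (st V a b W' N hW hV NO NV NW e) (st' V a b W' N hW hV NO NV NW e).
Qed.

(** One fraction with invertible denominator near each point suffices, since any two fractions for s
    can be cross-multiplied. *)
Lemma endo_rel_intro (W : opens X) (s : sec W) (O : opens X) (t : sec O) :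
  (forall x, O x -> exists (V : opens Y) (a b : sec (preim f V)) (W' O' : opens X)
    (hW : W' `<=` W) (hV : W' `<=` preim f V)
    (hO : O' `<=` O) (hO' : O' `<=` preim f V),
    [/\ O' x, forall y, O' y -> W' (endo_map y), forall y, W' y -> unit_near a y,
      res hV a * res hW s = res hV b &
      res hO' (sigma V a) * res hO t = res hO' (sigma V b)]) ->
  endo_rel s t.
Proof.
move=> loc V2 a2 b2 W2 O2 hW2 hV2 hO2 hO2' O2W e2; apply: sec_sep => x O2x.
have [V [a [b [W' [O' [hW [hV [hO [hO' [O'x OW au e E]]]]]]]]]] := loc x (hO2 x O2x).
pose VI := opensI V V2; pose W3 := opensI W' W2; pose N := opensI O' O2.
have W31 : W3 `<=` W' by move=> y [].
have W32 : W3 `<=` W2 by move=> y [].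
have W3W : W3 `<=` W by move=> y [/hW].
have W3V : W3 `<=` preim f V by move=> y [/hV].
have W3V2 : W3 `<=` preim f V2 by move=> y [_ /hV2].
have h1 : VI `<=` V by move=> y [].
have h2 : VI `<=` V2 by move=> y [].
have W3I : W3 `<=` preim f VI by move=> y [] /hV ? /hV2.
have N1 : N `<=` O' by move=> y [].
have N2 : N `<=` O2 by move=> y [].
have NV : N `<=` preim f V by move=> y [/hO'].
have NV2 : N `<=` preim f V2 by move=> y [_ /hO2'].
have NO : N `<=` O by move=> y [/hO].
have NI : N `<=` preim f VI by move=> y Ny; split; [exact: NV Ny|exact: NV2 Ny].
(* From a s = b and a2 s = b2 follows a2 b - a b2 = 0 where both hold; [endo_zero] transports this
   equation. *)
pose c := res (preim_sub (f := f) h2) a2 * res (preim_sub (f := f) h1) b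
        - res (preim_sub (f := f) h1) a * res (preim_sub (f := f) h2) b2.
have c0 : res W3I c = 0.
  rewrite rmorphB !rmorphM !(res_comp _ _ W3V) !(res_comp _ _ W3V2).
  rewrite -(res_comp hV W31) -(res_comp hV W31) -e.
  rewrite -(res_comp hV2 W32) -(res_comp hV2 W32) -e2 !rmorphM.
  by rewrite !(res_comp _ _ W3W) mulrCA subrr.
have := endo_zero NI c0 (fun y Ny => conj (OW y (N1 y Ny)) (O2W y (N2 y Ny))).
rewrite /c !rmorphB !rmorphM !aend_res.
rewrite !(res_comp _ _ NV) !(res_comp _ _ NV2) => /subr0_eq E'.
exists N, N2; split=> //; rewrite rmorphM !(res_comp _ _ NV2) !(res_comp _ _ NO).
apply: (unit_cancel (s := res NV (sigma V a))).
  move=> y Ny; apply/unit_near_res => //; apply/endo_mapP; first exact: (NV y Ny).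
  by apply: au; apply: OW; exact: N1.
rewrite -E' mulrCA; congr (_ * _).
rewrite -(res_comp hO' N1) -(res_comp hO' N1) -E rmorphM.
by rewrite (res_comp _ _ NO).
Qed.

Lemma endo_rel_exists (W : opens X) (s : sec W) :
  exists t : sec (opreim endo_map_cont W), endo_rel s t.
Proof.
apply: (@local_section _ X _ (fun O (t : sec O) => endo_rel s t)).
- move=> O O' h t _ st V a b W' O2 hW hV hO hO' OW e.
  by rewrite (res_comp _ _ (subset_trans hO h)); exact: (st V a b W' O2 hW hV).
- move=> O t t1 OW st st1; exact: (endo_rel_uniq OW st st1).
- move=> x Wx.
  have [V [a [b [W' [hW [hV [Vx W'x au e]]]]]]] := endo_fraction s (Wx : W (endo_map x)).
  pose O := opreim endo_map_cont W'.
  have OV : O `<=` preim f V.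
    by move=> y W'y; have := hV _ W'y; rewrite /preim /= /preimage /= endo_mapf.
  have [|a' aa'] := @inverse_glue _ _ _ (res OV (sigma V a)).
    move=> y Oy; apply/unit_near_res => //; apply/endo_mapP; first exact: (OV y).
    exact: au.
  exists O, (res OV (sigma V b) * a'); split=> //; first by move=> y /hW.
  apply: endo_rel_intro => y Oy.
  exists V, a, b, W', O, hW, hV, (fun _ => id), OV; split=> //.
  by rewrite res_id mulrCA aa' mulr1.
- move=> t st V a b W' O' hW hV hO hO' OW e; apply: sec_sep => x O'x.
  have [O2 [h2 [O2x stx]]] := st x (hO x O'x).
  pose N := opensI O' O2.
  exists N, (@opensIl _ _ _); split=> //.
  have NO2 : N `<=` O2 by move=> y [].
  have NO' : N `<=` O' by move=> y [].
  have NV : N `<=` preim f V by move=> y /NO' /hO'.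
  have := stx V a b W' N hW hV NO2 NV (fun y Ny => OW y (NO' y Ny)) e.
  by rewrite rmorphM !(res_comp _ _ NV) !(res_comp _ _ (subset_trans NO' hO)).
Qed.

Definition endo_pull0 (W : opens X) (s : sec W) : sec (opreim endo_map_cont W) :=
  projT1 (cid (endo_rel_exists s)).

Lemma endo_pull0P (W : opens X) (s : sec W) : endo_rel s (endo_pull0 s).
Proof. exact: projT2 (cid (endo_rel_exists s)). Qed.

Lemma endo_pull0_eq (W : opens X) (s : sec W) t : endo_rel s t -> endo_pull0 s = t.
Proof. by move=> st; exact: (endo_rel_uniq (fun _ => id) (@endo_pull0P W s) st). Qed.

(** Two sections are brought to the common denominator a1 a2, so that differences and products of
    pullbacks can be compared on numerators. *)
Lemma endo_rel_pair (W : opens X) (s s' : sec W) (O : opens X) (t t' : sec O) x :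
  O `<=` opreim endo_map_cont W -> endo_rel s t -> endo_rel s' t' -> O x ->
  exists (V : opens Y) (a b b' : sec (preim f V)) (W' O' : opens X)
    (hW : W' `<=` W) (hV : W' `<=` preim f V)
    (hO : O' `<=` O) (hO' : O' `<=` preim f V),
    [/\ O' x, forall y, O' y -> W' (endo_map y), forall y, W' y -> unit_near a y,
      res hV a * res hW s = res hV b /\ res hV a * res hW s' = res hV b' &
      res hO' (sigma V a) * res hO t = res hO' (sigma V b) /\
      res hO' (sigma V a) * res hO t' = res hO' (sigma V b')].
Proof.
move=> OW st st' Ox; have Wx := OW x Ox.
have [V1 [a1 [b1 [W1 [hW1 [hV1 [Vx1 Wx1 au1 e1]]]]]]] := endo_fraction s Wx.
have [V2 [a2 [b2 [W2 [hW2 [hV2 [Vx2 Wx2 au2 e2]]]]]]] := endo_fraction s' Wx.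
pose V := opensI V1 V2; pose W' := opensI W1 W2.
have h1 : V `<=` V1 := @opensIl _ V1 V2.
have h2 : V `<=` V2 := @opensIr _ V1 V2.
have hW'1 : W' `<=` W1 by move=> y [].
have hW'2 : W' `<=` W2 by move=> y [].
have hW : W' `<=` W by move=> y [/hW1].
have W'V1 : W' `<=` preim f V1 by move=> y [/hV1].
have W'V2 : W' `<=` preim f V2 by move=> y [_ /hV2].
have hV : W' `<=` preim f V by move=> y [/hV1 ? /hV2].
pose O' := opensI O (opreim endo_map_cont W').
have hO : O' `<=` O by move=> y [].
have OW' y : O' y -> W' (endo_map y) by case.
have hO' : O' `<=` preim f V.
  by move=> y /OW' /hV; rewrite /preim /= /preimage /= endo_mapf.
have hO1 : O' `<=` preim f V1 by move=> y /hO' /h1.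
have hO2 : O' `<=` preim f V2 by move=> y /hO' /h2.
exists V, (res (preim_sub (f := f) h1) a1 * res (preim_sub (f := f) h2) a2), (res (preim_sub (f := f) h2) a2 * res (preim_sub (f := f) h1) b1), (res (preim_sub (f := f) h1) a1 * res (preim_sub (f := f) h2) b2).
exists W', O', hW, hV, hO, hO'.
split=> //.
- move=> y W'y; have [y1 y2] := W'y; apply/unit_nearM; split.
    by apply/unit_near_res; [exact: (hV y)|exact: au1].
  by apply/unit_near_res; [exact: (hV y)|exact: au2].
- rewrite !rmorphM !(res_comp _ _ W'V1) !(res_comp _ _ W'V2).
  rewrite -(res_comp hW1 hW'1) -!(res_comp hV1 hW'1) -!(res_comp hV2 hW'2) -e1 -e2.
  by rewrite !rmorphM !(res_comp _ _ hW); split; ring.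
rewrite !rmorphM !aend_res !(res_comp _ _ hO1) !(res_comp _ _ hO2).
rewrite -(st V1 a1 b1 W' O' hW W'V1 hO hO1 OW').
  rewrite -(st' V2 a2 b2 W' O' hW W'V2 hO hO2 OW'); first by split; ring.
  by rewrite -(res_comp hV2 hW'2) -(res_comp hW2 hW'2) -rmorphM e2 (res_comp _ _ W'V2).
by rewrite -(res_comp hV1 hW'1) -(res_comp hW1 hW'1) -rmorphM e1 (res_comp _ _ W'V1).
Qed.

Lemma endo_pull0_zmod (W : opens X) : zmod_morphism (@endo_pull0 W).
Proof.
move=> s s'; apply: endo_pull0_eq; apply: endo_rel_intro => x Ox.
have [V [a [b [b' [W' [O' [hW [hV [hO [hO' [O'x OW au [e e'] [E E']]]]]]]]]]]] :=
  endo_rel_pair (fun _ => id) (@endo_pull0P W s) (@endo_pull0P W s') Ox.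
exists V, a, (b - b'), W', O', hW, hV, hO, hO'; split=> //.
  by rewrite !rmorphB mulrBr e e'.
by rewrite !rmorphB mulrBr E E'.
Qed.

Lemma endo_pull0_monoid (W : opens X) : monoid_morphism (@endo_pull0 W).
Proof.
split=> [|s s']; apply: endo_pull0_eq; apply: endo_rel_intro => x Ox.
  have [V [a [b [W' [hW [hV [Vx W'x au e]]]]]]] := endo_fraction (1 : sec W) Ox.
  exists V, a, a, W', (opreim endo_map_cont W'), hW, hV.
  have hO : opreim endo_map_cont W' `<=` opreim endo_map_cont W by move=> y /hW.
  have hO' : opreim endo_map_cont W' `<=` preim f V.
    by move=> y /hV; rewrite /preim /= /preimage /= endo_mapf.
  by exists hO, hO'; rewrite !rmorph1 !mulr1.
have [V [a [b [b' [W' [O' [hW [hV [hO [hO' [O'x OW au [e e'] [E E']]]]]]]]]]]] :=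
  endo_rel_pair (fun _ => id) (@endo_pull0P W s) (@endo_pull0P W s') Ox.
exists V, (a * a), (b * b'), W', O', hW, hV, hO, hO'; split=> //.
- by move=> y W'y; apply/unit_nearM; split; exact: au.
- by rewrite !rmorphM mulrACA e e'.
by rewrite !rmorphM mulrACA E E'.
Qed.

Definition endo_pull (W : opens X) :
    {rmorphism sec W -> sec (opreim endo_map_cont W)} :=
  HB.pack_for {rmorphism sec W -> sec (opreim endo_map_cont W)} (@endo_pull0 W)
    (GRing.isZmodMorphism.Build _ _ (@endo_pull0 W) (@endo_pull0_zmod W))
    (GRing.isMonoidMorphism.Build _ _ (@endo_pull0 W) (@endo_pull0_monoid W)).

Lemma endo_pull_preim (V : opens Y) (s : sec (preim f V))
    (h : opreim endo_map_cont (preim f V) `<=` preim f V) :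
  endo_pull (preim f V) s = res h (sigma V s).
Proof.
apply: endo_pull0_eq; apply: endo_rel_intro => x Ox.
exists V, 1, s, (preim f V), (opreim endo_map_cont (preim f V)).
exists (fun _ => id), (fun _ => id), (fun _ => id), h.
rewrite !rmorph1 !mul1r !res_id; split=> // y Oy; exact: unit_near1.
Qed.

Lemma endo_pull_res (U W : opens X) (h : W `<=` U)
    (h' : opreim endo_map_cont W `<=` opreim endo_map_cont U) (s : sec U) :
  endo_pull W (res h s) = res h' (endo_pull U s).
Proof.
apply: endo_pull0_eq => V a b W' O' hW hV hO hO' OW e.
rewrite (res_comp _ _ (subset_trans hO h')).
apply: (@endo_pull0P U s V a b W' O' (subset_trans hW h) hV) => //.
by rewrite -e (res_comp _ _ (subset_trans hW h)).
Qed.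

Lemma endo_pull_scal (W : opens X) c :
  endo_pull W (scal W c) = scal (opreim endo_map_cont W) c.
Proof.
apply: endo_pull0_eq; apply: endo_rel_intro => x Ox.
have [V [a [b [W' [hW [hV [Vx W'x au e]]]]]]] := endo_fraction (scal W c) Ox.
exists V, a, (a * scal _ c), W', (opreim endo_map_cont W'), hW, hV.
have hO : opreim endo_map_cont W' `<=` opreim endo_map_cont W by move=> y /hW.
have hO' : opreim endo_map_cont W' `<=` preim f V.
  by move=> y /hV; rewrite /preim /= /preimage /= endo_mapf.
exists hO, hO'; rewrite !rmorphM !res_scal; split=> //.
by rewrite -!pull_scal aend_pull !pull_scal res_scal.
Qed.

Lemma endo_pull_local (W : opens X) (s : sec W) (x : X) :
  W (endo_map x) -> unit_near (endo_pull W s) x -> unit_near s (endo_map x).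
Proof.
move=> Wx tx.
have [V [a [b [W' [hW [hV [Vx W'x au e]]]]]]] := endo_fraction s Wx.
have hO : opreim endo_map_cont W' `<=` opreim endo_map_cont W by move=> y /hW.
have hO' : opreim endo_map_cont W' `<=` preim f V.
  by move=> y /hV; rewrite /preim /= /preimage /= endo_mapf.
have Vfx : V (f x) by rewrite -endo_mapf.
have E := @endo_pull0P W s V a b W' _ hW hV hO hO' (fun _ => id) e.
have sb : unit_near (sigma V b) x.
  apply/(unit_near_res hO') => //; rewrite -E; apply/unit_nearM; split.
    by apply/unit_near_res => //; apply/endo_mapP => //; exact: au.
  exact/unit_near_res.
apply/(unit_near_res hW) => //.
have : unit_near (res hV b) (endo_map x).
  by apply/unit_near_res => //; apply/endo_mapP.
by rewrite -e => /unit_nearM [].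
Qed.

Definition endo_morphism : smorphism X X :=
  Smorphism endo_pull_scal endo_pull_res endo_pull_local.

Lemma endo_morphism_over : eqmor (mcomp f endo_morphism) f.
Proof.
split=> [x|V s W hf hg]; first exact: endo_mapf.
have h : opreim endo_map_cont (preim f V) `<=` preim f V.
  by move=> y; rewrite /preim /= /preimage /= endo_mapf.
rewrite /= /mcomp_pull /=.
have -> : endo_pull0 (pull f V s) = res h (pull f V s).
  by rewrite -{2}(aend_pull sigma); exact: endo_pull_preim.
by rewrite (res_comp _ _ (h : preim (mcomp f endo_morphism) V `<=` preim f V))
  (res_comp _ _ hg).
Qed.

End EndoMorphism.

Section EndoUniq.
Variables (k : fieldType) (X Y : space k) (f : smorphism X Y).
Hypothesis afff : affine_morphism f.

(** Points are determined by the primes of sections over preimages of opens of Y, and arbitrary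
    sections are locally fractions of such sections. *)
Lemma endo_uniq (h h' : smorphism X X) :
  (forall x, f (h x) = f x) -> (forall x, f (h' x) = f x) ->
  (forall (V : opens Y) (s : sec (preim f V)) (W : opens X)
     (hh : W `<=` preim h (preim f V)) (hh' : W `<=` preim h' (preim f V)),
     res hh (pull h _ s) = res hh' (pull h' _ s)) ->
  eqmor h h'.
Proof.
move=> fh fh' E.
have pE x : h x = h' x.
  have [V [Vx affV affW]] := afff (f x).
  apply: (affine_point_inj affW).
  - by rewrite /in_opens /= /preimage /= fh.
  - by rewrite /in_opens /= /preimage /= fh'.
  move=> s.
  have hx : preim h (preim f V) x by rewrite /in_opens /= /preimage /= fh.
  have hx' : preim h' (preim f V) x by rewrite /in_opens /= /preimage /= fh'.
  rewrite -(unit_near_pull (f := h) s hx) -(unit_near_pull (f := h') s hx').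
  pose W := opensI (preim h (preim f V)) (preim h' (preim f V)).
  have Wx : W x by [].
  rewrite -(unit_near_res (@opensIl _ _ _ : W `<=` preim h (preim f V)) _ Wx).
  rewrite -(unit_near_res (@opensIr _ _ _ : W `<=` preim h' (preim f V)) _ Wx).
  by rewrite (E V s W _ (@opensIr _ _ _)).
split=> // W s O hf hg; apply: sec_sep => x Ox.
have [V [Vx affV affW]] := afff (f x).
have Wx : W (h x) := hf x Ox.
have Vhx : preim f V (h x) by rewrite /in_opens /= /preimage /= fh.
have [a [ax aW]] := affine_basic affW Wx Vhx.
have ha : basic a `<=` W := aW.
have hav : basic a `<=` preim f V := @basic_sub _ _ _ a.
have [b [n e]] := affine_extend affW hav (@basicE _ _ _ a)
  (res ha s).
pose N := opensI O (preim h (basic a)).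
have NO : N `<=` O by move=> y [].
exists N, NO; split; first by split.
have Na : N `<=` preim h (basic a) by move=> y [].
have Na' : N `<=` preim h' (basic a) by move=> y [_]; rewrite /in_opens /= /preimage /= pE.
have NV : N `<=` preim h (preim f V) by move=> y /Na /hav.
have NV' : N `<=` preim h' (preim f V) by move=> y /Na' /hav.
apply: (unit_cancel (s := res NV (pull h _ a) ^+ n)).
  move=> y Ny; apply: unit_nearX; apply/unit_near_res => //.
  by apply/unit_near_pull; [exact: (NV y Ny)|exact: (Na y Ny)].
have NW : N `<=` preim h W by move=> y /NO /hf.
have NW' : N `<=` preim h' W by move=> y /NO /hg.
rewrite (res_comp _ _ NW) (res_comp _ _ NW').
have hE : res NV (pull h _ a) ^+ n * res NW (pull h _ s) = res NV (pull h _ b).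
  rewrite -(res_comp (preim_sub (f := h) ha) Na) -!(res_comp (preim_sub (f := h) hav) Na).
  by rewrite -!pull_res e rmorphM rmorphXn rmorphM !rmorphXn.
have hE' : res NV' (pull h' _ a) ^+ n * res NW' (pull h' _ s) = res NV' (pull h' _ b).
  rewrite -(res_comp (preim_sub (f := h') ha) Na') -!(res_comp (preim_sub (f := h') hav) Na').
  by rewrite -!pull_res e rmorphM rmorphXn rmorphM !rmorphXn.
by rewrite hE (E V b N NV NV') -hE' (E V a N NV NV').
Qed.
End EndoUniq.

(** * Primes in invariant rings *)

Section CommutativeAlgebra.
Variable B : comPzRingType.

Record ideal_pred (I : B -> Prop) : Prop := IdealPred {
  ideal_pred0 : I 0;
  ideal_predD : forall a b, I a -> I b -> I (a + b);
  ideal_predM : forall a b, I b -> I (a * b) }.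

(** Krull's argument: an ideal that is maximal among those containing I and disjoint from the
    multiplicative set S is prime. *)
Lemma prime_exists (I S : B -> Prop) : ideal_pred I -> S 1 ->
  (forall a b, S a -> S b -> S (a * b)) -> (forall a, I a -> S a -> False) ->
  exists Q, [/\ prime_ideal Q, forall a, I a -> Q a & forall a, Q a -> S a -> False].
Proof.
move=> idI S1 SM IS.
pose good (A : B -> Prop) :=
  [/\ ideal_pred A, forall a, I a -> A a & forall a, A a -> S a -> False].
have [|M [goodM maxM]] := @Zorn_bigcup B (fun A => A = set0 \/ good A).
  move=> F Fgood Ftot.
  have [[A0 FA0 gA0]|nogood] := pselect (exists2 A, F A & good A); last first.
    left; apply/seteqP; split=> // a [A FA Aa].
    have [A0|gA] := Fgood A FA; first by rewrite A0 in Aa.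
    by case: nogood; exists A.
  right; split; [split|..].
  - by exists A0 => //; case: gA0 => -[].
  - move=> a b [A FA Aa] [A' FA' Ab].
    have [AA|AA] := Ftot _ _ FA FA'.
      have [A'0|[id' _ _]] := Fgood A' FA'; first by rewrite A'0 in Ab.
      by exists A' => //; apply: (ideal_predD id') => //; exact: AA.
    have [A'0|[id' _ _]] := Fgood A FA; first by rewrite A'0 in Aa.
    by exists A => //; apply: (ideal_predD id') => //; exact: AA.
  - move=> a b [A FA Ab].
    have [A'0|[id' _ _]] := Fgood A FA; first by rewrite A'0 in Ab.
    by exists A => //; exact: (ideal_predM id').
  - by move=> a Ia; exists A0 => //; case: gA0 => _ + _; apply.
  - move=> a [A FA Aa].
    have [A'0|[_ _ h]] := Fgood A FA; first by rewrite A'0 in Aa.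
    exact: h.
have {goodM}gM : good M.
  case: goodM => // M0; case: (maxM I); last by right.
  split; first by rewrite M0.
  by move=> /(_ _ (ideal_pred0 idI)); rewrite M0.
case: (gM) => idM IM MS; exists M; split=> //.
(* By maximality, the ideal generated by M and an element outside M meets S. *)
have big a : ~ M a -> exists s m x, [/\ S s, M m & s = m + x * a].
  move=> Ma; apply: contrapT => no.
  pose M' b := exists m x, M m /\ b = m + x * a.
  case: (maxM M').
    split=> [b Mb|MM']; first by exists b, 0; rewrite mul0r addr0.
    apply: Ma; apply: MM'; exists 0, 1; rewrite mul1r add0r; split=> //.
    exact: (ideal_pred0 idM).
  right; split; [split|..].
  - by exists 0, 0; rewrite mul0r addr0; split=> //; exact: (ideal_pred0 idM).
  - move=> b c [m [x [Mm ->]]] [m' [x' [Mm' ->]]]; exists (m + m'), (x + x').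
    by rewrite mulrDl addrACA; split=> //; exact: (ideal_predD idM).
  - move=> b c [m [x [Mm ->]]]; exists (b * m), (b * x).
    by rewrite mulrDr mulrA; split=> //; exact: (ideal_predM idM).
  - by move=> b Ib; exists b, 0; rewrite mul0r addr0; split=> //; exact: IM.
  - move=> s [m [x [Mm e]]] Ss; apply: no; exists s, m, x; split=> //.
split; [exact: (ideal_pred0 idM)|exact: (ideal_predD idM)|exact: (ideal_predM idM)|..].
  by move=> M1; exact: MS M1 S1.
move=> a b Mab; apply: contrapT => /not_orP [Ma Mb].
have [s [m [x [Ss Mm es]]]] := big a Ma.
have [t [n [y [St Mn et]]]] := big b Mb.
apply: MS (SM _ _ Ss St).
have -> : s * t = (n + y * b) * m + x * a * n + x * y * (a * b) by rewrite es et; ring.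
by do 2?apply: (ideal_predD idM); apply: (ideal_predM idM).
Qed.

Lemma prime_ideal_pred (Q : B -> Prop) : prime_ideal Q -> ideal_pred Q.
Proof. by case. Qed.

Lemma prime_prod (Q : B -> Prop) (J : Type) (r : seq J) (P : pred J) (F : J -> B) :
  prime_ideal Q -> Q (\prod_(j <- r | P j) F j) -> exists2 j, P j & Q (F j).
Proof.
case=> _ _ _ Q1 QM; elim: r => [|j r IH]; first by rewrite big_nil => /Q1.
rewrite big_cons; case: ifP => // Pj /QM [Qj|/IH //]; by exists j.
Qed.

(** Induction on the list, with no incomparability assumed: an element b that avoids the tail but
    lies in the head prime is corrected by a second element c of I. *)
Lemma prime_avoidance (J : eqType) (r : seq J) (Q : J -> B -> Prop) (I : B -> Prop) :
  ideal_pred I -> (forall j, j \in r -> prime_ideal (Q j)) ->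
  (forall j, j \in r -> exists2 b, I b & ~ Q j b) ->
  exists2 b, I b & forall j, j \in r -> ~ Q j b.
Proof.
move=> idI; elim: r => [|j0 r IH] pQ IQ.
  by exists 0; [exact: (ideal_pred0 idI)|].
have [||b Ib bQ] := IH.
- by move=> j jr; apply: pQ; rewrite inE jr orbT.
- by move=> j jr; apply: IQ; rewrite inE jr orbT.
have j0r : j0 \in j0 :: r by rewrite mem_head.
have [Q0b|nQ0b] := pselect (Q j0 b); last first.
  by exists b => // j; rewrite inE => /orP [/eqP ->|/bQ].
have p0 := pQ j0 j0r; case: (p0) => Q00 Q0D Q0M Q01 Q0p.
(* The correction c lies outside the head prime and inside each tail prime that is not contained in
   the head. Then b + c avoids the latter because b does, and avoids the head and all primes inside
   it because there only c counts. *)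
have [c Ic [nQ0c cQ]] : exists2 c, I c & ~ Q j0 c /\
    forall j, j \in r -> Q j c \/ (forall d, Q j d -> Q j0 d).
  have : forall j, j \in r -> prime_ideal (Q j).
    by move=> j jr; apply: pQ; rewrite inE jr orbT.
  elim: (r) => [_|j s IHs pr].
    by have [c Ic nc] := IQ j0 j0r; exists c.
  have [|c Ic [nc cQ]] := IHs; first by move=> i si; apply: pr; rewrite inE si orbT.
  have [sub|/existsNP [d /not_implyP [Qd nd]]] := pselect (forall d, Q j d -> Q j0 d).
    by exists c => //; split=> // i; rewrite inE => /orP [/eqP ->|/cQ //]; right.
  exists (d * c); first exact: (ideal_predM idI).
  split; first by move=> /Q0p [].
  move=> i; rewrite inE => /orP [/eqP ->|si].
    left; have [_ _ M _ _] : prime_ideal (Q j) by apply: pr; rewrite mem_head.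
    by rewrite mulrC; exact: M.
  have [Qc|h] := cQ i si; last by right.
  left; have [_ _ M _ _] : prime_ideal (Q i) by apply: pr; rewrite inE si orbT.
  exact: M.
have sub0 x y : Q j0 x -> Q j0 (x + y) -> Q j0 y.
  by move=> Qx Qxy; rewrite -[y](addKr x) addrC; apply: Q0D => //; rewrite -mulN1r; exact: Q0M.
exists (b + c); first exact: (ideal_predD idI).
move=> j; rewrite inE => /orP [/eqP ->|jr] Qbc; first exact: nQ0c (sub0 _ _ Q0b Qbc).
have [Qc|sub] := cQ j jr; last exact: nQ0c (sub0 _ _ Q0b (sub _ Qbc)).
have [_ QD QM _ _] : prime_ideal (Q j) by apply: pQ; rewrite inE jr orbT.
apply: (bQ j jr); rewrite -[b](addrK c); apply: QD => //.
by rewrite -mulN1r; exact: QM.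
Qed.
End CommutativeAlgebra.

(** * Rings of invariants under a finite group *)

Section FiniteGroup.
Variables (A B : comPzRingType) (gT : finGroupType) (H : {group gT}).
Variables (actB : gT -> {rmorphism B -> B}) (iota : {rmorphism A -> B}).
Hypothesis actB1 : forall b, actB 1%g b = b.
Hypothesis actBM : {in H &, forall g h b, actB (g * h)%g b = actB g (actB h b)}.
Hypothesis iota_inj : injective iota.
Hypothesis iotaP : forall b,
  (forall g, g \in H -> actB g b = b) <-> exists a, iota a = b.

Lemma act_iota g a : g \in H -> actB g (iota a) = iota a.
Proof. by move=> Hg; apply: ((iotaP (iota a)).2 _ g Hg); exists a. Qed.

Lemma trace_invariant b : exists a, iota a = \sum_(g in H) actB g b.
Proof.
apply/iotaP => h Hh; rewrite rmorph_sum [RHS](reindex_inj (mulgI h)) /=.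
under [RHS]eq_bigl do rewrite groupMl //.
by apply: eq_bigr => g Hg; rewrite actBM.
Qed.

Lemma norm_invariant b : exists a, iota a = \prod_(g in H) actB g b.
Proof.
apply/iotaP => h Hh; rewrite rmorph_prod [RHS](reindex_inj (mulgI h)) /=.
under [RHS]eq_bigl do rewrite groupMl //.
by apply: eq_bigr => g Hg; rewrite actBM.
Qed.

(** With the group order invertible, traces replace the argument by integrality: it is enough to
    have an ideal of B that meets A exactly in P, and then a prime containing it and disjoint from
    the complement of P in A. *)
Lemma lying_over (u : A) (P : A -> Prop) : u * #|H|%:R = 1 -> prime_ideal P ->
  exists Q : B -> Prop, prime_ideal Q /\ forall a, P a <-> Q (iota a).
Proof.
move=> uH primeP; have [P0 PD PM P1 PP] := primeP.
(* The ideal of those b for which every trace Tr(c b) lies in P. It contains P because the trace is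
   A-linear, and its elements a from A lie in P because Tr(a) is a times the group order. *)
pose I (b : B) := forall c, exists2 a, P a & iota a = \sum_(g in H) actB g (c * b).
have IP a : P a -> I (iota a).
  move=> Pa c; have [t et] := trace_invariant c; exists (t * a); first exact: PM.
  rewrite rmorphM et big_distrl; apply: eq_bigr => g Hg.
  by rewrite rmorphM act_iota.
have PI a : I (iota a) -> P a.
  move=> /(_ 1) [a' Pa' e]; suff -> : a = u * a' by exact: PM.
  apply: iota_inj; rewrite rmorphM e mul1r.
  under eq_bigr => g Hg do rewrite act_iota //.
  by rewrite sumr_const -mulr_natl mulrA -(rmorph_nat iota) -rmorphM uH rmorph1 mul1r.
have [||||Q [primeQ IQ QS]] := @prime_exists B I (fun b => exists2 a, ~ P a & iota a = b).
- split.
  + by move=> c; exists 0; rewrite // rmorph0 big1 // => g _; rewrite mulr0 rmorph0.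
  + move=> b b' Ib Ib' c; have [a Pa ea] := Ib c; have [a' Pa' ea'] := Ib' c.
    exists (a + a'); first exact: PD.
    rewrite rmorphD ea ea' -big_split; apply: eq_bigr => g _.
    by rewrite mulrDr rmorphD.
  + by move=> b b' Ib' c; rewrite mulrA; exact: Ib'.
- by exists 1; rewrite ?rmorph1.
- move=> _ _ [a Pa <-] [b Pb <-]; exists (a * b); rewrite ?rmorphM //.
  by move=> /PP [].
- by move=> b Ib [a Pa ea]; apply: Pa; apply: PI; rewrite ea.
exists Q; split=> // a; split=> [/IP /IQ //|Qa].
by apply: contrapT => Pa; apply: QS Qa _; exists a.
Qed.

(** Otherwise prime avoidance gives b in Q' outside all inverse images of Q. The norm of b lies in
    Q' and in A, hence in Q, so some conjugate of b lies in Q: a contradiction. *)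
Lemma prime_conjugate_sub (Q Q' : B -> Prop) : prime_ideal Q -> prime_ideal Q' ->
  (forall a, Q' (iota a) -> Q (iota a)) ->
  exists2 h, h \in H & forall b, Q' b -> Q (actB h b).
Proof.
move=> pQ pQ' Q'Q; apply: contrapT => no.
have [||b Q'b nb] := @prime_avoidance B gT (enum H) (fun h b => Q (actB h b)) Q'
    (prime_ideal_pred pQ').
- move=> h _; case: pQ => Q0 QD QM Q1 QP; split; rewrite ?rmorph0 ?rmorph1 //.
  + by move=> a b; rewrite rmorphD; exact: QD.
  + by move=> a b; rewrite rmorphM; exact: QM.
  + by move=> a b; rewrite rmorphM; exact: QP.
- move=> h; rewrite mem_enum => Hh; apply: contrapT => no'; apply: no.
  by exists h => // b Q'b; apply: contrapT => nQ; apply: no'; exists b.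
have [a ea] := norm_invariant b.
have : Q (iota a).
  apply: Q'Q; rewrite ea (bigD1 1%g) //= actB1 mulrC.
  by case: pQ' => _ _ + _ _; apply.
rewrite ea => /(prime_prod pQ) [h Hh]; apply: nb.
by rewrite mem_enum.
Qed.

(** The two inclusions compose to an inclusion of Q' into its own translate by h' h. Since h' h has
    finite order, iterating it leads back and turns the inclusions into equalities. *)
Lemma prime_conjugate (Q Q' : B -> Prop) : prime_ideal Q -> prime_ideal Q' ->
  (forall a, Q' (iota a) <-> Q (iota a)) ->
  exists2 h, h \in H & forall b, Q' b <-> Q (actB h b).
Proof.
move=> pQ pQ' QQ'.
have [h Hh hP] := prime_conjugate_sub pQ pQ' (fun a => (QQ' a).1).
have [h' Hh' h'P] := prime_conjugate_sub pQ' pQ (fun a => (QQ' a).2).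
exists h => // b; split=> [|Qhb]; first exact: hP.
have vP n c : Q' c -> Q' (actB ((h' * h) ^+ n)%g c).
  elim: n c => [|n IH] c Q'c; first by rewrite expg0 actB1.
  rewrite expgS actBM ?groupX ?groupM // actBM //.
  by apply: h'P; apply: hP; exact: IH.
have := vP #[(h' * h)%g]%g.-1 _ (h'P _ Qhb).
rewrite -(actBM Hh' Hh) -actBM ?groupX ?groupM //.
by rewrite -expgSr prednK ?order_gt0 // expg_order actB1.
Qed.
End FiniteGroup.

(** * Quotients by finite groups *)

Section SectionAction.
Variables (k : fieldType) (X : space k) (gT : finGroupType).
Variables (act : gT -> smorphism X X) (H : {group gT}).
Hypothesis act1 : eqmor (act 1%g) (mid X).
Hypothesis actM : forall s t, eqmor (act (s * t)%g) (mcomp (act t) (act s)).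

Definition stable (W : opens X) := forall g, g \in H -> W `<=` preim (act g) W.

(** The identity serves as default value when g does not preserve W, so that a ring endomorphism is
    obtained for all W and g without a proof argument. *)
Definition sact (W : opens X) (g : gT) : {rmorphism sec W -> sec W} :=
  match pselect (W `<=` preim (act g) W) with
  | left h => res h \o pull (act g) W
  | right _ => idfun
  end.

Section Stable.
Variable W : opens X.
Hypothesis stW : stable W.

Lemma sactE g (h : W `<=` preim (act g) W) s : sact W g s = res h (pull (act g) W s).
Proof. by rewrite /sact; case: pselect => // h'; rewrite /= (res_irr h' h). Qed.

Lemma sact_near g s x : g \in H -> W x ->
  unit_near (sact W g s) x <-> unit_near s (act g x).
Proof.
move=> Hg Wx; have h := stW Hg; rewrite (sactE h) unit_near_res //.
by apply: unit_near_pull; exact: (h x Wx).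
Qed.

Lemma sact1 s : sact W 1%g s = s.
Proof.
have h := stW (group1 H); rewrite (sactE h).
have hW : W `<=` W by [].
by rewrite (act1.2 W s W h hW) /= /mid_pull (res_comp _ _ hW) res_id.
Qed.

Lemma sactM : {in H &, forall g h s, sact W (g * h)%g s = sact W g (sact W h s)}.
Proof.
move=> g h Hg Hh s.
have hgh := stW (groupM Hg Hh); have hg := stW Hg; have hh := stW Hh.
rewrite (sactE hgh) (sactE hg) (sactE hh).
have h2 : W `<=` preim (act g) (preim (act h) W) by move=> y /hg /hh.
rewrite (pull_res hh (preim_sub (f := act g) hh)) (res_comp _ _ h2).
have h3 : W `<=` preim (mcomp (act h) (act g)) W by [].
rewrite ((actM g h).2 W s W hgh h3) /= /mcomp_pull /=.
by rewrite (res_comp _ _ h2).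
Qed.

Lemma invariant_sactE s :
  invariant_section act H s <-> forall g, g \in H -> sact W g s = s.
Proof.
split=> [inv g Hg|inv g Hg W' h h'].
  by rewrite (sactE (stW Hg)) (inv g Hg W (fun _ => id)) res_id.
rewrite -{2}(inv g Hg) (sactE (stW Hg)) (res_comp _ _ h').
exact: res_irr.
Qed.
End Stable.

Lemma sact_res (V W : opens X) (h : V `<=` W) g s : stable V -> stable W ->
  g \in H -> sact V g (res h s) = res h (sact W g s).
Proof.
move=> stV stW Hg; rewrite (sactE (stV g Hg)) (sactE (stW g Hg)).
rewrite (pull_res h (preim_sub (f := act g) h)).
have hV : V `<=` preim (act g) W by move=> y /h /(stW g Hg).
by rewrite !(res_comp _ _ hV).
Qed.

(* A product of conjugates of a section that vanishes off O but at no point of the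
   orbit of x. *)
Lemma stable_norm (W O : opens X) x : stable W -> affine W -> W x ->
  (forall g, g \in H -> O (act g x)) ->
  exists b : sec W, unit_near (\prod_(g in H) sact W g b) x /\
    forall y, unit_near (\prod_(g in H) sact W g b) y -> O y.
Proof.
move=> stW affW Wx Ox; have [primeW _ _ _] := affW.
(* The ideal of W minus O; prime avoidance is applied to it and to the primes of the points of the
   orbit of x. *)
pose I (b : sec W) := forall y, unit_near b y -> O y.
have nprime y : W y -> prime_ideal (fun s : sec W => ~ unit_near s y) by exact: primeW.
have idI : ideal_pred I.
  split.
  - move=> y uy; have [p0 _ _ _ _] := nprime y (unit_near_sub uy).
    by case: (p0 uy).
  - move=> a b Ia Ib y uy; have [_ pD _ _ _] := nprime y (unit_near_sub uy).
    apply: contrapT => nO; apply: (pD a b) uy; first by move/Ia.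
    by move/Ib.
  - by move=> a b Ib y /unit_nearM [_ /Ib].
have [||b Ib bQ] := @prime_avoidance _ gT (enum H)
    (fun g (b : sec W) => ~ unit_near b (act g x)) I idI.
- by move=> g; rewrite mem_enum => Hg; apply: nprime; exact: stW Hg _ Wx.
- move=> g; rewrite mem_enum => Hg.
  have [b [bx bO]] := affine_basic affW (Ox g Hg) (stW _ Hg _ Wx).
  by exists b => //; exact/notP.
exists b; split.
  apply: (big_ind (fun s : sec W => unit_near s x)).
  - exact: unit_near1.
  - by move=> s t sx tx; apply/unit_nearM.
  - move=> g Hg; apply/(sact_near stW) => //; apply/notP.
    by apply: bQ; rewrite mem_enum.
move=> y; rewrite (bigD1 1%g) //= => /unit_nearM [+ _].
by rewrite sact1 //; exact: Ib.
Qed.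

Variables (Z : space k) (q : smorphism X Z).
Hypothesis qact : forall g x, g \in H -> q (act g x) = q x.

Lemma preim_stable (U : opens Z) : stable (preim q U).
Proof. by move=> g Hg x; rewrite /in_opens /= /preimage /= qact. Qed.

Hypothesis q_inj : forall V : opens Z, injective (pull q V).
Hypothesis q_inv : forall (V : opens Z) (s : sec (preim q V)),
  invariant_section act H s <-> exists t, pull q V t = s.
Variable cardV : k.
Hypothesis cardK : cardV * #|H|%:R = 1.

Lemma pull_invariant (U : opens Z) (b : sec (preim q U)) :
  (forall g, g \in H -> sact (preim q U) g b = b) <-> exists a, pull q U a = b.
Proof. by rewrite -q_inv invariant_sactE //; exact: preim_stable. Qed.

Lemma scal_cardK (U : opens Z) : scal U cardV * #|H|%:R = 1.
Proof. by rewrite -(rmorph_nat (scal U)) -rmorphM cardK rmorph1. Qed.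

Lemma section_trace (U : opens Z) (b : sec (preim q U)) :
  exists a, pull q U a = \sum_(g in H) sact _ g b.
Proof.
exact: (@trace_invariant _ _ _ H (sact (preim q U)) (pull q U) (sactM (@preim_stable U)) (@pull_invariant U)).
Qed.

Lemma section_norm (U : opens Z) (b : sec (preim q U)) :
  exists a, pull q U a = \prod_(g in H) sact _ g b.
Proof.
exact: (@norm_invariant _ _ _ H (sact (preim q U)) (pull q U) (sactM (@preim_stable U)) (@pull_invariant U)).
Qed.

Lemma quotient_surj : affine_morphism q -> forall z, exists x, q x = z.
Proof.
move=> affq z; have [V [Vz affV affW]] := affq z; have [primeV _ _ _] := affV.
have [Q [pQ PQ]] := @lying_over _ _ _ H (sact (preim q V)) (pull q V) (sactM (@preim_stable V)) (@q_inj V) (@pull_invariant V) _ _ (scal_cardK V) (primeV z Vz).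
have [_ /(_ Q pQ) [x [[Wx xQ] _]] _ _] := affW.
exists x; apply: (affine_point_inj affV) => // s.
rewrite -(unit_near_pull (f := q) s Wx).
by rewrite -[X in X <-> _]notK -xQ -PQ notK.
Qed.

Lemma affine_fibre (V : opens Z) x x' : affine V -> affine (preim q V) ->
  V (q x) -> V (q x') -> (forall s : sec V, unit_near s (q x) <-> unit_near s (q x')) ->
  exists2 g, g \in H & x' = act g x.
Proof.
move=> affV affW Vx Vx' xx'; have [primeW _ _ _] := affW.
have [|g Hg gP] := @prime_conjugate _ _ _ H (sact (preim q V)) (pull q V) (sact1 (@preim_stable V)) (sactM (@preim_stable V))
  (@pull_invariant V) _ _ (primeW x Vx) (primeW x' Vx').
  by move=> a; rewrite !unit_near_pull // xx'.
exists g => //; apply: (affine_point_inj affW) => //; first exact: preim_stable Hg _ Vx.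
move=> s; rewrite -(sact_near (@preim_stable V)) //.
by rewrite -[X in X <-> _]notK gP notK.
Qed.

(** The norm from [stable_norm] is invariant and so comes from Z. This compares the open sets of X
    with the topology of Z. *)
Lemma affine_quotient_basic (V : opens Z) (O : opens X) x : affine (preim q V) ->
  V (q x) -> (forall g, g \in H -> O (act g x)) ->
  exists a : sec V, unit_near a (q x) /\
    forall x', unit_near a (q x') -> O x'.
Proof.
move=> affW Vx Ox.
have [b [bx bO]] := stable_norm (@preim_stable V) affW Vx Ox.
have [a ea] := section_norm b; exists a; split.
  by apply/(unit_near_pull (f := q)) => //; rewrite ea.
move=> x' ax'; apply: bO; rewrite -ea; apply/unit_near_pull => //.
exact: unit_near_sub ax'.
Qed.

(** For a target that is given rather than constructed: it recognizes Y as the quotient of X by all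
    of S_3. Surjectivity is lying over, and the fibres are orbits by conjugacy of primes. *)
Lemma affine_is_quotient : affine_morphism q -> is_quotient act H q.
Proof.
move=> affq; split=> //; first exact: quotient_surj.
- move=> x x'; split=> [qq|[g Hg ->]]; last by rewrite qact.
  have [V [Vx affV affW]] := affq (q x).
  by apply: (affine_fibre affV affW) => //; rewrite -qq.
- move=> A oA; rewrite openE => z Az.
  have [x qx] := quotient_surj affq z.
  have [V [Vz affV affW]] := affq z; rewrite -qx in Vz Az *.
  have [|a [ax aO]] := affine_quotient_basic (O := Opens oA) affW Vz.
    by move=> g Hg; rewrite /in_opens /= /preimage /= qact.
  apply: (filterS _ (open_nbhs_nbhs (conj (open_unit_near a) ax))) => y ay.
  by have [x' qx'] := quotient_surj affq y; rewrite -qx' in ay *; exact: aO.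
Qed.

Hypothesis q_surj : forall z, exists x, q x = z.
Hypothesis q_fib : forall x x', q x = q x' <-> exists2 g, g \in H & x' = act g x.

(** For the constructed orbit spaces: affineness descends along a quotient. Primes of the invariant
    ring lift by [lying_over], points are separated by [prime_conjugate], and basic opens come from
    norms. *)
Lemma quotient_affine (U : opens Z) : affine (preim q U) -> affine U.
Proof.
move=> affW; have [primeW _ _ _] := affW.
have primeU z : U z -> prime_ideal (fun s : sec U => ~ unit_near s z).
  have [x <-] := q_surj z => Ux; have [P0 PD PM P1 PP] := primeW x Ux.
  have uE (s : sec U) : ~ unit_near s (q x) <-> ~ unit_near (pull q U s) x.
    by rewrite unit_near_pull.
  split; first by rewrite uE rmorph0.
  - by move=> a b; rewrite !uE rmorphD; exact: PD.
  - by move=> a b; rewrite !uE rmorphM; exact: PM.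
  - by rewrite uE rmorph1.
  - by move=> a b; rewrite !uE rmorphM; exact: PP.
split=> //.
- move=> P pP.
  have [Q [pQ PQ]] := @lying_over _ _ _ H (sact (preim q U)) (pull q U) (sactM (@preim_stable U)) (@q_inj U) (@pull_invariant U) _ _ (scal_cardK U) pP.
  have [_ /(_ Q pQ) [x [[Wx xQ] _]] _ _] := affW.
  have qP s : P s <-> ~ unit_near s (q x).
    by rewrite PQ xQ unit_near_pull.
  exists (q x); split=> [//|z [Uz zP]].
  have [x' qx'] := q_surj z; rewrite -qx' in Uz zP *.
  have [|g Hg gP] := @prime_conjugate _ _ _ H (sact (preim q U)) (pull q U) (sact1 (@preim_stable U)) (sactM (@preim_stable U))
    (@pull_invariant U) _ _ (primeW x Wx) (primeW x' Uz).
    by move=> a; rewrite !unit_near_pull // -qP -zP.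
  apply/q_fib; exists g => //; apply: (affine_point_inj affW) => //.
    exact: preim_stable Hg _ Wx.
  move=> s; rewrite -(sact_near (@preim_stable U)) //.
  by rewrite -[X in X <-> _]notK gP notK.
- move=> V z VU Vz; have [x qx] := q_surj z; rewrite -qx in Vz *.
  have [|a [ax aO]] := affine_quotient_basic (O := preim q V) affW (VU _ Vz).
    by move=> g Hg; rewrite /in_opens /= /preimage /= qact.
  exists a; split=> // y ay; have [x' qx'] := q_surj y; rewrite -qx' in ay *.
  exact: aO.
- move=> s; have hb : basic s `<=` U := @basic_sub _ _ _ s.
  have hbq := preim_sub (f := q) hb.
  have bE x : preim q (basic s) x <-> unit_near (pull q U s) x by rewrite -basic_pull.
  split=> [a a0|b].
    have [|n e] := affine_zero affW (s := pull q U s) (a := pull q U a) (hW := hbq) bE.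
      by rewrite -(pull_res (@basic_sub _ _ _ s)) a0 rmorph0.
    by exists n; apply: (@q_inj U); rewrite rmorphM rmorphXn e rmorph0.
  (* An extension b' of s^n b over the preimage of U need not be invariant. Its average over H is,
     and still restricts to s^n b, because s and b are invariant. *)
  have [b' [n e]] := affine_extend affW hbq bE (pull q _ b).
  have [a ea] := section_trace b'.
  exists (scal U cardV * a), n; apply: (@q_inj (basic s)).
  rewrite (pull_res _ hbq) [RHS]rmorphM rmorphXn /= (pull_res _ hbq) !rmorphM ea.
  rewrite rmorph_sum /=.
  have E g : g \in H -> res hbq (sact (preim q U) g b') =
      res hbq (pull q U s) ^+ n * pull q (basic s) b.
    move=> Hg; rewrite -(sact_res hbq _ (@preim_stable _) (@preim_stable _) Hg) e.
    rewrite rmorphM rmorphXn /= -pull_res.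
    by rewrite !((pull_invariant _).2 _ g Hg) //; eexists; reflexivity.
  rewrite (eq_bigr _ E); set y := _ ^+ n * _.
  rewrite sumr_const -mulr_natl mulrA.
  rewrite -[RHS]mul1r; congr (_ * _).
  rewrite -(rmorph_nat (res hbq)) -rmorphM -(rmorph_nat (pull q U)) -rmorphM.
  by rewrite scal_cardK !rmorph1.
Qed.

End SectionAction.

(** * The quotient ringed space *)

Definition rmorphism_of (R S : comPzRingType) (f : R -> S)
    (fB : zmod_morphism f) (fM : monoid_morphism f) : {rmorphism R -> S} :=
  HB.pack_for {rmorphism R -> S} f
    (GRing.isZmodMorphism.Build R S f fB) (GRing.isMonoidMorphism.Build R S f fM).

Section Quotient.
Variables (k : fieldType) (X : space k) (gT : finGroupType).
Variables (act : gT -> smorphism X X) (H : {group gT}).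
Hypothesis act1 : eqmor (act 1%g) (mid X).
Hypothesis actM : forall s t, eqmor (act (s * t)%g) (mcomp (act t) (act s)).

Definition orbit_rel (x x' : X) : bool := `[< exists2 g, g \in H & x' = act g x >].

Lemma orbit_rel_refl : reflexive orbit_rel.
Proof. by move=> x; apply/asboolP; exists 1%g; rewrite ?group1 // act1.1. Qed.

Lemma orbit_rel_sym : symmetric orbit_rel.
Proof.
have h x y : orbit_rel x y -> orbit_rel y x.
  move=> /asboolP [g Hg ->]; apply/asboolP; exists (g^-1)%g; rewrite ?groupV //.
  by rewrite -[act _ _]/(mcomp (act g^-1%g) (act g) x) -(actM _ _).1 mulgV act1.1.
by move=> x y; apply/idP/idP; exact: h.
Qed.

Lemma orbit_rel_trans : transitive orbit_rel.
Proof.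
move=> y x z /asboolP [g Hg ->] /asboolP [h Hh ->]; apply/asboolP.
by exists (g * h)%g; rewrite ?groupM // (actM _ _).1.
Qed.

Definition orbit_equiv := EquivRel orbit_rel orbit_rel_refl orbit_rel_sym orbit_rel_trans.

Local Open Scope quotient_scope.

Definition orbit_space : topologicalType := quotient_topology {eq_quot orbit_equiv}.

Definition orbit_proj : X -> orbit_space :=
  \pi_(quotient_topology {eq_quot orbit_equiv})%qT.

Lemma orbit_proj_cont : continuous orbit_proj.
Proof. exact: pi_continuous. Qed.

Lemma orbit_projP x x' : orbit_proj x = orbit_proj x' <->
  exists2 g, g \in H & x' = act g x.
Proof.
have E : (\pi_({eq_quot orbit_equiv}) x == \pi_({eq_quot orbit_equiv}) x') =
  orbit_rel x x' := eqmodE orbit_equiv x x'.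
split=> [e|xx'].
  by apply/asboolP; rewrite -[asbool _]/(orbit_rel x x') -E; apply/eqP; exact: e.
have /eqP : \pi_({eq_quot orbit_equiv}) x == \pi_({eq_quot orbit_equiv}) x'.
  by rewrite E; apply/asboolP.
exact.
Qed.

Lemma orbit_proj_surj z : exists x, orbit_proj x = z.
Proof. by exists (repr z); exact: reprK. Qed.

Lemma orbit_open (A : set orbit_space) : open (orbit_proj @^-1` A) -> open A.
Proof. by []. Qed.

Local Notation pre V := (opreim orbit_proj_cont V).

Lemma orbit_proj_act g x : g \in H -> orbit_proj (act g x) = orbit_proj x.
Proof. by move=> Hg; apply/esym/orbit_projP; exists g. Qed.

Lemma pre_stable V : stable act H (pre V).
Proof. by move=> g Hg x; rewrite /in_opens /= /preimage /= orbit_proj_act. Qed.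

Definition invariant_pred (V : opens orbit_space) (s : sec (pre V)) : bool :=
  `[< forall g, g \in H -> sact act (pre V) g s = s >].

Lemma invariant_subring V : subring_closed (@invariant_pred V).
Proof.
split=> [|s t /asboolP si /asboolP ti|s t /asboolP si /asboolP ti];
  apply/asboolP => g Hg; first exact: rmorph1.
- by rewrite rmorphB si ?ti.
- by rewrite rmorphM si ?ti.
Qed.

Definition invariants V := {s : sec (pre V) | invariant_pred s}.

HB.instance Definition _ V := SubChoice.on (invariants V).
HB.instance Definition _ V :=
  GRing.SubChoice_isSubComPzRing.Build (sec (pre V)) (@invariant_pred V)
    (invariants V) (invariant_subring V).

Lemma invariantsP V (s : invariants V) g :
  g \in H -> sact act (pre V) g (val s) = val s.
Proof. by move: g; apply/asboolP; exact: (valP s). Qed.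

Definition invariant_res0 (U V : opens orbit_space) (h : V `<=` U)
  (s : invariants U) : invariants V.
Proof.
exists (res (fun x => h (orbit_proj x) : pre V x -> pre U x) (val s)).
apply/asboolP => g Hg.
by rewrite (sact_res _ _ (@pre_stable V) (@pre_stable U)) // invariantsP.
Defined.

Lemma invariant_res0_zmod U V h : zmod_morphism (@invariant_res0 U V h).
Proof. by move=> s t; apply: val_inj; rewrite rmorphB /= rmorphB. Qed.

Lemma invariant_res0_monoid U V h : monoid_morphism (@invariant_res0 U V h).
Proof.
by split=> [|s t]; apply: val_inj; rewrite /= ?rmorph1 // !rmorphM.
Qed.

Definition invariant_res U V h : {rmorphism invariants U -> invariants V} :=
  rmorphism_of (@invariant_res0_zmod U V h) (@invariant_res0_monoid U V h).

Definition invariant_scal0 V (a : k) : invariants V.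
Proof.
exists (scal (pre V) a); apply/asboolP => g Hg.
have h := pre_stable (V := V) Hg.
by rewrite (sactE h) pull_scal res_scal.
Defined.

Lemma invariant_scal0_zmod V : zmod_morphism (@invariant_scal0 V).
Proof. by move=> s t; apply: val_inj; rewrite rmorphB /= rmorphB. Qed.

Lemma invariant_scal0_monoid V : monoid_morphism (@invariant_scal0 V).
Proof. by split=> [|s t]; apply: val_inj; rewrite /= ?rmorph1 // !rmorphM. Qed.

Definition invariant_scal V : {rmorphism k -> invariants V} :=
  rmorphism_of (@invariant_scal0_zmod V) (@invariant_scal0_monoid V).

Lemma invariant_glue (I : Type) (F : I -> opens orbit_space) (U : opens orbit_space)
    (hF : forall i, F i `<=` U) : U `<=` \bigcup_i F i ->
  forall s : forall i, invariants (F i),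
    (forall i j (W : opens orbit_space) (hi : W `<=` F i) (hj : W `<=` F j),
       invariant_res hi (s i) = invariant_res hj (s j)) ->
  exists! t : invariants U, forall i, invariant_res (hF i) t = s i.
Proof.
move=> cov s comp.
have hP i : pre (F i) `<=` pre U by move=> x; exact: (hF i (orbit_proj x)).
have covP : pre U `<=` \bigcup_i pre (F i) by move=> x /cov [i _ Fi]; exists i.
have [|t [tP tu]] := sec_glue hP covP (s := fun i => val (s i)).
  move=> i j W hi hj.
  have hFi : opensI (F i) (F j) `<=` F i by move=> x [].
  have hFj : opensI (F i) (F j) `<=` F j by move=> x [].
  (* Compatibility is known only over preimages of opens of the orbit space, whereas gluing on X
     asks for it on any W; every W lies in the preimage of the intersection of F i and F j. *)
  have hW : W `<=` pre (opensI (F i) (F j)) by move=> x Wx; split; [exact: hi|exact: hj].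
  have /(congr1 val) /= e := comp i j _ hFi hFj.
  by have := congr1 (res hW) e; rewrite (res_comp _ _ hi) (res_comp _ _ hj).
have it : invariant_pred t.
  apply/asboolP => g Hg.
  rewrite -(tu (sact act (pre U) g t)) // => i.
  by rewrite -(sact_res _ _ (@pre_stable _) (@pre_stable _)) // tP invariantsP.
exists (exist _ t it); split=> [i|[t' it'] t'P].
  by apply: val_inj; rewrite /= -tP; exact: res_irr.
apply: val_inj => /=; apply: tu => i.
by rewrite -(congr1 val (t'P i)) /=; exact: res_irr.
Qed.

Definition quotient_space : space k.
Proof.
refine (@Space k orbit_space (fun V => invariants V : comPzRingType)
  invariant_res invariant_scal _ _ _ invariant_glue).
- by move=> U V h a; apply: val_inj; rewrite /= res_scal.
- by move=> U h s; apply: val_inj; rewrite /= res_id.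
- move=> U V W hUV hVW hUW s; apply: val_inj => /=.
  exact: res_comp.
Defined.

Definition quotient_pull0 (V : opens orbit_space) (s : @sec k quotient_space V) :
  sec (pre V) := val (s : invariants V).

Lemma quotient_pull0_zmod V : zmod_morphism (@quotient_pull0 V).
Proof. by []. Qed.

Lemma quotient_pull0_monoid V : monoid_morphism (@quotient_pull0 V).
Proof. by []. Qed.

Definition quotient_pull V : {rmorphism @sec k quotient_space V -> sec (pre V)} :=
  rmorphism_of (@quotient_pull0_zmod V) (@quotient_pull0_monoid V).

(** The locus where an invariant section is invertible is a union of orbits, so its image is open.
    The inverse on it is invariant by uniqueness of inverses, hence is a section of the quotient. *)
Lemma quotient_unit (V : opens orbit_space) (s : @sec k quotient_space V) x :
  unit_near (quotient_pull V s) x -> @unit_near k quotient_space V s (orbit_proj x).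
Proof.
move=> ux; pose W := [set x | unit_near (quotient_pull V s) x].
pose D : set orbit_space := [set z | exists2 x, W x & orbit_proj x = z].
have st := @pre_stable V.
have WE g y : g \in H -> W y -> W (act g y).
  move=> Hg Wy; have Vy : pre V y := unit_near_sub Wy.
  by apply/(sact_near st) => //; rewrite invariantsP.
have DW y : D (orbit_proj y) <-> W y.
  split=> [[y' Wy' /orbit_projP [g Hg ->]]|Wy]; last by exists y.
  exact: WE.
have oD : open D.
  apply: orbit_open; have -> : orbit_proj @^-1` D = W by apply/predeqP.
  exact: open_unit_near.
have hDV : Opens oD `<=` V by move=> z [y Wy <-]; exact: (unit_near_sub Wy).
have hP : pre (Opens oD) `<=` pre V by move=> y; exact: (hDV (orbit_proj y)).
have [|t st1] := @inverse_glue _ _ _ (res hP (quotient_pull V s)).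
  by move=> y Dy; apply/unit_near_res => //; exact/DW.
have it : invariant_pred t.
  apply/asboolP => g Hg.
  have E : res hP (quotient_pull V s) * sact act (pre (Opens oD)) g t = 1.
    rewrite -(rmorph1 (sact act (pre (Opens oD)) g)) -st1 rmorphM; congr (_ * _).
    by rewrite (sact_res _ _ (@pre_stable _) st) // invariantsP.
  by rewrite -[RHS]mulr1 -E mulrA [t * _]mulrC st1 mul1r.
exists (Opens oD), hDV; split; first by exists x.
exists (exist _ t it); apply: val_inj; rewrite rmorphM rmorph1 /= -st1.
by congr (_ * _); exact: res_irr.
Qed.

Definition quotient_proj : smorphism X quotient_space.
Proof.
refine (@Smorphism k X quotient_space orbit_proj orbit_proj_cont quotient_pull _ _ _).
- by [].
- by move=> U V h h' s; exact: res_irr.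
- by move=> V s x _; exact: quotient_unit.
Defined.

Lemma quotient_projP : is_quotient act H quotient_proj.
Proof.
split.
- exact: orbit_proj_surj.
- exact: orbit_projP.
- exact: orbit_open.
- by move=> V; exact: val_inj.
- move=> V s; rewrite invariant_sactE; last exact: pre_stable.
  split=> [inv|[t <-] g Hg]; last exact: invariantsP.
  have it : @invariant_pred V s by apply/asboolP; exact: inv.
  by exists (exist _ s it : invariants V).
Qed.

Variables (Y : space k) (f : smorphism X Y).
Hypothesis fact : forall g, eqmor (mcomp f (act g)) f.

Definition quotient_map (z : orbit_space) : Y := f (repr z).

Lemma quotient_mapE x : quotient_map (orbit_proj x) = f x.
Proof.
rewrite /quotient_map.
have /orbit_projP [g Hg e] : orbit_proj (repr (orbit_proj x)) = orbit_proj x.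
  exact: reprK.
rewrite [in RHS]e; exact/esym/(fact g).1.
Qed.

Lemma quotient_map_cont : continuous quotient_map.
Proof.
apply/continuousP => A oA; apply: orbit_open.
have -> : orbit_proj @^-1` (quotient_map @^-1` A) = f @^-1` A.
  by apply/predeqP => x; rewrite /preimage /= quotient_mapE.
by have /continuousP := @mpt_cont _ _ _ f; apply.
Qed.

Lemma quotient_preim (V : opens Y) :
  pre (opreim quotient_map_cont V) `<=` preim f V.
Proof. by move=> x; rewrite /preim /= /preimage /= quotient_mapE. Qed.

Lemma preim_stable_over (V : opens Y) : stable act H (preim f V).
Proof.
move=> g Hg x; rewrite /in_opens /= /preimage /=.
by rewrite -[f (act g x)]/(mcomp f (act g) x) (fact g).1.
Qed.

Lemma sact_pull (V : opens Y) (a : sec V) g : g \in H ->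
  sact act (preim f V) g (pull f V a) = pull f V a.
Proof.
move=> Hg; have h := preim_stable_over (V := V) Hg.
have hV : preim f V `<=` preim (mcomp f (act g)) V by [].
rewrite (sactE h) -[RHS](res_id (fun _ => id)).
rewrite -((fact g).2 V a (preim f V) hV (fun _ => id)) /= /mcomp_pull /=.
by rewrite (res_comp _ _ h).
Qed.

Definition quotient_map_pull0 (V : opens Y) (a : sec V) :
  @sec k quotient_space (opreim quotient_map_cont V).
Proof.
exists (res (@quotient_preim V) (pull f V a)); apply/asboolP => g Hg.
rewrite (sact_res _ _ (@pre_stable _) (@preim_stable_over V)) //.
by rewrite sact_pull.
Defined.

Lemma quotient_map_pull0_zmod V : zmod_morphism (@quotient_map_pull0 V).
Proof. by move=> s t; apply: val_inj; rewrite rmorphB /= !rmorphB. Qed.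

Lemma quotient_map_pull0_monoid V : monoid_morphism (@quotient_map_pull0 V).
Proof. by split=> [|s t]; apply: val_inj; rewrite /= ?rmorph1 // !rmorphM. Qed.

Definition quotient_map_pull V :
    {rmorphism sec V -> @sec k quotient_space (opreim quotient_map_cont V)} :=
  rmorphism_of (@quotient_map_pull0_zmod V) (@quotient_map_pull0_monoid V).

Definition quotient_mor : smorphism quotient_space Y.
Proof.
refine (@Smorphism k quotient_space Y quotient_map quotient_map_cont quotient_map_pull _ _ _).
- by move=> V a; apply: val_inj; rewrite /= pull_scal res_scal.
- move=> U V h h' s; apply: val_inj; rewrite /=.
  rewrite (pull_res h (preim_sub (f := f) h)).
  have hV : pre (opreim quotient_map_cont V) `<=` preim f U.
    by move=> x /quotient_preim; exact: h.
  by rewrite !(res_comp _ _ hV).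
- move=> V s z; have [x <-] := orbit_proj_surj z => Vz uz.
  have Vx : V (f x) by rewrite -quotient_mapE.
  rewrite quotient_mapE; apply/(unit_near_pull (f := f)) => //.
  have := (@unit_near_pull _ _ _ quotient_proj _ (quotient_map_pull V s) x Vz).2 uz.
  by rewrite /= unit_near_res.
Defined.

Lemma quotient_mor_comp : eqmor (mcomp quotient_mor quotient_proj) f.
Proof.
split=> [x|V s W hf hg]; first exact: quotient_mapE.
rewrite /= /mcomp_pull /= /quotient_pull0 /=.
have h : preim (mcomp quotient_mor quotient_proj) V `<=` preim f V.
  exact: quotient_preim.
by rewrite (res_comp _ _ h) (res_comp _ _ hg).
Qed.
End Quotient.

(** * Quotients over a base *)

Lemma inj_surj_bij (S T : Type) (f : S -> T) :
  injective f -> (forall t, exists s, f s = t) -> bijective f.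
Proof.
move=> fi fs; exists (fun t => projT1 (cid (fs t))) => [s|t].
  by apply: fi; exact: projT2 (cid (fs (f s))).
exact: projT2 (cid (fs t)).
Qed.

Section QuotientOver.
Variables (k : fieldType) (X Y Z : space k) (gT : finGroupType).
Variables (act : gT -> smorphism X X) (H : {group gT}).
Variables (f : smorphism X Y) (q : smorphism X Z) (f2 : smorphism Z Y).
Hypothesis actf : action_over f act.
Hypothesis quoq : is_quotient act H q.
Hypothesis f2q : eqmor (mcomp f2 q) f.
Variable cardV : k.
Hypothesis cardK : cardV * #|H|%:R = 1.

Let act1 : eqmor (act 1%g) (mid X). Proof. by case: actf. Qed.
Let actM s t : eqmor (act (s * t)%g) (mcomp (act t) (act s)).
Proof. by case: actf. Qed.
Let fact g : eqmor (mcomp f (act g)) f. Proof. by case: actf. Qed.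
Let stV (V : opens Y) : stable act H (preim f V).
Proof. exact: preim_stable_over. Qed.
Let qact g x : g \in H -> q (act g x) = q x.
Proof. by move=> Hg; case: quoq => _ qP _ _ _; apply/esym/qP; exists g. Qed.
Let q_inj V : injective (pull q V). Proof. by case: quoq. Qed.
Let q_inv (V : opens Z) (s : sec (preim q V)) :
  invariant_section act H s <-> exists t, pull q V t = s.
Proof. by case: quoq => _ _ _ _; apply. Qed.
Let stZ (V : opens Z) : stable act H (preim q V).
Proof. exact: preim_stable. Qed.

Lemma preim_quotient (V : opens Y) : preim q (preim f2 V) = preim f V.
Proof. by apply: opens_eq => x; rewrite /in_opens /= /preimage /= -f2q.1. Qed.

Lemma preim_quotient_sub (V : opens Y) : preim f V `<=` preim q (preim f2 V).
Proof. by rewrite preim_quotient. Qed.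

Lemma preim_quotient_sup (V : opens Y) : preim q (preim f2 V) `<=` preim f V.
Proof. by rewrite preim_quotient. Qed.

(* The sections of (f2)_* O_Z are the invariant sections of f_* O_X. *)
Definition quotient_iota (V : opens Y) : {rmorphism sec (preim f2 V) -> sec (preim f V)} :=
  res (@preim_quotient_sub V) \o pull q (preim f2 V).

Lemma quotient_iota_inj V : injective (quotient_iota V).
Proof.
move=> s t /(congr1 (res (@preim_quotient_sup V))) /=.
have h : preim q (preim f2 V) `<=` preim q (preim f2 V) by [].
by rewrite !(res_comp _ _ h) !res_id; exact: q_inj.
Qed.

Lemma quotient_iotaP V (b : sec (preim f V)) :
  (forall g, g \in H -> sact act (preim f V) g b = b) <->
  exists a, quotient_iota V a = b.
Proof.
have h : preim q (preim f2 V) `<=` preim q (preim f2 V) by [].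
have h' : preim f V `<=` preim f V by [].
split=> [inv|[a <-] g Hg].
  have [|a ea] := (pull_invariant qact q_inv (res (@preim_quotient_sup V) b)).1.
    by move=> g Hg; rewrite (sact_res _ _ (@stZ _) (@stV V)) // inv.
  by exists a; rewrite /quotient_iota /= ea (res_comp _ _ h') res_id.
rewrite /quotient_iota /= (sact_res _ _ (@stV V) (@stZ _)) //.
by congr (res _ _); apply: (pull_invariant qact q_inv _).2 => //; eexists.
Qed.

Lemma quotient_iota_pull V (a : sec V) : quotient_iota V (pull f2 V a) = pull f V a.
Proof.
have h : preim f V `<=` preim (mcomp f2 q) V by exact: preim_quotient_sub.
have h' : preim f V `<=` preim f V by [].
have := f2q.2 V a (preim f V) h h'; rewrite res_id => <-.
rewrite /quotient_iota /= /mcomp_pull /=.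
by rewrite (res_comp _ _ (@preim_quotient_sub V)).
Qed.

Lemma quotient_iota_res (U V : opens Y) (h : V `<=` U) (s : sec (preim f2 U)) :
  quotient_iota V (res (preim_sub (f := f2) h) s) =
  res (preim_sub (f := f) h) (quotient_iota U s).
Proof.
rewrite /quotient_iota /= (pull_res _ (preim_sub (f := q) (preim_sub (f := f2) h))).
have hV : preim f V `<=` preim q (preim f2 U).
  by move=> x /(preim_sub (f := f) h) /preim_quotient_sub.
by rewrite !(res_comp _ _ hV).
Qed.

(** The averages of the generators b_i generate the invariants: taking traces in s = sum a_i b_i,
    with s invariant and a_i from Y, gives the group order times s. *)
Lemma quotient_finite : finite_morphism f -> finite_morphism f2.
Proof.
case: quoq => qs qf _ _ _ fin y; have [V [Vy affV affW [n [b bP]]]] := fin y.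
have affZ : affine (preim f2 V).
  apply: (quotient_affine act1 actM qact q_inj q_inv cardK qs qf).
  by rewrite preim_quotient.
exists V; split=> //; exists n.
have tr i : exists t, quotient_iota V t = \sum_(g in H) sact act (preim f V) g (b i).
  apply/quotient_iotaP => h Hh; rewrite rmorph_sum [RHS](reindex_inj (mulgI h)) /=.
  under [RHS]eq_bigl do rewrite groupMl //.
  by apply: eq_bigr => g Hg; rewrite (sactM actM (@stV V)).
exists (fun i => scal _ cardV * projT1 (cid (tr i))) => s.
have [a ea] := bP (quotient_iota V s); exists a; apply: quotient_iota_inj.
have tE : \sum_(g in H) sact act (preim f V) g (quotient_iota V s) =
    #|H|%:R * quotient_iota V s.
  rewrite mulr_natl -sumr_const; apply: eq_bigr => g Hg.
  by apply: (quotient_iotaP _).2 => //; exists s.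
rewrite rmorph_sum.
transitivity (scal (preim f V) cardV * (#|H|%:R * quotient_iota V s)).
  rewrite mulrA -(rmorph_nat (scal (preim f V))) -rmorphM cardK rmorph1.
  by rewrite mul1r.
rewrite -tE.
under [X in _ * X = _]eq_bigr => g Hg do rewrite ea rmorph_sum.
rewrite exchange_big mulr_sumr; apply: eq_bigr => i _.
rewrite !rmorphM quotient_iota_pull.
have -> : quotient_iota V (projT1 (cid (tr i))) = \sum_(g in H) sact act (preim f V) g (b i).
  exact: projT2 (cid (tr i)).
have -> : quotient_iota V (scal (preim f2 V) cardV) = scal (preim f V) cardV.
  by rewrite /quotient_iota /= pull_scal res_scal.
rewrite mulrCA; congr (_ * _); rewrite mulr_sumr; apply: eq_bigr => g Hg.
by rewrite rmorphM (sact_pull fact _ Hg).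
Qed.

Lemma quotient_locally_free n :
  (forall y : Y, exists (U : opens Y) (b : 'I_n -> sec (preim f U)), [/\ U y,
     forall i g, g \in H -> sact act (preim f U) g (b i) = b i &
     forall (V : opens Y) (h : V `<=` U) (s : sec (preim f V)),
       (forall g, g \in H -> sact act (preim f V) g s = s) ->
       exists! a : 'rV[sec V]_n,
         s = \sum_i pull f V (a 0 i) * res (preim_sub (f := f) h) (b i)]) ->
  direct_image_locally_free f2 n.
Proof.
move=> loc y; have [U [b [Uy bi bP]]] := loc y.
have ib i : exists t, quotient_iota U t = b i.
  by apply/quotient_iotaP => g; exact: bi.
exists U, (fun i => projT1 (cid (ib i))); split=> // V h s.
have [|a [ea ua]] := bP V h (quotient_iota V s).
  by apply/quotient_iotaP; exists s.
have E (a' : 'rV[sec V]_n) : quotient_iota V (\sum_i pull f2 V (a' 0 i) *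
      res (preim_sub (f := f2) h) (projT1 (cid (ib i)))) =
    \sum_i pull f V (a' 0 i) * res (preim_sub (f := f) h) (b i).
  rewrite rmorph_sum; apply: eq_bigr => i _.
  rewrite rmorphM quotient_iota_pull quotient_iota_res.
  by congr (_ * res _ _); exact: projT2 (cid (ib i)).
exists a; split=> [|a' ea']; first by apply: quotient_iota_inj; rewrite E.
by apply: ua; rewrite -E -ea'.
Qed.

Lemma quotient_splits (M : modsheaf Y) (j : pushhom f M) :
  (forall (U : opens Y) m g, g \in H -> sact act (preim f U) g (j U m) = j U m) ->
  (forall (U : opens Y) (s : sec (preim f U)),
     (forall g, g \in H -> sact act (preim f U) g s = s) ->
     exists a m, s = pull f U a + j U m) ->
  (forall (U : opens Y) a m, pull f U a + j U m = 0 -> a = 0 /\ m = 0) ->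
  splits_as f2 M.
Proof.
move=> ji js jinj.
have ij U m : exists t, quotient_iota U t = j U m.
  by apply/quotient_iotaP => g; exact: ji.
pose j2 U m := projT1 (cid (ij U m)).
have j2E U m : quotient_iota U (j2 U m) = j U m := projT2 (cid (ij U m)).
have j2D U m n : j2 U (m + n) = j2 U m + j2 U n.
  by apply: quotient_iota_inj; rewrite rmorphD !j2E phomD.
have j2Z U a m : j2 U (a *: m) = pull f2 U a * j2 U m.
  by apply: quotient_iota_inj; rewrite rmorphM quotient_iota_pull !j2E phomZ.
have j2r (U V : opens Y) (h : V `<=` U) m :
    j2 V (mres h m) = res (preim_sub (f := f2) h) (j2 U m).
  by apply: quotient_iota_inj; rewrite quotient_iota_res !j2E phom_res.
exists (Pushhom j2D j2Z j2r) => U /=; apply: inj_surj_bij => [[a m] [a' m'] /= e|s].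
  have := congr1 (quotient_iota U) e; rewrite !rmorphD !quotient_iota_pull !j2E => {}e.
  have jB : j U (m - m') = j U m - j U m'.
    by rewrite -[m' in LHS]scale1r -scaleNr phomD phomZ rmorphN rmorph1 mulN1r.
  have [|/subr0_eq -> /subr0_eq ->] // := jinj U (a - a') (m - m').
  by rewrite rmorphB jB addrACA e -opprD subrr.
have [|a [m e]] := js U (quotient_iota U s).
  by apply/quotient_iotaP; exists s.
by exists (a, m); apply: quotient_iota_inj; rewrite rmorphD quotient_iota_pull j2E.
Qed.
End QuotientOver.

(** * Binary products with nonzero discriminant *)

(* The symmetric product on k^2 with p p = e1 p + e0 q, p q = - e2 p - e1 q and
   q q = e3 p + e2 q.  Multiplications have trace 0, so a product is the same as a
   binary cubic form; its discriminant is Delta, and the product vanishes on the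
   pair of zeros of the Hessian form. *)
Section BinaryProduct.
Variable k : closedFieldType.
Variables e0 e1 e2 e3 : k.

Let prod1 (a b c d : k) := a * c * e1 - (a * d + b * c) * e2 + b * d * e3.
Let prod2 (a b c d : k) := a * c * e0 - (a * d + b * c) * e1 + b * d * e2.
Let H0 := e0 * e2 - e1 ^+ 2.
Let H1 := e0 * e3 - e1 * e2.
Let H2 := e1 * e3 - e2 ^+ 2.

Hypothesis disc : H1 ^+ 2 - 4%:R * H0 * H2 != 0.

(** The product of (x1, y1) and (x2, y2) is linear in (y1 y2, x1 y2 + y1 x2, x1 x2) and vanishes
    when this triple is proportional to (H0, H1, H2), by the relations between the minors of the
    matrix with rows (e0, e1, e2), (e1, e2, e3). So both points are zeros of the form H0 X^2 - H1 X
    Y + H2 Y^2, and they are distinct as its discriminant is nonzero. *)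
Lemma hessian_zeros : exists x1 y1 x2 y2 : k,
  [/\ x1 * y2 - y1 * x2 != 0, prod1 x1 y1 x2 y2 = 0 & prod2 x1 y1 x2 y2 = 0].
Proof.
suff [x1 [y1 [x2 [y2 [c [c0 h0 h1 h2]]]]]] : exists x1 y1 x2 y2 c : k,
    [/\ c != 0, y1 * y2 = c * H0, x1 * y2 + y1 * x2 = c * H1 & x1 * x2 = c * H2].
  exists x1, y1, x2, y2; split.
  - have E : (x1 * y2 - y1 * x2) ^+ 2 = c ^+ 2 * (H1 ^+ 2 - 4%:R * H0 * H2).
      transitivity ((x1 * y2 + y1 * x2) ^+ 2 - 4%:R * (y1 * y2) * (x1 * x2)); first by ring.
      by rewrite h0 h1 h2; ring.
    by rewrite -sqrf_eq0 E mulf_neq0 // sqrf_eq0.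
  - by rewrite /prod1 h0 h1 h2 /H0 /H1 /H2; ring.
  - by rewrite /prod2 h0 h1 h2 /H0 /H1 /H2; ring.
(* If H0 = 0, one of the zeros is the point at infinity (1 : 0); otherwise both are affine, with sum
   H1 / H0. *)
have [H00|H00] := eqVneq H0 0.
  exists 1, 0, H2, H1, 1; rewrite H00 oner_neq0; split=> //; ring.
have [r er] := @solve_monicpoly k 2 (fun i => if i == 0%N then - H2 / H0 else H1 / H0) isT.
rewrite !big_ord_recl big_ord0 /= expr0 expr1 mulr1 addr0 in er.
exists r, 1, (H1 / H0 - r), 1, (H0^-1); rewrite invr_neq0 //; split=> //.
- by rewrite mulVf // mulr1.
- by field.
- rewrite mulrBr -expr2 er; by field.
Qed.

Lemma product_square (x1 y1 x2 y2 : k) : x1 * y2 - y1 * x2 != 0 ->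
  prod1 x1 y1 x2 y2 = 0 -> prod2 x1 y1 x2 y2 = 0 ->
  exists2 b, b != 0 & prod1 x1 y1 x1 y1 = b * x2 /\ prod2 x1 y1 x1 y1 = b * y2.
Proof.
move=> dt p1 p2.
set P := prod1 x1 y1 x1 y1; set Q := prod2 x1 y1 x1 y1.
(* Total symmetry of the associated cubic form: pairing u u with v by the determinant is pairing u v
   with u, and u v = 0. Hence u u is a multiple of v. *)
have tr : P * y2 - Q * x2 = 0.
  transitivity (y1 * prod1 x1 y1 x2 y2 - x1 * prod2 x1 y1 x2 y2).
    by rewrite /P /Q /prod1 /prod2; ring.
  by rewrite p1 p2; ring.
pose b := (x1 * Q - y1 * P) / (x1 * y2 - y1 * x2).
have eP : P = b * x2.
  apply: (mulIf dt); rewrite /b mulrAC divfK //.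
  by rewrite -[LHS]subr0 -[X in _ - X](mulr0 x1) -tr; ring.
have eQ : Q = b * y2.
  apply: (mulIf dt); rewrite /b mulrAC divfK //.
  by rewrite -[LHS]subr0 -[X in _ - X](mulr0 y1) -tr; ring.
(* If u u = 0, then u annihilates the plane and x1 e_i = y1 e_(i+1) for i = 0, 1, 2. Then x1 and y1
   annihilate the Hessian coefficients H0 and H1, which contradicts [disc]. *)
exists b => //; apply/eqP => b0; move: eP eQ; rewrite b0 !mul0r => eP eQ.
have z1 : x1 * e1 - y1 * e2 = 0.
  apply: (mulIf dt); rewrite mul0r.
  transitivity (y2 * P - y1 * prod1 x1 y1 x2 y2); first by rewrite /P /prod1; ring.
  by rewrite eP p1; ring.
have z0 : x1 * e0 - y1 * e1 = 0.
  apply: (mulIf dt); rewrite mul0r.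
  transitivity (y2 * Q - y1 * prod2 x1 y1 x2 y2); first by rewrite /Q /prod2; ring.
  by rewrite eQ p2; ring.
have z2 : x1 * e2 - y1 * e3 = 0.
  apply: (mulIf dt); rewrite mul0r.
  transitivity (x2 * P - x1 * prod1 x1 y1 x2 y2); first by rewrite /P /prod1; ring.
  by rewrite eP p1; ring.
have k0 : x1 * H0 = 0 /\ y1 * H0 = 0.
  split; [transitivity (e2 * (x1 * e0 - y1 * e1) - e1 * (x1 * e1 - y1 * e2))
         |transitivity (e1 * (x1 * e0 - y1 * e1) - e0 * (x1 * e1 - y1 * e2))];
    by [rewrite /H0; ring | rewrite z0 z1; ring].
have k1 : x1 * H1 = 0 /\ y1 * H1 = 0.
  split; [transitivity (e3 * (x1 * e0 - y1 * e1) - e1 * (x1 * e2 - y1 * e3))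
         |transitivity (e2 * (x1 * e0 - y1 * e1) - e0 * (x1 * e2 - y1 * e3))];
    by [rewrite /H1; ring | rewrite z0 z2; ring].
have dx (x : k) : x * H0 = 0 -> x * H1 = 0 -> x = 0.
  move=> a0 a1; apply: (mulIf disc); rewrite mul0r.
  transitivity (H1 * (x * H1) - 4%:R * H2 * (x * H0)); first by ring.
  by rewrite a0 a1; ring.
by move: dt; rewrite (dx x1 k0.1 k1.1) (dx y1 k0.2 k1.2) !mul0r subr0 eqxx.
Qed.

Lemma product_normal_form : exists a b c d : k,
  [/\ a * d - b * c != 0,
      prod1 a b a b = c /\ prod2 a b a b = d,
      prod1 a b c d = 0 /\ prod2 a b c d = 0 &
      prod1 c d c d = a /\ prod2 c d c d = b].
Proof.
have [x1 [y1 [x2 [y2 [dt p1 p2]]]]] := hessian_zeros.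
have [b b0 [b1 b2]] := product_square dt p1 p2.
have [|||g g0 [g1 g2]] := @product_square x2 y2 x1 y1.
- by rewrite -oppr_eq0 opprB [y2 * _]mulrC [x2 * _]mulrC.
- by rewrite -p1 /prod1; ring.
- by rewrite -p2 /prod2; ring.
(* Given u u = b v and v v = g u, rescale to l u and its square l^2 b v. The square of the latter is
   l^4 b^2 g u, which equals l u exactly when l^3 b^2 g = 1. *)
have [l el] := @solve_monicpoly k 3 (fun i => if i == 0%N then (b ^+ 2 * g)^-1 else 0) isT.
rewrite !big_ord_recl big_ord0 /= expr0 mulr1 !mul0r !addr0 in el.
have bg0 : b ^+ 2 * g != 0 by rewrite mulf_neq0 // sqrf_eq0.
have l0 : l != 0.
  apply: contra_neq bg0 => l0; move: el; rewrite l0 expr0n /= => /esym/eqP.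
  by rewrite invr_eq0 => /eqP.
have lE : l ^+ 3 * (b ^+ 2 * g) = 1 by rewrite el mulVf.
exists (l * x1), (l * y1), (l ^+ 2 * b * x2), (l ^+ 2 * b * y2).
have sc (F : k -> k -> k -> k -> k) (s t a1 a2 a3 a4 : k) :
  (F = prod1 \/ F = prod2) -> F (s * a1) (s * a2) (t * a3) (t * a4) = s * t * F a1 a2 a3 a4.
  by case=> ->; rewrite /prod1 /prod2; ring.
split.
- have -> : l * x1 * (l ^+ 2 * b * y2) - l * y1 * (l ^+ 2 * b * x2) =
    l ^+ 3 * b * (x1 * y2 - y1 * x2) by ring.
  by rewrite !mulf_neq0 // expf_neq0.
- by rewrite !(sc prod1) ?(sc prod2); [rewrite b1 b2; split; ring|right|left].
- by rewrite !(sc prod1) ?(sc prod2); [rewrite p1 p2; split; ring|right|left].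
- rewrite !(sc prod1) ?(sc prod2); [rewrite g1 g2|by right|by left].
  have E z : l ^+ 2 * b * (l ^+ 2 * b) * (g * z) = l * z.
    by rewrite -[RHS]mul1r -lE; ring.
  by rewrite !E.
Qed.
End BinaryProduct.

(** * Matrix forms and polynomial presentations *)

Import -(notations) mpoly.
Import Defs.

Section MapForms.
Variables (R S : comPzRingType) (g : {rmorphism R -> S}).

Lemma map_mx_of_rows m n (s : seq (seq R)) :
  map_mx g (mx_of_rows m n s) = mx_of_rows m n (map (map g) s).
Proof.
apply/matrixP => i j; rewrite !mxE.
have [ltis|leis] := ltnP i (size s).
  rewrite (nth_map [::]) //; have [ltj|lej] := ltnP j (size (nth [::] s i)).
    by rewrite (nth_map 0).
  by rewrite (nth_default _ lej) rmorph0 nth_default // size_map.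
by rewrite (nth_default [::] leis) nth_nil rmorph0 (nth_default [::]) ?size_map ?nth_nil.
Qed.

Lemma map_Ctilde c : map_mx g (Ctilde c) = Ctilde (g \o c).
Proof. by rewrite /Ctilde map_mx_of_rows /= !rmorphN. Qed.

Lemma map_Dtilde h c : map_mx g (Dtilde h c) = Dtilde (g h) (g \o c).
Proof. by rewrite /Dtilde map_mx_of_rows /= !(rmorphM, rmorphB, rmorphXn). Qed.

Lemma map_linear_Phi e c :
  map_mx g (linear_Phi_mx e c) = linear_Phi_mx (g \o e) (g \o c).
Proof.
by rewrite /linear_Phi_mx !map_col_mx !map_row_mx !map_mxZ !map_Ctilde !rmorphN.
Qed.

Lemma map_normal_Phi c : map_mx g (normal_Phi_mx c) = normal_Phi_mx (g \o c).
Proof. by rewrite /normal_Phi_mx !map_col_mx !map_row_mx !map_mx0 !map_Ctilde. Qed.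

Lemma map_normal_const h c :
  map_mx g (normal_const h c) = normal_const (g h) (g \o c).
Proof. by rewrite /normal_const !map_col_mx !map_mx0 map_Dtilde. Qed.

Lemma map_S2 z : map_mx g (S2 z) = S2 (map_mx g z).
Proof. by rewrite /S2 map_mx_of_rows /= !(mxE, rmorphM, rmorphXn). Qed.

Lemma map_S2mixed h z w :
  map_mx g (S2mixed h z w) = S2mixed (g h) (map_mx g z) (map_mx g w).
Proof. by rewrite /S2mixed map_mx_of_rows /= !(mxE, rmorphM, rmorphD). Qed.

Lemma map_quadrics h x : map_mx g (quadrics h x) = quadrics (g h) (map_mx g x).
Proof.
by rewrite /quadrics !map_col_mx map_S2mixed !map_S2 map_usubmx map_dsubmx.
Qed.
End MapForms.

Section VectorForms.
Variables (S : comPzRingType) (h : S).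
Hypothesis hK : 2%:R * h = 1.
Implicit Types (z w : 'cV[S]_2) (c : 'I_4 -> S).

Lemma S2_entries z : [/\ S2 z 0 0 = z ord0 0 * z ord0 0,
  S2 z 1 0 = z ord0 0 * z ord_max 0 & S2 z 2%:R 0 = z ord_max 0 * z ord_max 0].
Proof. by split; rewrite mxE. Qed.
Lemma I3_ind (P : 'I_3 -> Prop) : P 0 -> P 1 -> P 2%:R -> forall i, P i.
Proof.
move=> P0 P1 P2 [[|[|[|//]]] hi].
- by have -> : Ordinal hi = 0 by exact: val_inj.
- by have -> : Ordinal hi = 1 by exact: val_inj.
- by have -> : Ordinal hi = 2%:R by exact: val_inj.
Qed.

Lemma col3P (u v : 'cV[S]_3) :
  [/\ u 0 0 = v 0 0, u 1 0 = v 1 0 & u 2%:R 0 = v 2%:R 0] -> u = v.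
Proof. by move=> [*]; apply/matrixP => i j; rewrite ord1; elim/I3_ind: i. Qed.

(** The factor 1/2 in its middle entry makes [S2mixed] the polarization of [S2]. Hence a linear
    change of (z, w) acts on the three blocks of quadrics through its symmetric square. *)
Lemma S2_comb (a b : S) z w : S2 (a *: z + b *: w) =
  a ^+ 2 *: S2 z + (2%:R * a * b) *: S2mixed h z w + b ^+ 2 *: S2 w.
Proof.
apply: col3P; split; rewrite !mxE /=; try by ring.
rewrite [2%:R * a * b * _](_ : _ = (2%:R * h) * (a * b *
  (z ord0 0 * w ord_max 0 + z ord_max 0 * w ord0 0))); last by ring.
by rewrite hK; ring.
Qed.

Lemma S2mixed_comb (a b a' b' : S) z w :
  S2mixed h (a *: z + b *: w) (a' *: z + b' *: w) =
  (a * a') *: S2 z + (a * b' + b * a') *: S2mixed h z w + (b * b') *: S2 w.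
Proof.
apply: col3P; split; rewrite !mxE /=; try by ring.
transitivity ((2%:R * h) * (a * a' * (z ord0 0 * z ord_max 0) +
  b * b' * (w ord0 0 * w ord_max 0)) +
  (a * b' + b * a') * (h * (z ord0 0 * w ord_max 0 + z ord_max 0 * w ord0 0))).
  by ring.
by rewrite hK; ring.
Qed.

Lemma Ctilde_mul c z :
  let c0 := c ord0 in let c1 := c (inord 1) in
  let c2 := c (inord 2) in let c3 := c (inord 3) in
  [/\ (Ctilde c *m z) 0 0 = c1 * z ord0 0 + c0 * z ord_max 0,
      (Ctilde c *m z) 1 0 = - c2 * z ord0 0 - c1 * z ord_max 0 &
      (Ctilde c *m z) 2%:R 0 = c3 * z ord0 0 + c2 * z ord_max 0].
Proof.
have E : lift ord0 (ord0 : 'I_1) = ord_max :> 'I_2 by exact: val_inj.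
by split; rewrite mxE !big_ord_recl big_ord0 !mxE /= E addr0 ?mulNr.
Qed.
End VectorForms.

Section Blocks.
Variables (S : comPzRingType) (h : S).
Implicit Types (x d : 'cV[S]_(2 + 2)) (e c : 'I_4 -> S).

Lemma linear_relations_blocks e c x (d : 'cV[S]_(3 + 3 + 3)) :
  let Cz := Ctilde c *m usubmx x in let Cw := Ctilde c *m dsubmx x in
  quadrics h x - linear_Phi_mx e c *m x - d =
  col_mx (col_mx
    (S2 (usubmx x) - (e (inord 1) *: Cz + e ord0 *: Cw) - usubmx (usubmx d))
    (S2mixed h (usubmx x) (dsubmx x)
       - (- e (inord 2) *: Cz - e (inord 1) *: Cw) - dsubmx (usubmx d)))
    (S2 (dsubmx x) - (e (inord 3) *: Cz + e (inord 2) *: Cw) - dsubmx d).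
Proof.
rewrite /= -[x in linear_Phi_mx e c *m x]vsubmxK -[d in LHS]vsubmxK.
rewrite -[usubmx d in LHS]vsubmxK /quadrics /linear_Phi_mx.
rewrite !mul_col_mx !mul_row_col !opp_col_mx !add_col_mx.
by rewrite -!scalemxAl !scaleNr.
Qed.

Lemma normal_relations_blocks c x :
  let Cz := Ctilde c *m usubmx x in let Cw := Ctilde c *m dsubmx x in
  quadrics h x - normal_Phi_mx c *m x - normal_const h c =
  col_mx (col_mx (S2 (usubmx x) - Cw)
    (S2mixed h (usubmx x) (dsubmx x) - Dtilde h c)) (S2 (dsubmx x) - Cz).
Proof.
rewrite /= -[x in normal_Phi_mx c *m x]vsubmxK.
rewrite /quadrics /normal_Phi_mx /normal_const.
rewrite !mul_col_mx !mul_row_col !opp_col_mx !add_col_mx.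
by rewrite !mul0mx add0r !addr0 !subr0.
Qed.
End Blocks.

Section Ideals.
Variables (P : comPzRingType) (n : nat) (g : 'cV[P]_n).

Lemma ideal_of_gen i : ideal_of g (g i 0).
Proof.
exists (delta_mx 0 i); rewrite mxE (bigD1 i) //= mxE !eqxx mul1r big1 ?addr0 //.
by move=> j ji; rewrite mxE (negbTE ji) andbF mul0r.
Qed.

Lemma ideal_of_add p q : ideal_of g p -> ideal_of g q -> ideal_of g (p + q).
Proof. by move=> [a ->] [b ->]; exists (a + b); rewrite mulmxDl [in RHS]mxE. Qed.

Lemma ideal_of_mul p q : ideal_of g q -> ideal_of g (p * q).
Proof. by move=> [a ->]; exists (p *: a); rewrite -scalemxAl [in RHS]mxE. Qed.

Lemma ideal_of_zero : ideal_of g 0.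
Proof. by exists 0; rewrite mul0mx mxE. Qed.
End Ideals.

Lemma ideal_of_map (P Q : comPzRingType) (phi : {rmorphism P -> Q}) m n
    (g : 'cV[P]_m) (g' : 'cV[Q]_n) p :
  (forall i, ideal_of g' (phi (g i 0))) -> ideal_of g p -> ideal_of g' (phi p).
Proof.
move=> gg' [a ->]; rewrite mxE rmorph_sum.
elim/big_ind: _ => [|q r|i _]; first exact: ideal_of_zero.
  exact: ideal_of_add.
by rewrite rmorphM; exact: ideal_of_mul.
Qed.

(** * Polynomial presentations under a linear change of generators *)

Section Polynomials.
Variable R : comNzRingType.
Local Notation P := (mpoly.mpoly 4 R).
Local Notation C := (@mpoly.mpolyC 4 R).

Lemma mpoly_rmorph_ext (S : comPzRingType) (phi psi : {rmorphism P -> S}) :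
  (forall a, phi (C a) = psi (C a)) ->
  (forall i, phi (mpoly.mpolyX R (mpoly.mnm1 i)) = psi (mpoly.mpolyX R (mpoly.mnm1 i))) ->
  phi =1 psi.
Proof.
move=> hC hX p; rewrite (mpoly.mpolyE p) !rmorph_sum; apply: eq_bigr => m _.
rewrite -mpoly.mul_mpolyC !rmorphM hC; congr (_ * _).
rewrite mpoly.mpolyXE_id !rmorph_prod; apply: eq_bigr => i _.
by rewrite !rmorphXn hX.
Qed.

Lemma map_relations (S : comPzRingType) (phi : {rmorphism P -> S}) half A d :
  map_mx phi (relations half A d) =
  quadrics (phi (C half)) (map_mx phi (coordinates R))
  - map_mx (phi \o C) A *m map_mx phi (coordinates R) - map_mx (phi \o C) d.
Proof.
by rewrite /relations !map_mxB map_mxM map_quadrics -!map_mx_comp.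
Qed.

Section Evaluation.
Variables (B : comNzRingType) (f : {rmorphism R -> B}) (x : 'I_4 -> B).

Lemma mmap_coordinates : map_mx (mpoly.mmap f x) (coordinates R) = \col_i x i.
Proof.
by apply/matrixP => i j; rewrite !mxE mpoly.mmapX mpoly.mmap1U.
Qed.

Lemma mmap_comp_C : mpoly.mmap f x \o C =1 f.
Proof. by move=> a; rewrite /= mpoly.mmapC. Qed.

Lemma mmap_relations half A d : map_mx (mpoly.mmap f x) (relations half A d) =
  quadrics (f half) (\col_i x i) - map_mx f A *m (\col_i x i) - map_mx f d.
Proof.
rewrite map_relations mmap_coordinates.
rewrite !(eq_map_mx _ mmap_comp_C).
by rewrite [X in quadrics X _](mmap_comp_C half).
Qed.

Lemma presented_relations half A d : presented_by half A d f x ->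
  quadrics (f half) (\col_i x i) - map_mx f A *m (\col_i x i) - map_mx f d = 0.
Proof.
move=> [_ ker]; rewrite -mmap_relations; apply/matrixP => i j.
by rewrite ord1 mxE [RHS]mxE; apply/ker; exact: ideal_of_gen.
Qed.
End Evaluation.

(** Substitution by G and by G' gives inverse automorphisms of the polynomial ring that exchange the
    kernels for x and x'. That the new relations hold at x' puts their ideal into the kernel; that
    the transformed old relations lie in the new ideal gives the converse. *)
Lemma presented_change (B : comNzRingType) (f : {rmorphism R -> B}) (x x' : 'I_4 -> B)
    half A d A' d' (G G' : 'M[R]_(2 + 2)) :
  presented_by half A d f x ->
  G *m G' = 1%:M ->
  (forall i, x i = \sum_j f (G i j) * x' j) ->
  (forall i, x' i = \sum_j f (G' i j) * x j) ->
  quadrics (f half) (\col_i x' i) - map_mx f A' *m (\col_i x' i) - map_mx f d' = 0 ->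
  (forall i, ideal_of (relations half A' d')
     ((quadrics (C half) (map_mx C G *m coordinates R)
       - map_mx C A *m (map_mx C G *m coordinates R) - map_mx C d) i 0)) ->
  presented_by half A' d' f x'.
Proof.
move=> [surj ker] GG' xE x'E rel' sub.
have G'G : G' *m G = 1%:M by exact: mulmx1C.
pose lin (H : 'M[R]_(2 + 2)) (i : 'I_4) : P := (map_mx C H *m coordinates R) i 0.
pose psi H : {rmorphism P -> P} := mpoly.mmap C (lin H).
have linE (H : 'M[R]_(2 + 2)) (y : 'I_4 -> B) i :
    mpoly.mmap f y (lin H i) = \sum_j f (H i j) * y j.
  rewrite /lin mxE rmorph_sum; apply: eq_bigr => j _.
  by rewrite rmorphM !mxE /= mpoly.mmapC mpoly.mmapX mpoly.mmap1U.
have psiK (H H' : 'M[R]_(2 + 2)) p : H *m H' = 1%:M -> psi H' (psi H p) = p.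
  move=> HH'; rewrite -[RHS]/(idfun p).
  apply: (@mpoly_rmorph_ext _ (psi H' \o psi H) idfun) => [a|i] /=.
    by rewrite /psi !mpoly.mmapC.
  rewrite /psi mpoly.mmapX mpoly.mmap1U /lin.
  rewrite mxE rmorph_sum /=.
  under eq_bigr => j _ do rewrite rmorphM !mxE /= mpoly.mmapC mpoly.mmapX mpoly.mmap1U.
  transitivity ((map_mx C H *m (map_mx C H' *m coordinates R)) i 0).
    rewrite [RHS]mxE; apply: eq_bigr => j _. by rewrite [(map_mx C H) _ _]mxE.
  by rewrite mulmxA -map_mxM HH' map_mx1 mul1mx mxE.
have psiE (H : 'M[R]_(2 + 2)) (y y' : 'I_4 -> B) p :
    (forall i, y' i = \sum_j f (H i j) * y j) ->
    mpoly.mmap f y (psi H p) = mpoly.mmap f y' p.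
  move=> yE; apply: (@mpoly_rmorph_ext _ (mpoly.mmap f y \o psi H) (mpoly.mmap f y'))
    => [a|i] /=.
    by rewrite /psi !mpoly.mmapC.
  by rewrite /psi !mpoly.mmapX !mpoly.mmap1U linE yE.
split=> [b|p].
  have [p <-] := surj b; exists (psi G p).
  by apply: psiE.
split=> [p0|].
  have : ideal_of (relations half A d) (psi G' p).
    by apply/ker; rewrite (psiE G' x x').
  move=> /(@ideal_of_map _ _ (psi G) _ _ _ (relations half A' d')) h.
  rewrite -(psiK G' G p) //; apply: h => i.
  have -> : psi G (relations half A d i 0) = map_mx (psi G) (relations half A d) i 0.
    by rewrite [RHS]mxE.
  rewrite map_relations.
  have E : psi G \o C =1 C by move=> a; rewrite /= /psi mpoly.mmapC.
  have -> : map_mx (psi G) (coordinates R) = map_mx C G *m coordinates R.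
    apply/matrixP => l j; rewrite ord1 [LHS]mxE.
    have -> : coordinates R l 0 = mpoly.mpolyX R (mpoly.mnm1 l) by rewrite mxE.
    by rewrite /psi /= mpoly.mmapX mpoly.mmap1U.
  rewrite !(eq_map_mx _ E) [X in quadrics X _](E half).
  exact: sub.
move=> /(@ideal_of_map _ _ (mpoly.mmap f x') _ _ _ (0 : 'cV_1)) h.
have E i : mpoly.mmap f x' (relations half A' d' i 0) = 0.
  have := congr1 (fun M : 'cV_(3 + 3 + 3) => M i 0) (mmap_relations f x' half A' d').
  by rewrite rel' mxE [RHS]mxE.
have [i|a ->] := h; last by rewrite mulmx0 mxE.
exact: (eq_ind_r (ideal_of 0) (ideal_of_zero _) (E i)).
Qed.
End Polynomials.

(** * The algebra of the normal form *)

Section NormalRelations.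
Variables (R B : comPzRingType) (f : {rmorphism R -> B}) (h : R).
Hypothesis hK : 2%:R * h = 1.
Variables c0 c1 c2 c3 : R.

Let fhK : 2%:R * f h = 1.
Proof. by rewrite -(rmorph_nat f) -rmorphM hK rmorph1. Qed.

Lemma half_eq (x y : B) : 2%:R * x = y -> x = f h * y.
Proof. by move=> <-; rewrite mulrA [f h * _]mulrC fhK mul1r. Qed.

(** The nine entries of the normal form, with the middle mixed relation multiplied by 2. *)
Definition normal_rel (z1 z2 w1 w2 : B) : Prop :=
  [/\ [/\ z1 * z1 = f c1 * w1 + f c0 * w2, z1 * z2 = - f c2 * w1 - f c1 * w2 &
          z2 * z2 = f c3 * w1 + f c2 * w2],
      [/\ z1 * w1 = f (c1 ^+ 2 - c0 * c2), z1 * w2 + z2 * w1 = f (c0 * c3 - c1 * c2) &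
          z2 * w2 = f (c2 ^+ 2 - c1 * c3)] &
      [/\ w1 * w1 = f c1 * z1 + f c0 * z2, w1 * w2 = - f c2 * z1 - f c1 * z2 &
          w2 * w2 = f c3 * z1 + f c2 * z2]].

Lemma normal_rel_swap z1 z2 w1 w2 : normal_rel z1 z2 w1 w2 -> normal_rel w1 w2 z1 z2.
Proof.
move=> [r1 [s1 s2 s3] r2]; split=> //.
by split; [rewrite mulrC | rewrite -s2; ring | rewrite mulrC].
Qed.

Definition lincomb (z1 z2 w1 w2 : B) (a0 a1 a2 a3 a4 a5 : R) : B :=
  f a0 + f a1 * z1 + f a2 * z2 + f a3 * w1 + f a4 * w2 + f a5 * (z1 * w2 - z2 * w1).

Lemma lincomb_swap z1 z2 w1 w2 a0 a1 a2 a3 a4 a5 :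
  lincomb z1 z2 w1 w2 a0 a1 a2 a3 a4 a5 = lincomb w1 w2 z1 z2 a0 a3 a4 a1 a2 (- a5).
Proof. by rewrite /lincomb; ring. Qed.

Let K := c0 * c3 - c1 * c2.

Section Products.
Variables z1 z2 w1 w2 : B.
Hypothesis nr : normal_rel z1 z2 w1 w2.
Let v := z1 * w2 - z2 * w1.

Lemma z1w2E : z1 * w2 = f h * (f K + v).
Proof.
case: nr => _ [_ s2 _] _; apply: half_eq.
by rewrite -s2 /v; ring.
Qed.

Lemma z2w1E : z2 * w1 = f h * (f K - v).
Proof.
case: nr => _ [_ s2 _] _; apply: half_eq.
by rewrite -s2 /v; ring.
Qed.

(** Reducing z1 z1 and z1 z2 leaves a quadratic expression in w, which the third group of relations
    makes linear in z. *)
Lemma z1vE : z1 * v = f K * z1 + f (2%:R * (c0 * c2 - c1 ^+ 2)) * z2.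
Proof.
case: nr => [[q1 q2 q3] [s1 s2 s3] [p1 p2 p3]].
transitivity ((z1 * z1) * w2 - (z1 * z2) * w1); first by rewrite /v; ring.
rewrite q1 q2.
transitivity (2%:R * f c1 * (w1 * w2) + f c0 * (w2 * w2) + f c2 * (w1 * w1)); first by ring.
by rewrite p1 p2 p3 /K; ring.
Qed.

Lemma z2vE : z2 * v = f (2%:R * (c2 ^+ 2 - c1 * c3)) * z1 - f K * z2.
Proof.
case: nr => [[q1 q2 q3] [s1 s2 s3] [p1 p2 p3]].
transitivity ((z1 * z2) * w2 - (z2 * z2) * w1); first by rewrite /v; ring.
rewrite q2 q3.
transitivity (- 2%:R * f c2 * (w1 * w2) - f c1 * (w2 * w2) - f c3 * (w1 * w1)); first by ring.
by rewrite p1 p2 p3 /K; ring.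
Qed.

(** With [z2_lincomb] this is half of the multiplication table on 1, z, w, v. The exchange of z and
    w, which changes the sign of v, gives the other half. *)
Lemma z1_lincomb a0 a1 a2 a3 a4 a5 : z1 * lincomb z1 z2 w1 w2 a0 a1 a2 a3 a4 a5 =
  lincomb z1 z2 w1 w2 (a3 * (c1 ^+ 2 - c0 * c2) + a4 * (h * K))
    (a0 + a5 * K) (a5 * (2%:R * (c0 * c2 - c1 ^+ 2)))
    (a1 * c1 - a2 * c2) (a1 * c0 - a2 * c1) (a4 * h).
Proof.
case: (nr) => [[q1 q2 q3] [s1 s2 s3] _].
transitivity (f a0 * z1 + f a1 * (z1 * z1) + f a2 * (z1 * z2) + f a3 * (z1 * w1)
  + f a4 * (z1 * w2) + f a5 * (z1 * v)); first by rewrite /lincomb /v; ring.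
by rewrite q1 q2 s1 z1w2E z1vE /lincomb /v; ring.
Qed.

Lemma z2_lincomb a0 a1 a2 a3 a4 a5 : z2 * lincomb z1 z2 w1 w2 a0 a1 a2 a3 a4 a5 =
  lincomb z1 z2 w1 w2 (a3 * (h * K) + a4 * (c2 ^+ 2 - c1 * c3))
    (a5 * (2%:R * (c2 ^+ 2 - c1 * c3))) (a0 - a5 * K)
    (a2 * c3 - a1 * c2) (a2 * c2 - a1 * c1) (- (a3 * h)).
Proof.
case: (nr) => [[q1 q2 q3] [s1 s2 s3] _].
transitivity (f a0 * z2 + f a1 * (z1 * z2) + f a2 * (z2 * z2) + f a3 * (z2 * w1)
  + f a4 * (z2 * w2) + f a5 * (z2 * v)); first by rewrite /lincomb /v; ring.
by rewrite q2 q3 s3 z2w1E z2vE /lincomb /v; ring.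
Qed.
End Products.

Section Spanned.
Variables z1 z2 w1 w2 : B.
Hypothesis nr : normal_rel z1 z2 w1 w2.
Local Notation lc := (lincomb z1 z2 w1 w2).

Definition in_span (b : B) : Prop := exists a0 a1 a2 a3 a4 a5, b = lc a0 a1 a2 a3 a4 a5.

Lemma in_span_add b b' : in_span b -> in_span b' -> in_span (b + b').
Proof.
move=> [a0 [a1 [a2 [a3 [a4 [a5 ->]]]]]] [d0 [d1 [d2 [d3 [d4 [d5 ->]]]]]].
exists (a0 + d0), (a1 + d1), (a2 + d2), (a3 + d3), (a4 + d4), (a5 + d5).
by rewrite /lincomb; ring.
Qed.

Lemma in_span_scale a b : in_span b -> in_span (f a * b).
Proof.
move=> [a0 [a1 [a2 [a3 [a4 [a5 ->]]]]]].
exists (a * a0), (a * a1), (a * a2), (a * a3), (a * a4), (a * a5).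
by rewrite /lincomb; ring.
Qed.

Lemma in_span_const a : in_span (f a).
Proof. by exists a, 0, 0, 0, 0, 0; rewrite /lincomb; ring. Qed.

Lemma in_span_z1 b : in_span b -> in_span (z1 * b).
Proof.
by move=> [? [? [? [? [? [? ->]]]]]]; rewrite z1_lincomb //; do 6!eexists; reflexivity.
Qed.

Lemma in_span_z2 b : in_span b -> in_span (z2 * b).
Proof.
by move=> [? [? [? [? [? [? ->]]]]]]; rewrite z2_lincomb //; do 6!eexists; reflexivity.
Qed.

Lemma in_span_w1 b : in_span b -> in_span (w1 * b).
Proof.
move=> [? [? [? [? [? [? ->]]]]]]; rewrite lincomb_swap z1_lincomb; last exact: normal_rel_swap.
by rewrite lincomb_swap; do 6!eexists; reflexivity.
Qed.

Lemma in_span_w2 b : in_span b -> in_span (w2 * b).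
Proof.
move=> [? [? [? [? [? [? ->]]]]]]; rewrite lincomb_swap z2_lincomb; last exact: normal_rel_swap.
by rewrite lincomb_swap; do 6!eexists; reflexivity.
Qed.

Hypothesis gen : forall b, in_span b.

(** The elements x with s (x y) = s x * s y for all y form a subring containing the image of R. It
    contains z1 and z2, because their multiplication tables hold equally with z and w exchanged, and
    w1, w2 likewise. *)
Lemma swap_multiplicative (s : B -> B) :
  (forall a0 a1 a2 a3 a4 a5,
     s (lc a0 a1 a2 a3 a4 a5) = lc a0 a3 a4 a1 a2 (- a5)) ->
  forall x y, s (x * y) = s x * s y.
Proof.
move=> sE.
have sE' a0 a1 a2 a3 a4 a5 : s (lc a0 a1 a2 a3 a4 a5) =
    lincomb w1 w2 z1 z2 a0 a1 a2 a3 a4 a5.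
  by rewrite sE lincomb_swap; congr lincomb; rewrite opprK.
have nr' := normal_rel_swap nr.
have sD x y : s (x + y) = s x + s y.
  have [a0 [a1 [a2 [a3 [a4 [a5 ->]]]]]] := gen x.
  have [d0 [d1 [d2 [d3 [d4 [d5 ->]]]]]] := gen y.
  rewrite [lc _ _ _ _ _ _ + _](_ : _ =
    lc (a0 + d0) (a1 + d1) (a2 + d2) (a3 + d3) (a4 + d4) (a5 + d5)).
    by rewrite !sE' /lincomb; ring.
  by rewrite /lincomb; ring.
have sZ a y : s (f a * y) = f a * s y.
  have [d0 [d1 [d2 [d3 [d4 [d5 ->]]]]]] := gen y.
  rewrite [f a * _](_ : _ = lc (a * d0) (a * d1) (a * d2) (a * d3) (a * d4) (a * d5)).
    by rewrite !sE' /lincomb; ring.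
  by rewrite /lincomb; ring.
pose mult x := forall y, s (x * y) = s x * s y.
have sz1 : s z1 = w1.
  by transitivity (s (lc 0 1 0 0 0 0)); [congr s|rewrite sE]; rewrite /lincomb; ring.
have sz2 : s z2 = w2.
  by transitivity (s (lc 0 0 1 0 0 0)); [congr s|rewrite sE]; rewrite /lincomb; ring.
have sw1 : s w1 = z1.
  by transitivity (s (lc 0 0 0 1 0 0)); [congr s|rewrite sE]; rewrite /lincomb; ring.
have sw2 : s w2 = z2.
  by transitivity (s (lc 0 0 0 0 1 0)); [congr s|rewrite sE]; rewrite /lincomb; ring.
have sf a : s (f a) = f a.
  by transitivity (s (lc a 0 0 0 0 0)); [congr s|rewrite sE]; rewrite /lincomb; ring.
have mz1 : mult z1.
  move=> y; have [a0 [a1 [a2 [a3 [a4 [a5 ->]]]]]] := gen y.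
  by rewrite sz1 z1_lincomb // !sE' z1_lincomb.
have mz2 : mult z2.
  move=> y; have [a0 [a1 [a2 [a3 [a4 [a5 ->]]]]]] := gen y.
  by rewrite sz2 z2_lincomb // !sE' z2_lincomb.
have sE2 a0 a1 a2 a3 a4 a5 : s (lincomb w1 w2 z1 z2 a0 a1 a2 a3 a4 a5) =
    lc a0 a1 a2 a3 a4 a5.
  by rewrite lincomb_swap sE opprK.
have gen' b : exists a0 a1 a2 a3 a4 a5, b = lincomb w1 w2 z1 z2 a0 a1 a2 a3 a4 a5.
  have [a0 [a1 [a2 [a3 [a4 [a5 ->]]]]]] := gen b.
  by rewrite lincomb_swap; do 6!eexists; reflexivity.
have mw1 : mult w1.
  move=> y; have [a0 [a1 [a2 [a3 [a4 [a5 ->]]]]]] := gen' y.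
  by rewrite sw1 z1_lincomb // !sE2 z1_lincomb.
have mw2 : mult w2.
  move=> y; have [a0 [a1 [a2 [a3 [a4 [a5 ->]]]]]] := gen' y.
  by rewrite sw2 z2_lincomb // !sE2 z2_lincomb.
have multD x x' : mult x -> mult x' -> mult (x + x').
  by move=> mx mx' y; rewrite mulrDl !sD mx mx' mulrDl.
have multM x x' : mult x -> mult x' -> mult (x * x').
  by move=> mx mx' y; rewrite -mulrA mx mx' mx mulrA.
have multf a : mult (f a) by move=> y; rewrite sZ sf.
move=> x; have [a0 [a1 [a2 [a3 [a4 [a5 ->]]]]]] := gen x.
have -> : lc a0 a1 a2 a3 a4 a5 = f a0 + f a1 * z1 + f a2 * z2 + f a3 * w1 + f a4 * w2
    + f a5 * (z1 * w2 + f (- 1) * (z2 * w1)) by rewrite /lincomb; ring.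
have mt a t : mult t -> mult (f a * t) by apply: multM.
exact: (multD _ _ (multD _ _ (multD _ _ (multD _ _ (multD _ _ (multf _) (mt _ _ mz1)) (mt _ _ mz2)) (mt _ _ mw1)) (mt _ _ mw2)) (mt _ _ (multD _ _ (multM _ _ mz1 mw2) (mt _ _ (multM _ _ mz2 mw1))))).
Qed.

End Spanned.

(* The constant terms of a deformation of the quadrics are forced by associativity. *)
Lemma constants_determined (z1 z2 w1 w2 : B) (d1 d2 d3 d4 d5 d6 d7 d8 d9 : R) :
  (forall a0 a1 a2 a3 a4, f a0 + f a1 * z1 + f a2 * z2 + f a3 * w1 + f a4 * w2 = 0 ->
    [/\ a0 = 0, a1 = 0, a2 = 0, a3 = 0 & a4 = 0]) ->
  z1 * z1 = f c1 * w1 + f c0 * w2 + f d1 ->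
  z1 * z2 = - f c2 * w1 - f c1 * w2 + f d2 ->
  z2 * z2 = f c3 * w1 + f c2 * w2 + f d3 ->
  z1 * w1 = f d4 -> z1 * w2 + z2 * w1 = 2%:R * f d5 -> z2 * w2 = f d6 ->
  w1 * w1 = f c1 * z1 + f c0 * z2 + f d7 ->
  w1 * w2 = - f c2 * z1 - f c1 * z2 + f d8 ->
  w2 * w2 = f c3 * z1 + f c2 * z2 + f d9 ->
  [/\ [/\ d1 = 0, d2 = 0 & d3 = 0],
      [/\ d4 = c1 ^+ 2 - c0 * c2, d5 = h * (c0 * c3 - c1 * c2) &
          d6 = c2 ^+ 2 - c1 * c3] & [/\ d7 = 0, d8 = 0 & d9 = 0]].
Proof.
move=> ind q1 q2 q3 s1 s2 s3 p1 p2 p3.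
(* Expanding (z1 z2) z1 = (z1 z1) z2 leaves only a constant and the terms d2 z1 - d1 z2. The next
   three equations are the analogues with z2, and for w. *)
have [_ d2z d1z _ _] : [/\ - (c2 * d4) - 2%:R * c1 * d5 - c0 * d6 = 0, d2 = 0, - d1 = 0,
    0 = 0 :> R & 0 = 0 :> R].
  apply: ind; transitivity ((z1 * z2) * z1 - (z1 * z1) * z2); last by ring.
  rewrite q1 q2.
  transitivity (- f c2 * (z1 * w1) - f c1 * (z1 * w2 + z2 * w1) - f c0 * (z2 * w2)
    + f d2 * z1 - f d1 * z2); last by ring.
  by rewrite s1 s2 s3; ring.
have [_ d3z _ _ _] : [/\ - (c2 * 2%:R * d5) - c1 * d6 - c3 * d4 = 0, - d3 = 0, d2 = 0,
    0 = 0 :> R & 0 = 0 :> R].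
  apply: ind; transitivity ((z1 * z2) * z2 - (z2 * z2) * z1); last by ring.
  rewrite q2 q3.
  transitivity (- f c2 * (z1 * w2 + z2 * w1) - f c1 * (z2 * w2) - f c3 * (z1 * w1)
    + f c2 * (z1 * w2) - f c2 * (z1 * w2)
    + f d2 * z2 - f d3 * z1); last by ring.
  by rewrite s1 s2 s3; ring.
have [_ _ _ d8z d7z] : [/\ - (c2 * d4) - 2%:R * c1 * d5 - c0 * d6 = 0, 0 = 0 :> R,
    0 = 0 :> R, d8 = 0 & - d7 = 0].
  apply: ind; transitivity ((w1 * w2) * w1 - (w1 * w1) * w2); last by ring.
  rewrite p1 p2.
  transitivity (- f c2 * (z1 * w1) - f c1 * (z1 * w2 + z2 * w1) - f c0 * (z2 * w2)
    + f d8 * w1 - f d7 * w2); last by ring.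
  by rewrite s1 s2 s3; ring.
have [_ _ _ d9z _] : [/\ - (c2 * 2%:R * d5) - c1 * d6 - c3 * d4 = 0, 0 = 0 :> R,
    0 = 0 :> R, - d9 = 0 & d8 = 0].
  apply: ind; transitivity ((w1 * w2) * w2 - (w2 * w2) * w1); last by ring.
  rewrite p2 p3.
  transitivity (- f c2 * (z1 * w2 + z2 * w1) - f c1 * (z2 * w2) - f c3 * (z1 * w1)
    + f d8 * w2 - f d9 * w1); last by ring.
  by rewrite s1 s2 s3; ring.
have neg0 (a : R) : - a = 0 -> a = 0 by move=> /(congr1 -%R); rewrite opprK oppr0.
move/neg0: d1z => d1z; move/neg0: d3z => d3z.
move/neg0: d7z => d7z; move/neg0: d9z => d9z.
rewrite d1z d3z d7z d9z d2z d8z !rmorph0 !addr0 in q1 q2 q3 p1 p2 p3 *.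
split=> //.
(* The mixed constants come from z1 (z1 w1) = (z1 z1) w1: reducing the right side twice gives (c1^2
   - c0 c2) z1. Likewise z1 (z1 w2 + z2 w1) yields d5 and z2 (z2 w2) yields d6. *)
have [_ e4 _ _ _] : [/\ 0 = 0 :> R, d4 - (c1 ^+ 2 - c0 * c2) = 0, 0 = 0 :> R,
    0 = 0 :> R & 0 = 0 :> R].
  apply: ind; transitivity (z1 * f d4 - f c1 * (f c1 * z1 + f c0 * z2)
    - f c0 * (- f c2 * z1 - f c1 * z2)); first by ring.
  rewrite -p1 -p2 -s1.
  transitivity ((z1 * z1 - (f c1 * w1 + f c0 * w2)) * w1); first by ring.
  by rewrite q1; ring.
have [_ e5 _ _ _] : [/\ 0 = 0 :> R, 2%:R * d5 - (c0 * c3 - c1 * c2) = 0, 0 = 0 :> R,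
    0 = 0 :> R & 0 = 0 :> R].
  apply: ind; transitivity (z1 * (2%:R * f d5) - f c0 * (f c3 * z1 + f c2 * z2)
    + f c2 * (f c1 * z1 + f c0 * z2)); first by ring.
  rewrite -p1 -p3 -s2.
  transitivity (z1 * z1 * w2 + z1 * z2 * w1 - f c0 * (w2 * w2) + f c2 * (w1 * w1)).
    by ring.
  by rewrite q1 q2; ring.
have [_ _ e6 _ _] : [/\ 0 = 0 :> R, 0 = 0 :> R, d6 - (c2 ^+ 2 - c1 * c3) = 0,
    0 = 0 :> R & 0 = 0 :> R].
  apply: ind; transitivity (z2 * f d6 - f c2 * (f c3 * z1 + f c2 * z2)
    - f c3 * (- f c2 * z1 - f c1 * z2)); first by ring.
  rewrite -p3 -p2 -s3.
  transitivity ((z2 * z2 - (f c3 * w1 + f c2 * w2)) * w2); first by ring.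
  by rewrite q3; ring.
split; [exact: subr0_eq|..|exact: subr0_eq].
by rewrite -(subr0_eq e5) mulrA [h * _]mulrC hK mul1r.
Qed.

End NormalRelations.

(** * Reduction to the normal form *)

Section NormalVectors.
Variables (R B : comPzRingType) (f : {rmorphism R -> B}) (h : R).
Hypothesis hK : 2%:R * h = 1.
Variable c : 'I_4 -> R.
Local Notation c0 := (c ord0).
Local Notation c1 := (c (inord 1)).
Local Notation c2 := (c (inord 2)).
Local Notation c3 := (c (inord 3)).

Let fhK : 2%:R * f h = 1.
Proof. by rewrite -(rmorph_nat f) -rmorphM hK rmorph1. Qed.

Lemma S2mixed_entries (z w : 'cV[B]_2) (g : B) : [/\ S2mixed g z w 0 0 = z ord0 0 * w ord0 0,
  S2mixed g z w 1 0 = g * (z ord0 0 * w ord_max 0 + z ord_max 0 * w ord0 0) &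
  S2mixed g z w 2%:R 0 = z ord_max 0 * w ord_max 0].
Proof. by split; rewrite mxE. Qed.

Lemma normal_relP (z w : 'cV[B]_2) :
  [/\ S2 z = Ctilde (f \o c) *m w, S2mixed (f h) z w = map_mx f (Dtilde h c) &
      S2 w = Ctilde (f \o c) *m z] <->
  normal_rel f c0 c1 c2 c3 (z ord0 0) (z ord_max 0) (w ord0 0) (w ord_max 0).
Proof.
have [z0 z1 z2] := S2_entries z; have [w0 w1 w2] := S2_entries w.
have [m0 m1 m2] := S2mixed_entries z w (f h).
have [u0 u1 u2] := Ctilde_mul (f \o c) z; have [v0 v1 v2] := Ctilde_mul (f \o c) w.
split=> [[E1 E2 E3]|[[q1 q2 q3] [s1 s2 s3] [p1 p2 p3]]].
  split; split.
  - by rewrite -z0 E1 v0.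
  - by rewrite -z1 E1 v1.
  - by rewrite -z2 E1 v2.
  - by rewrite -m0 E2 !mxE.
  - rewrite -[LHS]mul1r -fhK -mulrA -m1 E2 !mxE /= rmorphM mulrA fhK mul1r.
    by [].
  - by rewrite -m2 E2 !mxE.
  - by rewrite -w0 E3 u0.
  - by rewrite -w1 E3 u1.
  - by rewrite -w2 E3 u2.
split; apply: col3P.
- by rewrite z0 z1 z2 v0 v1 v2 q1 q2 q3.
- by rewrite m0 m1 m2 s1 s2 s3 !mxE /= rmorphM.
- by rewrite w0 w1 w2 u0 u1 u2 p1 p2 p3.
Qed.

Lemma normal_vectors (z w : 'cV[B]_2) (dz dm dw : 'cV[R]_3) :
  (forall a0 a1 a2 a3 a4, f a0 + f a1 * z ord0 0 + f a2 * z ord_max 0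
     + f a3 * w ord0 0 + f a4 * w ord_max 0 = 0 ->
    [/\ a0 = 0, a1 = 0, a2 = 0, a3 = 0 & a4 = 0]) ->
  S2 z = Ctilde (f \o c) *m w + map_mx f dz ->
  S2mixed (f h) z w = map_mx f dm ->
  S2 w = Ctilde (f \o c) *m z + map_mx f dw ->
  [/\ dz = 0, dm = Dtilde h c & dw = 0].
Proof.
move=> ind E1 E2 E3.
have [z0 z1 z2] := S2_entries z; have [w0 w1 w2] := S2_entries w.
have [m0 m1 m2] := S2mixed_entries z w (f h).
have [u0 u1 u2] := Ctilde_mul (f \o c) z; have [v0 v1 v2] := Ctilde_mul (f \o c) w.
have mE (d : 'cV[R]_3) i : map_mx f d i 0 = f (d i 0) by rewrite mxE.
have [|||||||||[x0 x1 x2] [y0 y1 y2] [t0 t1 t2]] := @constants_determined R B f h hK c0 c1 c2 c3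
  (z ord0 0) (z ord_max 0) (w ord0 0) (w ord_max 0) (dz 0 0) (dz 1 0) (dz 2%:R 0)
  (dm 0 0) (dm 1 0) (dm 2%:R 0) (dw 0 0) (dw 1 0) (dw 2%:R 0) ind.
- by rewrite -z0 E1 [LHS]mxE v0 mE.
- by rewrite -z1 E1 [LHS]mxE v1 mE.
- by rewrite -z2 E1 [LHS]mxE v2 mE.
- by rewrite -m0 E2 mE.
- by rewrite -mE -E2 m1 mulrA fhK mul1r.
- by rewrite -m2 E2 mE.
- by rewrite -w0 E3 [LHS]mxE u0 mE.
- by rewrite -w1 E3 [LHS]mxE u1 mE.
- by rewrite -w2 E3 [LHS]mxE u2 mE.
split; apply: col3P; split; rewrite ?x0 ?x1 ?x2 ?y0 ?y1 ?y2 ?t0 ?t1 ?t2 !mxE //.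
Qed.
End NormalVectors.

Lemma col_mx_ind (T : Type) (P : T -> Prop) m n (u : 'cV[T]_m) (v : 'cV[T]_n) :
  (forall l, P (u l 0)) -> (forall l, P (v l 0)) -> forall i, P (col_mx u v i 0).
Proof. by move=> Pu Pv i; rewrite mxE; case: fintype.split. Qed.

Section NormalForm.
Variables (R : comNzRingType) (h : R).
Hypothesis hK : 2%:R * h = 1.
Variables (e c : 'I_4 -> R).
Local Notation e0 := (e ord0).
Local Notation e1 := (e (inord 1)).
Local Notation e2 := (e (inord 2)).
Local Notation e3 := (e (inord 3)).
(* u = (a, b) and v = (a', b') satisfy u u = v, u v = 0, v v = u in the product with
   structure constants e; the inverse of (u, v) is (p q; p' q'). *)
Variables (a b a' b' p q p' q' : R).
Hypothesis uu1 : a ^+ 2 * e1 - 2%:R * a * b * e2 + b ^+ 2 * e3 = a'.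
Hypothesis uu2 : a ^+ 2 * e0 - 2%:R * a * b * e1 + b ^+ 2 * e2 = b'.
Hypothesis uv1 : a * a' * e1 - (a * b' + b * a') * e2 + b * b' * e3 = 0.
Hypothesis uv2 : a * a' * e0 - (a * b' + b * a') * e1 + b * b' * e2 = 0.
Hypothesis vv1 : a' ^+ 2 * e1 - 2%:R * a' * b' * e2 + b' ^+ 2 * e3 = a.
Hypothesis vv2 : a' ^+ 2 * e0 - 2%:R * a' * b' * e1 + b' ^+ 2 * e2 = b.
Hypothesis inv11 : p * a + q * a' = 1.
Hypothesis inv12 : p * b + q * b' = 0.
Hypothesis inv21 : p' * a + q' * a' = 0.
Hypothesis inv22 : p' * b + q' * b' = 1.
Hypothesis inw11 : a * p + b * p' = 1.
Hypothesis inw12 : a * q + b * q' = 0.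
Hypothesis inw21 : a' * p + b' * p' = 0.
Hypothesis inw22 : a' * q + b' * q' = 1.

(** The symmetric square of (a b; a' b') is inverted by the symmetric square of the inverse matrix.
    It solves for the structure constants and, later, for the constant terms. *)
Lemma quad_inverse (E0 E1 E2 Q0 Q1 Q2 : R) :
  a ^+ 2 * E0 + 2%:R * a * b * E1 + b ^+ 2 * E2 = Q0 ->
  a * a' * E0 + (a * b' + b * a') * E1 + b * b' * E2 = Q1 ->
  a' ^+ 2 * E0 + 2%:R * a' * b' * E1 + b' ^+ 2 * E2 = Q2 ->
  [/\ E0 = p ^+ 2 * Q0 + 2%:R * p * q * Q1 + q ^+ 2 * Q2,
      E1 = p * p' * Q0 + (p * q' + q * p') * Q1 + q * q' * Q2 &
      E2 = p' ^+ 2 * Q0 + 2%:R * p' * q' * Q1 + q' ^+ 2 * Q2].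
Proof.
move=> <- <- <-; split.
- transitivity ((p * a + q * a') ^+ 2 * E0 + 2%:R * (p * a + q * a') * (p * b + q * b') * E1
    + (p * b + q * b') ^+ 2 * E2); last by ring.
  by rewrite inv11 inv12; ring.
- transitivity ((p * a + q * a') * (p' * a + q' * a') * E0
    + ((p * a + q * a') * (p' * b + q' * b') + (p * b + q * b') * (p' * a + q' * a')) * E1
    + (p * b + q * b') * (p' * b + q' * b') * E2); last by ring.
  by rewrite inv11 inv12 inv21 inv22; ring.
- transitivity ((p' * a + q' * a') ^+ 2 * E0
    + 2%:R * (p' * a + q' * a') * (p' * b + q' * b') * E1
    + (p' * b + q' * b') ^+ 2 * E2); last by ring.
  by rewrite inv21 inv22; ring.
Qed.

Lemma structure_constants : [/\
  e1 = p ^+ 2 * a' + q ^+ 2 * a /\ e0 = p ^+ 2 * b' + q ^+ 2 * b,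
  - e2 = p * p' * a' + q * q' * a /\ - e1 = p * p' * b' + q * q' * b &
  e3 = p' ^+ 2 * a' + q' ^+ 2 * a /\ e2 = p' ^+ 2 * b' + q' ^+ 2 * b].
Proof.
have [||| A0 A1 A2] := @quad_inverse e1 (- e2) e3 a' 0 a.
- by rewrite -uu1; ring.
- by rewrite -uv1; ring.
- by rewrite -vv1; ring.
have [||| E0 E1 E2] := @quad_inverse e0 (- e1) e2 b' 0 b.
- by rewrite -uu2; ring.
- by rewrite -uv2; ring.
- by rewrite -vv2; ring.
by split; split; [rewrite A0|rewrite E0|rewrite A1|rewrite E1|rewrite A2|rewrite E2]; ring.
Qed.

(** With z = p z' + q w' and w = p' z' + q' w', the normal relations turn S2 z into p^2 C w' + q^2 C
    z', to be matched with e1 C z + e0 C w. The identities compare the coefficients of C z' and C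
    w', in this and in the other two blocks. *)
Lemma structure_inverse : [/\
  e1 * p + e0 * p' = q ^+ 2 /\ e1 * q + e0 * q' = p ^+ 2,
  - e2 * p - e1 * p' = q * q' /\ - e2 * q - e1 * q' = p * p' &
  e3 * p + e2 * p' = q' ^+ 2 /\ e3 * q + e2 * q' = p' ^+ 2].
Proof.
have [[A0 E0] [A1 E1] [A2 E2]] := structure_constants.
have lin (s t : R) : (s * a' + t * a) * p + (s * b' + t * b) * p' = t /\
    (s * a' + t * a) * q + (s * b' + t * b) * q' = s.
  split.
    transitivity (s * (a' * p + b' * p') + t * (a * p + b * p')); first by ring.
    by rewrite inw11 inw21; ring.
  transitivity (s * (a' * q + b' * q') + t * (a * q + b * q')); first by ring.
  by rewrite inw12 inw22; ring.
by split; [rewrite A0 E0|rewrite -!mulNr A1 E1|rewrite A2 E2]; exact: lin.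
Qed.

Section Ring.
Variables (S : comPzRingType) (g : {rmorphism R -> S}).

Let ghK : 2%:R * g h = 1.
Proof. by rewrite -(rmorph_nat g) -rmorphM hK rmorph1. Qed.

Let C := Ctilde (g \o c).

Lemma change_forward (z w : 'cV[S]_2) (dz dm dw : 'cV[R]_3) :
  S2 z = g e1 *: (C *m z) + g e0 *: (C *m w) + map_mx g dz ->
  S2mixed (g h) z w = - (g e2 *: (C *m z)) - g e1 *: (C *m w) + map_mx g dm ->
  S2 w = g e3 *: (C *m z) + g e2 *: (C *m w) + map_mx g dw ->
  let z' := g a *: z + g b *: w in let w' := g a' *: z + g b' *: w in
  [/\ S2 z' = C *m w' + map_mx g (a ^+ 2 *: dz + (2%:R * a * b) *: dm + b ^+ 2 *: dw),
      S2mixed (g h) z' w' =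
        map_mx g ((a * a') *: dz + (a * b' + b * a') *: dm + (b * b') *: dw) &
      S2 w' = C *m z' + map_mx g (a' ^+ 2 *: dz + (2%:R * a' * b') *: dm + b' ^+ 2 *: dw)].
Proof.
move=> E1 E2 E3 z' w'; rewrite /z' /w'.
rewrite !(S2_comb ghK) (S2mixed_comb ghK) E1 E2 E3 !mulmxDr -!scalemxAr.
move: (C *m z) (C *m w) => u t.
split; apply/matrixP => i j; rewrite !mxE ?rmorphD ?rmorphM.
- rewrite -uu1 -[in g b' * _]uu2; ring.
- transitivity (g (a * a' * e1 - (a * b' + b * a') * e2 + b * b' * e3) * u i j
    + g (a * a' * e0 - (a * b' + b * a') * e1 + b * b' * e2) * t i j
    + (g a * g a' * g (dz i j) + g (a * b' + b * a') * g (dm i j) + g b * g b' * g (dw i j))).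
    by ring.
  by rewrite uv1 uv2; ring.
- rewrite -[in g a * _]vv1 -[in g b * _]vv2; ring.
Qed.

(** Expresses the old relations by the new ones as polynomial identities, before anything vanishes.
    The multiples of D are the inverse symmetric square applied to the constants (0, D, 0). *)
Lemma change_backward (z' w' : 'cV[S]_2) (D : 'cV[R]_3) :
  let z := g p *: z' + g q *: w' in let w := g p' *: z' + g q' *: w' in
  let RZ := S2 z' - C *m w' in let RM := S2mixed (g h) z' w' - map_mx g D in
  let RW := S2 w' - C *m z' in
  [/\ S2 z - (g e1 *: (C *m z) + g e0 *: (C *m w)) - map_mx g ((2%:R * p * q) *: D) =
        g (p ^+ 2) *: RZ + g (2%:R * p * q) *: RM + g (q ^+ 2) *: RW,
      S2mixed (g h) z w - (- g e2 *: (C *m z) - g e1 *: (C *m w))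
          - map_mx g ((p * q' + q * p') *: D) =
        g (p * p') *: RZ + g (p * q' + q * p') *: RM + g (q * q') *: RW &
      S2 w - (g e3 *: (C *m z) + g e2 *: (C *m w)) - map_mx g ((2%:R * p' * q') *: D) =
        g (p' ^+ 2) *: RZ + g (2%:R * p' * q') *: RM + g (q' ^+ 2) *: RW].
Proof.
move=> z w RZ RM RW; rewrite /z /w /RZ /RM /RW.
rewrite !(S2_comb ghK) (S2mixed_comb ghK) !mulmxDr -!scalemxAr.
move: (C *m z') (C *m w') => u t.
have [[A0 E0] [A1 E1] [A2 E2]] := structure_inverse.
split; apply/matrixP => i j; rewrite !mxE; apply/subr0_eq.
- transitivity ((g (q ^+ 2) - g (e1 * p + e0 * p')) * u i j
    + (g (p ^+ 2) - g (e1 * q + e0 * q')) * t i j); first by ring.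
  by rewrite A0 E0; ring.
- transitivity ((g (q * q') - g (- e2 * p - e1 * p')) * u i j
    + (g (p * p') - g (- e2 * q - e1 * q')) * t i j); first by ring.
  by rewrite A1 E1; ring.
- transitivity ((g (q' ^+ 2) - g (e3 * p + e2 * p')) * u i j
    + (g (p' ^+ 2) - g (e3 * q + e2 * q')) * t i j); first by ring.
  by rewrite A2 E2; ring.
Qed.
End Ring.

Section Presented.
Variables (B : comNzRingType) (f : {rmorphism R -> B}) (x : 'I_(2 + 2) -> B).
Variable d : 'cV[R]_(3 + 3 + 3).
Hypothesis pres : presented_by h (linear_Phi_mx e c) d f x.
Hypothesis ind : forall (r : R) (m n : 'I_2 -> R),
  f r + \sum_i f (m i) * x (lshift 2 i) + \sum_i f (n i) * x (rshift 2 i) = 0 ->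
  [/\ r = 0, forall i, m i = 0 & forall i, n i = 0].

Let z : 'cV[B]_2 := \col_i x (lshift 2 i).
Let w : 'cV[B]_2 := \col_i x (rshift 2 i).

Definition changed (i : 'I_(2 + 2)) : B :=
  match fintype.split i with
  | inl l => f a * x (lshift 2 l) + f b * x (rshift 2 l)
  | inr l => f a' * x (lshift 2 l) + f b' * x (rshift 2 l)
  end.

Let z' : 'cV[B]_2 := f a *: z + f b *: w.
Let w' : 'cV[B]_2 := f a' *: z + f b' *: w.

Lemma changed_col : \col_i changed i = col_mx z' w'.
Proof.
apply/matrixP => i j; rewrite !mxE /changed; case: (fintype.split i) => l;
by rewrite !mxE.
Qed.

Lemma changed_ind (a0 a1 a2 a3 a4 : R) : f a0 + f a1 * z' ord0 0 + f a2 * z' ord_max 0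
     + f a3 * w' ord0 0 + f a4 * w' ord_max 0 = 0 ->
  [/\ a0 = 0, a1 = 0, a2 = 0, a3 = 0 & a4 = 0].
Proof.
move=> E.
pose m (i : 'I_2) := if i == ord0 then a1 * a + a3 * a' else a2 * a + a4 * a'.
pose n (i : 'I_2) := if i == ord0 then a1 * b + a3 * b' else a2 * b + a4 * b'.
have l2 : lift ord0 (ord0 : 'I_1) = ord_max :> 'I_2 by exact: val_inj.
have [|-> mE nE] := @ind a0 m n.
  rewrite -[RHS]E !big_ord_recl !big_ord0 l2 /m /n /= /z' /w' /z /w !mxE; ring.
have cancel s t : s * a + t * a' = 0 -> s * b + t * b' = 0 -> s = 0 /\ t = 0.
  move=> h1 h2; split.
    transitivity ((s * a + t * a') * p + (s * b + t * b') * p'); last by rewrite h1 h2; ring.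
    transitivity (s * (a * p + b * p') + t * (a' * p + b' * p')); last by ring.
    by rewrite inw11 inw21; ring.
  transitivity ((s * a + t * a') * q + (s * b + t * b') * q'); last by rewrite h1 h2; ring.
  transitivity (s * (a * q + b * q') + t * (a' * q + b' * q')); last by ring.
  by rewrite inw12 inw22; ring.
have [-> ->] := cancel _ _ (mE ord0) (nE ord0).
by have [-> ->] := cancel _ _ (mE ord_max) (nE ord_max).
Qed.

Let dz := usubmx (usubmx d).
Let dm := dsubmx (usubmx d).
Let dw := dsubmx d.

Lemma map_d_blocks (S : comPzRingType) (g : {rmorphism R -> S}) :
  [/\ usubmx (usubmx (map_mx g d)) = map_mx g dz,
      dsubmx (usubmx (map_mx g d)) = map_mx g dm & dsubmx (map_mx g d) = map_mx g dw].
Proof. by rewrite -!map_usubmx -!map_dsubmx. Qed.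

Lemma changed_relations : [/\
  S2 z' = Ctilde (f \o c) *m w', S2mixed (f h) z' w' = map_mx f (Dtilde h c) &
  S2 w' = Ctilde (f \o c) *m z'] /\
  [/\ dz = (2%:R * p * q) *: Dtilde h c, dm = (p * q' + q * p') *: Dtilde h c &
      dw = (2%:R * p' * q') *: Dtilde h c].
Proof.
have := presented_relations pres.
rewrite map_linear_Phi linear_relations_blocks.
have [-> -> ->] := map_d_blocks f.
have -> : usubmx (\col_i x i) = z by apply/matrixP => i j; rewrite !mxE.
have -> : dsubmx (\col_i x i) = w by apply/matrixP => i j; rewrite !mxE.
rewrite -[RHS]vsubmxK -[X in _ = col_mx X _]vsubmxK !linear0.
move=> /eq_col_mx [/eq_col_mx [/subr0_eq E1 /subr0_eq E2] /subr0_eq E3].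
have eqD (u v t : 'cV[B]_3) : u - v = t -> u = v + t by move=> <-; rewrite addrC subrK.
move/eqD: E1 => E1; move/eqD: E2 => E2; move/eqD: E3 => E3.
rewrite scaleNr in E2.
have [F1 F2 F3] := change_forward E1 E2 E3.
have [D1 D2 D3] := normal_vectors hK changed_ind F1 F2 F3.
split.
  by rewrite D1 map_mx0 addr0 in F1; rewrite D3 map_mx0 addr0 in F3; rewrite D2 in F2.
(* In the new coordinates the constants are (0, [Dtilde], 0); transforming back determines the
   original ones, in the form that [change_backward] requires. *)
have dE i := @quad_inverse (dz i 0) (dm i 0) (dw i 0) 0 (Dtilde h c i 0) 0.
have dE' i : [/\ dz i 0 = 2%:R * p * q * Dtilde h c i 0,
   dm i 0 = (p * q' + q * p') * Dtilde h c i 0 & dw i 0 = 2%:R * p' * q' * Dtilde h c i 0].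
  have [|||-> -> ->] := dE i.
  - by have := congr1 (fun M : 'cV_3 => M i 0) D1; rewrite !mxE.
  - by rewrite -D2 !mxE.
  - by have := congr1 (fun M : 'cV_3 => M i 0) D3; rewrite !mxE.
  by split; ring.
split; apply/matrixP => i j; rewrite ord1 [RHS]mxE; by have [] := dE' i.
Qed.

Lemma presented_normal_form :
  presented_by h (normal_Phi_mx c) (normal_const h c) f changed.
Proof.
have [[F1 F2 F3] [d1 d2 d3]] := changed_relations.
pose G : 'M[R]_(2 + 2) := block_mx p%:M q%:M p'%:M q'%:M.
pose G' : 'M[R]_(2 + 2) := block_mx a%:M b%:M a'%:M b'%:M.
have xE i : (\col_i x i) i 0 = x i by rewrite mxE.
have xzw : \col_i x i = col_mx z w.
  by rewrite -[LHS]vsubmxK; congr col_mx; apply/matrixP => i j; rewrite !mxE.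
have blockE (s t s' t' : R) (S : comPzRingType) (g : {rmorphism R -> S}) (u v : 'cV[S]_2) :
    map_mx g (block_mx s%:M t%:M s'%:M t'%:M) *m col_mx u v =
    col_mx (g s *: u + g t *: v) (g s' *: u + g t' *: v).
  by rewrite map_block_mx !map_scalar_mx mul_block_col !mul_scalar_mx.
have GG' : G *m G' = 1%:M.
  rewrite mulmx_block -!scalar_mxM -!raddfD inv11 inv12 inv21 inv22.
  by rewrite !raddf0 -scalar_mx_block.
have Ez : f p *: z' + f q *: w' = z.
  rewrite /z' /w' !scalerDr !scalerA addrACA -!scalerDl -!rmorphM -!rmorphD.
  by rewrite inv11 inv12 rmorph1 rmorph0 scale1r scale0r addr0.
have Ew : f p' *: z' + f q' *: w' = w.
  rewrite /z' /w' !scalerDr !scalerA addrACA -!scalerDl -!rmorphM -!rmorphD.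
  by rewrite inv21 inv22 rmorph1 rmorph0 scale1r scale0r add0r.
have xG i : x i = \sum_j f (G i j) * changed j.
  transitivity ((map_mx f G *m \col_i changed i) i 0); last first.
    by rewrite mxE; apply: eq_bigr => j _; rewrite [map_mx _ _ _ _]mxE [X in _ * X]mxE.
  by rewrite changed_col blockE Ez Ew -xzw mxE.
have x'G i : changed i = \sum_j f (G' i j) * x j.
  transitivity ((map_mx f G' *m \col_i x i) i 0); last first.
    by rewrite mxE; apply: eq_bigr => j _; rewrite [map_mx _ _ _ _]mxE [X in _ * X]mxE.
  by rewrite xzw blockE -changed_col mxE.
have rel' : quadrics (f h) (\col_i changed i) - map_mx f (normal_Phi_mx c) *m
    (\col_i changed i) - map_mx f (normal_const h c) = 0.
  rewrite map_normal_Phi map_normal_const normal_relations_blocks changed_col.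
  rewrite col_mxKu col_mxKd F1 F2 F3 map_Dtilde !subrr.
  by rewrite !col_mx0.
apply: (presented_change pres GG' xG x'G rel') => i.
pose g : {rmorphism R -> mpoly.mpoly 4 R} := @mpoly.mpolyC 4 R.
pose Z := usubmx (coordinates R : 'cV_(2 + 2)).
pose W := dsubmx (coordinates R : 'cV_(2 + 2)).
pose r := relations h (normal_Phi_mx c) (normal_const h c).
have rE : r = col_mx (col_mx (S2 Z - Ctilde (g \o c) *m W)
    (S2mixed (g h) Z W - map_mx g (Dtilde h c))) (S2 W - Ctilde (g \o c) *m Z).
  rewrite /r /relations (map_normal_Phi g) (map_normal_const g).
  by rewrite normal_relations_blocks map_Dtilde.
rewrite -/r -/g -[coordinates R]vsubmxK -/Z -/W (blockE _ _ _ _ _ g).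
rewrite (map_linear_Phi g) linear_relations_blocks col_mxKu col_mxKd.
have [-> -> ->] := map_d_blocks g.
have [H1 H2 H3] := change_backward g Z W (Dtilde h c).
rewrite -d1 in H1; rewrite -d2 in H2; rewrite -d3 in H3.
have idZ l : ideal_of r ((S2 Z - Ctilde (g \o c) *m W) l 0).
  have := ideal_of_gen r (lshift 3 (lshift 3 l)).
  by rewrite {2}rE !col_mxEu.
have idM l : ideal_of r ((S2mixed (g h) Z W - map_mx g (Dtilde h c)) l 0).
  have := ideal_of_gen r (lshift 3 (rshift 3 l)).
  by rewrite {2}rE col_mxEu col_mxEd.
have idW l : ideal_of r ((S2 W - Ctilde (g \o c) *m Z) l 0).
  have := ideal_of_gen r (rshift (3 + 3) l).
  by rewrite {2}rE col_mxEd.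
have comb (RZ RM RW : 'cV_3) s t u l : (forall l, ideal_of r (RZ l 0)) ->
    (forall l, ideal_of r (RM l 0)) -> (forall l, ideal_of r (RW l 0)) ->
    ideal_of r ((s *: RZ + t *: RM + u *: RW) l 0).
  move=> hZ hM hW; rewrite !mxE.
  by apply: ideal_of_add; [apply: ideal_of_add|]; exact: ideal_of_mul.
apply: (@col_mx_ind _ (ideal_of r)) => [|l].
  apply: (@col_mx_ind _ (ideal_of r)) => l.
    by move: (comb _ _ _ (g (p ^+ 2)) (g (2%:R * p * q)) (g (q ^+ 2)) l idZ idM idW); rewrite -H1.
  by move: (comb _ _ _ (g (p * p')) (g (p * q' + q * p')) (g (q * q')) l idZ idM idW); rewrite -H2.
by move: (comb _ _ _ (g (p' ^+ 2)) (g (2%:R * p' * q')) (g (q' ^+ 2)) l idZ idM idW); rewrite -H3.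
Qed.
End Presented.
End NormalForm.

(** * Direct images and modules *)

(** The span of 1, z, w, v contains 1 and is stable under multiplication by the four generators, so
    it contains all monomials. *)
Lemma presented_span (R B : comNzRingType) (f : {rmorphism R -> B}) (h : R) (c : 'I_4 -> R)
    (half : R) A d (x : 'I_(2 + 2) -> B) : 2%:R * h = 1 ->
  presented_by half A d f x ->
  normal_rel f (c ord0) (c (inord 1)) (c (inord 2)) (c (inord 3))
    (x (lshift 2 ord0)) (x (lshift 2 ord_max)) (x (rshift 2 ord0)) (x (rshift 2 ord_max)) ->
  forall b, in_span f (x (lshift 2 ord0)) (x (lshift 2 ord_max))
    (x (rshift 2 ord0)) (x (rshift 2 ord_max)) b.
Proof.
move=> hK [surj _] nr b; have [p <-] := surj b.
set T := in_span _ _ _ _ _.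
have T1 : T 1 by rewrite -(rmorph1 f); exact: in_span_const.
have TD := @in_span_add R B f (x (lshift 2 ord0)) (x (lshift 2 ord_max))
  (x (rshift 2 ord0)) (x (rshift 2 ord_max)).
have TZ := @in_span_scale R B f (x (lshift 2 ord0)) (x (lshift 2 ord_max))
  (x (rshift 2 ord0)) (x (rshift 2 ord_max)).
pose K y := forall b, T b -> T (y * b).
have Kx (i : 'I_(2 + 2)) : K (x i).
  case: (split_ordP i) => l ->.
    have [->|->] : l = ord0 \/ l = ord_max.
    - by case: l => [[|[|//]] ?]; [left|right]; exact: val_inj.
    - by move=> y; exact: (in_span_z1 hK nr).
    - by move=> y; exact: (in_span_z2 hK nr).
  have [->|->] : l = ord0 \/ l = ord_max.
  - by case: l => [[|[|//]] ?]; [left|right]; exact: val_inj.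
  - by move=> y; exact: (in_span_w1 hK nr).
  - by move=> y; exact: (in_span_w2 hK nr).
have K1 : K 1 by move=> y; rewrite mul1r.
have KM y y' : K y -> K y' -> K (y * y').
  by move=> Ky Ky' t Tt; rewrite -mulrA; apply: Ky; exact: Ky'.
have KX y n : K y -> K (y ^+ n).
  by move=> Ky; elim: n => [|n IH]; rewrite ?expr0 // exprS; exact: KM.
rewrite /mpoly.mmap; elim/big_ind: _ => [|y y'|m _]; last 1 first.
- apply: TZ; rewrite -[mpoly.mmap1 _ _]mulr1 /mpoly.mmap1.
  suff : K (\prod_(i < 4) x i ^+ mpoly.fun_of_multinom m i) by apply.
  by elim/big_ind: _ => // i _; apply: KX; exact: Kx.
- by rewrite -(rmorph0 f); exact: in_span_const.
- exact: TD.
Qed.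

Section Modules.
Variables (k : fieldType) (Y : space k).

Lemma msec_sep (M : modsheaf Y) (U : opens Y) (s t : msec M U) :
  (forall y, U y -> exists (V : opens Y) (h : V `<=` U),
     V y /\ mres h s = mres h t) -> s = t.
Proof.
move=> loc; pose I := {y | U y}.
pose F (i : I) : opens Y := projT1 (cid (loc _ (projT2 i))).
have FP (i : I) : exists h : F i `<=` U, F i (projT1 i) /\ mres h s = mres h t.
  exact: projT2 (cid (loc _ (projT2 i))).
have hF i : F i `<=` U by case: (FP i).
have cov : U `<=` \bigcup_i F i.
  by move=> y Uy; exists (exist _ y Uy) => //; case: (FP (exist _ y Uy)) => h [].
have [i j W hi hj|u [_ uu]] := msec_glue hF cov (m := fun i => mres (hF i) t).
  have hW : W `<=` U by move=> y /hi /hF.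
  by rewrite !(mres_comp _ _ hW).
rewrite -(uu t) // -(uu s) // => i; case: (FP i) => h [_].
by rewrite !(Prop_irrelevance h (hF i)).
Qed.

Lemma mres0 (M : modsheaf Y) (U V : opens Y) (h : V `<=` U) : mres h (0 : msec M U) = 0.
Proof. by rewrite -(scale0r 0) mresZ rmorph0 scale0r. Qed.

Variables (X : space k) (f : smorphism X Y).

Section PushHom.
Variables (M : modsheaf Y) (j : pushhom f M).

Lemma phom0 (U : opens Y) : j U 0 = 0.
Proof. by rewrite -(scale0r 0) phomZ rmorph0 mul0r. Qed.

Lemma phomN (U : opens Y) m : j U (- m) = - j U m.
Proof. by rewrite -scaleN1r phomZ rmorphN1 mulN1r. Qed.

Lemma phomB (U : opens Y) m n : j U (m - n) = j U m - j U n.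
Proof. by rewrite phomD phomN. Qed.

Lemma phom_sum (U : opens Y) n (F : 'I_n -> msec M U) : j U (\sum_i F i) = \sum_i j U (F i).
Proof. by apply: (big_morph (j U)); [exact: phomD|exact: phom0]. Qed.

Lemma phom_scal (U : opens Y) (a : k) m : j U (scal U a *: m) = scal (preim f U) a * j U m.
Proof. by rewrite phomZ pull_scal. Qed.
End PushHom.

Section Combination.
Variables (M : modsheaf Y) (j j' : pushhom f M) (a b : k).

Definition comb0 (U : opens Y) (m : msec M U) : sec (preim f U) :=
  scal _ a * j U m + scal _ b * j' U m.

Lemma comb0D (U : opens Y) (m n : msec M U) : comb0 (m + n) = comb0 m + comb0 n.
Proof. by rewrite /comb0 !phomD !mulrDr addrACA. Qed.

Lemma comb0Z (U : opens Y) (r : sec U) (m : msec M U) :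
  comb0 (r *: m) = pull f U r * comb0 m.
Proof. by rewrite /comb0 !phomZ mulrDr; congr (_ + _); rewrite mulrCA. Qed.

Lemma comb0_res (U V : opens Y) (h : V `<=` U) (m : msec M U) :
  comb0 (mres h m) = res (preim_sub (f := f) h) (comb0 m).
Proof. by rewrite /comb0 !phom_res rmorphD !rmorphM !res_scal. Qed.

Definition pushcomb : pushhom f M := Pushhom comb0D comb0Z comb0_res.

Lemma pushcombE (U : opens Y) (m : msec M U) :
  pushcomb U m = scal _ a * j U m + scal _ b * j' U m.
Proof. by []. Qed.
End Combination.

(** An alias, so that the module structure over [sec U] through [pull f U] can be attached to it. *)
Definition pf_sec (U : opens Y) : Type := sec (preim f U).
HB.instance Definition _ U := GRing.Zmodule.on (pf_sec U).

Section PfModule.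
Variable U : opens Y.
Definition pf_scale (a : sec U) (s : pf_sec U) : pf_sec U := pull f U a * (s : sec (preim f U)).
Lemma pf_scaleA a b v : pf_scale a (pf_scale b v) = pf_scale (a * b) v.
Proof. by rewrite /pf_scale rmorphM mulrA. Qed.
Lemma pf_scale1 : left_id 1 pf_scale.
Proof. by move=> v; rewrite /pf_scale rmorph1 mul1r. Qed.
Lemma pf_scaleDr : right_distributive pf_scale +%R.
Proof. by move=> a u v; rewrite /pf_scale mulrDr. Qed.
Lemma pf_scaleDl v : {morph pf_scale^~ v : a b / a + b}.
Proof. by move=> a b; rewrite /pf_scale rmorphD mulrDl. Qed.
HB.instance Definition _ := GRing.Zmodule_isLmodule.Build (sec U) (pf_sec U)
  pf_scaleA pf_scale1 pf_scaleDr pf_scaleDl.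
End PfModule.

Definition pf_res (U V : opens Y) (h : V `<=` U) (s : pf_sec U) : pf_sec V :=
  res (preim_sub (f := f) h) s.

Definition pushforward : modsheaf Y.
Proof.
refine (@Modsheaf k Y (fun U => pf_sec U : lmodType (sec U)) pf_res _ _ _ _ _).
- by move=> U V h m n; exact: rmorphD.
- move=> U V h a m; rewrite /pf_res [LHS]rmorphM; congr (_ * _).
  by rewrite -pull_res.
- by move=> U h m; exact: res_id.
- by move=> U V W hUV hVW hUW m; exact: res_comp.
- move=> I F U hF cov m comp.
  have covP : preim f U `<=` \bigcup_i preim f (F i) by move=> x /cov [i _ Fi]; exists i.
  have [|t [tP tu]] := sec_glue (fun i => preim_sub (f := f) (hF i)) covP (s := m).
    move=> i j W hi hj.
    have hFi : opensI (F i) (F j) `<=` F i by move=> x [].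
    have hFj : opensI (F i) (F j) `<=` F j by move=> x [].
    have hW : W `<=` preim f (opensI (F i) (F j)).
      by move=> x Wx; split; [exact: hi|exact: hj].
    have := congr1 (res hW) (comp i j _ hFi hFj).
    by rewrite /pf_res (res_comp _ _ hi) (res_comp _ _ hj).
  by exists t.
Defined.
End Modules.

(** * The decomposition of the direct image *)

Section Cover.
Variables (k : fieldType) (X Y : space k) (phi : smorphism X Y).
Variables (M L : modsheaf Y) (w : alternating M L).
Variables (jz jw : pushhom phi M) (jl : pushhom phi L) (Phi : quadhom M) (e : 'I_4 -> k).
Hypothesis splits : splits_by jz jw jl.
Hypothesis wedge : is_wedge2 w.
Hypothesis two0 : 2%:R != 0 :> k.
Local Notation e0 := (e ord0).
Local Notation e1 := (e (inord 1)).
Local Notation e2 := (e (inord 2)).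
Local Notation e3 := (e (inord 3)).
Variables a b a' b' : k.
Hypothesis det0 : a * b' - b * a' != 0.
Hypothesis uu1 : a ^+ 2 * e1 - 2%:R * a * b * e2 + b ^+ 2 * e3 = a'.
Hypothesis uu2 : a ^+ 2 * e0 - 2%:R * a * b * e1 + b ^+ 2 * e2 = b'.
Hypothesis uv1 : a * a' * e1 - (a * b' + b * a') * e2 + b * b' * e3 = 0.
Hypothesis uv2 : a * a' * e0 - (a * b' + b * a') * e1 + b * b' * e2 = 0.
Hypothesis vv1 : a' ^+ 2 * e1 - 2%:R * a' * b' * e2 + b' ^+ 2 * e3 = a.
Hypothesis vv2 : a' ^+ 2 * e0 - 2%:R * a' * b' * e1 + b' ^+ 2 * e2 = b.

Local Notation half := (2%:R^-1 : k).

Definition new_z : pushhom phi M := pushcomb jz jw a b.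
Definition new_w : pushhom phi M := pushcomb jz jw a' b'.

Lemma splits_zero (V : opens Y) r m n l :
  pull phi V r + jz V m + jw V n + jl V l = 0 -> [/\ r = 0, m = 0, n = 0 & l = 0].
Proof.
move=> E; have := bij_inj (splits V) (x1 := (r, m, n, l)) (x2 := (0, 0, 0, 0)).
by rewrite /= E rmorph0 !phom0 !addr0 => /(_ erefl) [-> -> -> ->].
Qed.

Lemma basis_zero (N : modsheaf Y) (U V : opens Y) (h : V `<=` U) n
    (m : 'I_n -> msec N U) (r : 'I_n -> sec V) : is_basis m ->
  \sum_i r i *: mres h (m i) = 0 -> forall i, r i = 0.
Proof.
move=> bm E i; have [s [_ su]] := bm V h 0.
have h1 : s = \row_l r l.
  by apply: su; rewrite -[LHS]E; apply: eq_bigr => l _; rewrite mxE.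
have h2 : s = 0.
  by apply: su; under eq_bigr do rewrite mxE scale0r; rewrite big1.
by have := congr1 (fun A : 'rV_n => A 0 i) (etrans (esym h1) h2); rewrite !mxE.
Qed.

(** The splitting supplies the independence of 1, z_i, w_i from which associativity forces the
    constants. *)
Lemma chart_ind (U V : opens Y) (h : V `<=` U) (m : 'I_2 -> msec M U) : is_basis m ->
  forall (r : sec V) (s t : 'I_2 -> sec V),
  pull phi V r + \sum_i pull phi V (s i) * jz V (mres h (m i))
    + \sum_i pull phi V (t i) * jw V (mres h (m i)) = 0 ->
  [/\ r = 0, forall i, s i = 0 & forall i, t i = 0].
Proof.
move=> bm r s t E.
have [|r0 s0 t0 _] := @splits_zero V r (\sum_i s i *: mres h (m i))
    (\sum_i t i *: mres h (m i)) 0.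
  rewrite phom0 addr0 -[RHS]E !phom_sum.
  by congr (_ + _ + _); apply: eq_bigr => i _; rewrite phomZ.
by split=> //; [exact: (basis_zero bm s0)|exact: (basis_zero bm t0)].
Qed.

Let det := a * b' - b * a'.
Let p := b' / det.
Let q := - b / det.
Let p' := - a' / det.
Let q' := a / det.

Let inverses : [/\ [/\ p * a + q * a' = 1, p * b + q * b' = 0,
    p' * a + q' * a' = 0 & p' * b + q' * b' = 1] &
  [/\ a * p + b * p' = 1, a * q + b * q' = 0, a' * p + b' * p' = 0 &
    a' * q + b' * q' = 1]].
Proof.
by rewrite /p /q /p' /q' /det; split; split; field.
Qed.

Lemma halfK (V : opens Y) : 2%:R * scal V half = 1.
Proof. by rewrite -(rmorph_nat (scal V)) -rmorphM mulfV // rmorph1. Qed.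

Lemma chart_normal_form (U : opens Y) (m : 'I_2 -> msec M U) (c : 'I_4 -> sec U) d :
  defined_on jz jw Phi e m c d ->
  normal_form_on (zw (fun i => new_z U (m i)) (fun i => new_w U (m i))) c.
Proof.
move=> [bm _ _ pres] V h nzR nzB; have := pres V h nzR nzB.
have -> : map_mx (res h) (linear_Phi_mx (fun i => scal U (e i)) c) =
    linear_Phi_mx (fun i => scal V (e i)) (res h \o c).
  by rewrite map_linear_Phi; congr linear_Phi_mx; apply/funext => i /=; rewrite res_scal.
move=> pV; pose s := scal V.
have S (x y : k) : x = y -> s x = s y by move=> ->.
have [[i11 i12 i21 i22] [j11 j12 j21 j22]] := inverses.
have ind (r : sec V) (s1 t1 : 'I_2 -> sec V) :
   pull phi V r + \sum_i pull phi V (s1 i) *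
      res (preim_sub (f := phi) h) (zw (fun i => jz U (m i)) (fun i => jw U (m i)) (lshift 2 i))
    + \sum_i pull phi V (t1 i) * res (preim_sub (f := phi) h)
       (zw (fun i => jz U (m i)) (fun i => jw U (m i)) (rshift 2 i)) = 0 ->
  [/\ r = 0, forall i, s1 i = 0 & forall i, t1 i = 0].
  move=> E; apply: (chart_ind (h := h) bm); rewrite -[RHS]E; congr (_ + _ + _);
    apply: eq_bigr => i _; rewrite /zw.
    by rewrite (unsplitK (inl i)) phom_res.
  by rewrite (unsplitK (inr i)) phom_res.
have A1 : s a ^+ 2 * s e1 - 2%:R * s a * s b * s e2 + s b ^+ 2 * s e3 = s a'.
  by rewrite -(S _ _ uu1); ring.
have A2 : s a ^+ 2 * s e0 - 2%:R * s a * s b * s e1 + s b ^+ 2 * s e2 = s b'.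
  by rewrite -(S _ _ uu2); ring.
have A3 : s a * s a' * s e1 - (s a * s b' + s b * s a') * s e2 + s b * s b' * s e3 = 0.
  by rewrite -(rmorph0 s) -(S _ _ uv1); ring.
have A4 : s a * s a' * s e0 - (s a * s b' + s b * s a') * s e1 + s b * s b' * s e2 = 0.
  by rewrite -(rmorph0 s) -(S _ _ uv2); ring.
have A5 : s a' ^+ 2 * s e1 - 2%:R * s a' * s b' * s e2 + s b' ^+ 2 * s e3 = s a.
  by rewrite -(S _ _ vv1); ring.
have A6 : s a' ^+ 2 * s e0 - 2%:R * s a' * s b' * s e1 + s b' ^+ 2 * s e2 = s b.
  by rewrite -(S _ _ vv2); ring.
have I1 (x y z t u : k) : x * y + z * t = u -> s x * s y + s z * s t = s u.
  by move=> <-; ring.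
have I11 : s p * s a + s q * s a' = 1 by rewrite (I1 _ _ _ _ _ i11) rmorph1.
have I12 : s p * s b + s q * s b' = 0 by rewrite (I1 _ _ _ _ _ i12) rmorph0.
have I21 : s p' * s a + s q' * s a' = 0 by rewrite (I1 _ _ _ _ _ i21) rmorph0.
have I22 : s p' * s b + s q' * s b' = 1 by rewrite (I1 _ _ _ _ _ i22) rmorph1.
have J11 : s a * s p + s b * s p' = 1 by rewrite (I1 _ _ _ _ _ j11) rmorph1.
have J12 : s a * s q + s b * s q' = 0 by rewrite (I1 _ _ _ _ _ j12) rmorph0.
have J21 : s a' * s p + s b' * s p' = 0 by rewrite (I1 _ _ _ _ _ j21) rmorph0.
have J22 : s a' * s q + s b' * s q' = 1 by rewrite (I1 _ _ _ _ _ j22) rmorph1.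
have := @presented_normal_form (nzRing nzR) (scal V half) (halfK V)
  (fun i => scal V (e i)) (res h \o c) (s a) (s b) (s a') (s b') (s p) (s q) (s p') (s q')
  A1 A2 A3 A4 A5 A6 I11 I12 I21 I22 J11 J12 J21 J22 (nzRing nzB) (pull phi V) _ _ pV ind.
rewrite map_normal_Phi map_normal_const res_scal.
congr (presented_by _ _ _ _ _); apply/funext => i.
rewrite /changed /zw; case: (fintype.split (i : 'I_(2 + 2))) => l; rewrite rmorphD !rmorphM !res_scal.
  by rewrite !pull_scal (unsplitK (inl l)) (unsplitK (inr l)).
by rewrite !pull_scal (unsplitK (inl l)) (unsplitK (inr l)).
Qed.

Lemma chart_relations (U V : opens Y) (h : V `<=` U) (m : 'I_2 -> msec M U)
    (c : 'I_4 -> sec U) d : defined_on jz jw Phi e m c d ->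
  let z i := new_z V (mres h (m i)) in let w' i := new_w V (mres h (m i)) in
  normal_rel (pull phi V) (res h (c ord0)) (res h (c (inord 1))) (res h (c (inord 2)))
    (res h (c (inord 3))) (z ord0) (z ord_max) (w' ord0) (w' ord_max) /\
  forall s, in_span (pull phi V) (z ord0) (z ord_max) (w' ord0) (w' ord_max) s.
Proof.
(* The presentation speaks only of nonzero rings; over a zero ring every equation holds. *)
move=> def z w'; have [nzB|/negPn/eqP B0] := boolP (1 != 0 :> sec (preim phi V)); last first.
  have triv (x y : sec (preim phi V)) : x = y.
    by rewrite -[x]mul1r -[y]mul1r B0 !mul0r.
  split; first by split; split; exact: triv.
  by move=> s; exists 0, 0, 0, 0, 0, 0; exact: triv.
have nzR : 1 != 0 :> sec V.
  by apply: contra_neq nzB => R0; rewrite -(rmorph1 (pull phi V)) R0 rmorph0.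
have pres := chart_normal_form def h nzR nzB.
set x := fun i => _ in pres.
have xl (i : 'I_2) : x (lshift 2 i) = z i.
  by rewrite /x /zw (unsplitK (inl i)) -phom_res.
have xr (i : 'I_2) : x (rshift 2 i) = w' i.
  by rewrite /x /zw (unsplitK (inr i)) -phom_res.
have nr : normal_rel (pull phi V) (res h (c ord0)) (res h (c (inord 1)))
    (res h (c (inord 2))) (res h (c (inord 3))) (z ord0) (z ord_max) (w' ord0) (w' ord_max).
  have := presented_relations pres.
  rewrite (map_normal_Phi (res h)) (map_normal_const (res h)) res_scal.
  rewrite (map_normal_Phi (pull phi V)) (map_normal_const (pull phi V)).
  rewrite normal_relations_blocks.
  have -> : usubmx (\col_(i < 2 + 2) x i) = \col_i z i.
    by apply/matrixP => i j; rewrite !mxE xl.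
  have -> : dsubmx (\col_(i < 2 + 2) x i) = \col_i w' i.
    by apply/matrixP => i j; rewrite !mxE xr.
  rewrite -[RHS]vsubmxK -[X in _ = col_mx X _]vsubmxK !linear0.
  move=> /eq_col_mx [/eq_col_mx [/subr0_eq E1 /subr0_eq E2] /subr0_eq E3].
  have := (normal_relP (pull phi V) (halfK V) (res h \o c) (\col_i z i) (\col_i w' i)).1.
  rewrite !mxE; apply; split=> //.
  by rewrite map_Dtilde.
split=> //; rewrite -!xl -!xr in nr *.
exact: (@presented_span (nzRing nzR) (nzRing nzB) (pull phi V) (scal V half) (res h \o c)
  (scal V half) _ _ x (halfK V) pres nr).
Qed.

Definition wedge_alt0 (U : opens Y) (m n : msec M U) : msec (pushforward phi) U :=
  new_z U m * new_w U n - new_z U n * new_w U m.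

Definition wedge_alt : alternating M (pushforward phi).
Proof.
refine (@Alternating k Y M (pushforward phi) wedge_alt0 _ _ _ _ _ _).
- by move=> U m m' n; rewrite /wedge_alt0 !phomD; ring.
- move=> U r m n; rewrite /wedge_alt0 !phomZ.
  by rewrite -!mulrA [new_z U n * (_ * _)]mulrCA -mulrBr.
- by move=> U m n n'; rewrite /wedge_alt0 !phomD; ring.
- move=> U r m n; rewrite /wedge_alt0 !phomZ.
  by rewrite -!mulrA [new_z U m * (_ * _)]mulrCA -mulrBr.
- by move=> U m; rewrite /wedge_alt0 subrr.
- move=> U V h m n; rewrite /wedge_alt0 !phom_res -!rmorphM -rmorphB; exact: erefl.
Defined.

Lemma wedge_pushhom : exists lam : pushhom phi L, forall (U : opens Y) m n,
  lam U (w U m n) = new_z U m * new_w U n - new_z U n * new_w U m.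
Proof.
have [[v vP] _] := wedge wedge_alt.
have vD (U : opens Y) m n : (v U (m + n) : sec (preim phi U)) = v U m + v U n.
  exact: linearD.
have vZ (U : opens Y) r m : (v U (r *: m) : sec (preim phi U)) = pull phi U r * v U m.
  exact: (linearZZ (v U) r m).
have vr (U V : opens Y) (h : V `<=` U) m :
    (v V (mres h m) : sec (preim phi V)) = res (preim_sub (f := phi) h) (v U m).
  exact: (hom_res v h m).
by exists (Pushhom vD vZ vr) => U m n; rewrite /= vP.
Qed.

Variable lam : pushhom phi L.
Hypothesis lamP : forall (U : opens Y) m n,
  lam U (w U m n) = new_z U m * new_w U n - new_z U n * new_w U m.

Lemma splits_uniq (V : opens Y) r m n l r' m' n' l' :
  pull phi V r + jz V m + jw V n + jl V l = pull phi V r' + jz V m' + jw V n' + jl V l' ->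
  [/\ r = r', m = m', n = n' & l = l'].
Proof.
move=> E; have := bij_inj (splits V) (x1 := (r, m, n, l)) (x2 := (r', m', n', l')).
by move=> /(_ E) [-> -> -> ->].
Qed.

Lemma splits_exists (V : opens Y) s :
  exists r m n l, s = pull phi V r + jz V m + jw V n + jl V l.
Proof.
have [g _ gK] := splits V; have := gK s.
by case: (g s) => [[[r m] n] l] /= <-; exists r, m, n, l.
Qed.

Lemma chart_dec (U V : opens Y) (h : V `<=` U) (m : 'I_2 -> msec M U)
    (c : 'I_4 -> sec U) d : defined_on jz jw Phi e m c d ->
  forall s : sec (preim phi V), exists r m1 n1 t, s = pull phi V r + new_z V m1 + new_w V n1
    + lam V (t *: w V (mres h (m ord0)) (mres h (m ord_max))).
Proof.
move=> def s; have [_ /(_ s) [a0 [a1 [a2 [a3 [a4 [a5 ->]]]]]]] := chart_relations h def.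
exists a0, (a1 *: mres h (m ord0) + a2 *: mres h (m ord_max)),
  (a3 *: mres h (m ord0) + a4 *: mres h (m ord_max)), a5.
by rewrite /lincomb phomZ lamP !phomD !phomZ; ring.
Qed.

Lemma zeta_eta_splits (V : opens Y) r m n :
  pull phi V r + new_z V m + new_w V n = pull phi V r +
    jz V (scal V a *: m + scal V a' *: n) + jw V (scal V b *: m + scal V b' *: n).
Proof. by rewrite /new_z /new_w !pushcombE !phomD !phom_scal; ring. Qed.

Lemma zeta_eta_zero (V : opens Y) r m n :
  pull phi V r + new_z V m + new_w V n = 0 -> [/\ r = 0, m = 0 & n = 0].
Proof.
rewrite zeta_eta_splits => E.
have [|r0 E1 E2 _] := @splits_zero V r (scal V a *: m + scal V a' *: n)
  (scal V b *: m + scal V b' *: n) 0.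
  by rewrite phom0 addr0.
have [[i11 i12 i21 i22] [j11 j12 j21 j22]] := inverses.
have cancel (x y x' y' : k) : x * a + y * b = x' -> x * a' + y * b' = y' ->
    scal V x' *: m + scal V y' *: n = 0.
  move=> <- <-; transitivity (scal V x *: (scal V a *: m + scal V a' *: n)
      + scal V y *: (scal V b *: m + scal V b' *: n)); last first.
    by rewrite E1 E2 !scaler0 addr0.
  by rewrite !scalerDr !scalerA !rmorphD !rmorphM !scalerDl addrACA.
split=> //.
  rewrite -[LHS]scale1r -(rmorph1 (scal V)) -[LHS]addr0 -[X in _ + X](scale0r n).
  rewrite -(rmorph0 (scal V)); apply: (cancel p p'); first by rewrite -j11; ring.
  by rewrite -j21; ring.
rewrite -[LHS]scale1r -(rmorph1 (scal V)) -[LHS]add0r -[X in X + _](scale0r m).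
rewrite -(rmorph0 (scal V)); apply: (cancel q q'); first by rewrite -j12; ring.
by rewrite -j22; ring.
Qed.

(** Consider the endomorphism of L given by [lam] followed by the projection along the given
    splitting. It is surjective by [chart_dec], and L is cyclic on V, so it is injective; this is
    carried out with explicit multipliers. *)
Lemma chart_dec_zero (U V : opens Y) (h : V `<=` U) (m : 'I_2 -> msec M U)
    (c : 'I_4 -> sec U) d : defined_on jz jw Phi e m c d ->
  forall r m1 n1 l, pull phi V r + new_z V m1 + new_w V n1 + lam V l = 0 ->
  [/\ r = 0, m1 = 0, n1 = 0 & l = 0].
Proof.
move=> def r m1 n1 l E; set w0 := w V (mres h (m ord0)) (mres h (m ord_max)).
have [r0 [m0 [n0 [t0 lw0]]]] := splits_exists (lam V w0).
(* The L-component t0 of [lam V w0] generates L: decompose [jl V l'] by [chart_dec] and compare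
   L-components. *)
have cyc l' : exists t, l' = t *: t0.
  have [r2 [m2 [n2 [t E2]]]] := chart_dec h def (jl V l').
  exists t; move: E2; rewrite -/w0 phomZ lw0 zeta_eta_splits.
  rewrite -[jl V l']add0r -[X in X + jl V l' = _]addr0 -[X in X + _ + jl V l' = _]addr0.
  rewrite -{1}(rmorph0 (pull phi V)) -{1}(phom0 jz V) -{1}(phom0 jw V).
  rewrite (_ : _ + _ + pull phi V t * _ = pull phi V (r2 + t * r0) +
    jz V (scal V a *: m2 + scal V a' *: n2 + t *: m0) +
    jw V (scal V b *: m2 + scal V b' *: n2 + t *: n0) + jl V (t *: t0)).
    by move=> /splits_uniq [_ _ _ ->].
  by rewrite !(phomD, phomZ); ring.
have [s ws] := cyc w0; have [r1 [m2 [n2 [u' lt0]]]] := splits_exists (lam V t0).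
have [u eu] := cyc u'; rewrite {}eu in lt0.
(* Here w0 = s t0, and u t0 is the L-component of [lam V t0]. So s inverts u on the module, and u t
   t0 = 0 will give t t0 = 0. *)
have sut : t0 = (s * u) *: t0.
  have := lw0; rewrite {1}ws phomZ lt0.
  rewrite (_ : pull phi V s * _ = pull phi V (s * r1) + jz V (s *: m2) + jw V (s *: n2)
    + jl V ((s * u) *: t0)); last by rewrite !phomZ; ring.
  by move=> /splits_uniq [_ _ _ ->].
have [t lt] := cyc l.
have tu0 : (t * u) *: t0 = 0.
  move: E; rewrite zeta_eta_splits lt phomZ lt0.
  rewrite (_ : _ + _ + pull phi V t * _ = pull phi V (r + t * r1) +
    jz V (scal V a *: m1 + scal V a' *: n1 + t *: m2) +
    jw V (scal V b *: m1 + scal V b' *: n1 + t *: n2) + jl V ((t * u) *: t0)).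
    by move=> /splits_zero [_ _ _ ->].
  by rewrite !(phomD, phomZ); ring.
have l0 : l = 0.
  by rewrite lt sut scalerA mulrCA -scalerA tu0 scaler0.
by move: E; rewrite l0 phom0 addr0 => /zeta_eta_zero [-> -> ->].
Qed.

Hypothesis charts : forall y : Y, exists (U : opens Y) (m : 'I_2 -> msec M U)
     (c : 'I_4 -> sec U) (d : 'cV[sec U]_(3 + 3 + 3)), U y /\ defined_on jz jw Phi e m c d.

Lemma dec_zero (V : opens Y) r m n l : pull phi V r + new_z V m + new_w V n + lam V l = 0 ->
  [/\ r = 0, m = 0, n = 0 & l = 0].
Proof.
move=> E.
have loc y : V y -> exists (V' : opens Y) (h : V' `<=` V), [/\ V' y,
    res h r = 0, mres h m = 0, mres h n = 0 & mres h l = 0].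
  move=> Vy; have [U [mU [c [d [Uy def]]]]] := charts y.
  have hU : opensI V U `<=` U by move=> z [].
  have hV : opensI V U `<=` V by move=> z [].
  have [|r0 m0 n0 l0] := chart_dec_zero hU def (r := res hV r) (m1 := mres hV m)
      (n1 := mres hV n) (l := mres hV l).
    rewrite !phom_res (pull_res hV (preim_sub (f := phi) hV)) -!rmorphD E.
    exact: rmorph0.
  by exists (opensI V U), hV.
split.
- by apply: sec_sep => y /loc [V' [h [Vy E1 E2 E3 E4]]]; exists V', h; rewrite rmorph0.
- by apply: msec_sep => y /loc [V' [h [Vy E1 E2 E3 E4]]]; exists V', h; rewrite mres0.
- by apply: msec_sep => y /loc [V' [h [Vy E1 E2 E3 E4]]]; exists V', h; rewrite mres0.
- by apply: msec_sep => y /loc [V' [h [Vy E1 E2 E3 E4]]]; exists V', h; rewrite mres0.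
Qed.

Lemma dec_uniq (V : opens Y) r m n l r' m' n' l' :
  pull phi V r + new_z V m + new_w V n + lam V l =
  pull phi V r' + new_z V m' + new_w V n' + lam V l' ->
  [/\ r = r', m = m', n = n' & l = l'].
Proof.
move=> E; have [|E1 E2 E3 E4] := @dec_zero V (r - r') (m - m') (n - n') (l - l').
  rewrite rmorphB !phomB -[RHS](subrr (pull phi V r + new_z V m + new_w V n + lam V l)).
  by rewrite {2}E; ring.
by split; exact: subr0_eq.
Qed.

(** Local decompositions exist by the charts, agree on overlaps by [dec_uniq], and are glued
    component by component. *)
Lemma dec_exists (V : opens Y) (s : sec (preim phi V)) :
  exists r m n l, s = pull phi V r + new_z V m + new_w V n + lam V l.
Proof.
have loc y : V y -> exists (V' : opens Y) (h : V' `<=` V), V' y /\ exists r m n l,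
    res (preim_sub (f := phi) h) s = pull phi V' r + new_z V' m + new_w V' n + lam V' l.
  move=> Vy; have [U [mU [c [d [Uy def]]]]] := charts y.
  have hU : opensI V U `<=` U by move=> z [].
  have hV : opensI V U `<=` V by move=> z [].
  exists (opensI V U), hV; split=> //.
  have [r [m [n [t E]]]] := chart_dec hU def (res (preim_sub (f := phi) hV) s).
  by exists r, m, n; eexists; exact: E.
pose I := {y | V y}.
pose F (i : I) : opens Y := projT1 (cid (loc _ (projT2 i))).
have FP (i : I) : exists h : F i `<=` V, F i (projT1 i) /\ exists r m n l,
    res (preim_sub (f := phi) h) s = pull phi _ r + new_z _ m + new_w _ n + lam _ l.
  exact: projT2 (cid (loc _ (projT2 i))).
have hF i : F i `<=` V by case: (FP i).
have cov : V `<=` \bigcup_i F i.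
  by move=> y Vy; exists (exist _ y Vy) => //; case: (FP (exist _ y Vy)) => h [].
pose T i := (sec (F i) * msec M (F i) * msec M (F i) * msec L (F i))%type.
have TP i : exists t : T i, res (preim_sub (f := phi) (hF i)) s =
    pull phi _ t.1.1.1 + new_z _ t.1.1.2 + new_w _ t.1.2 + lam _ t.2.
  case: (FP i) => h [_ [r [m [n [l E]]]]]; exists (r, m, n, l); rewrite /= -E.
  exact: res_irr.
pose t i : T i := projT1 (cid (TP i)).
have tP i : res (preim_sub (f := phi) (hF i)) s =
    pull phi _ (t i).1.1.1 + new_z _ (t i).1.1.2 + new_w _ (t i).1.2 + lam _ (t i).2.
  exact: projT2 (cid (TP i)).
have comp i j (W : opens Y) (hi : W `<=` F i) (hj : W `<=` F j) :
    [/\ res hi (t i).1.1.1 = res hj (t j).1.1.1, mres hi (t i).1.1.2 = mres hj (t j).1.1.2,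
        mres hi (t i).1.2 = mres hj (t j).1.2 & mres hi (t i).2 = mres hj (t j).2].
  apply: dec_uniq; rewrite !phom_res.
  rewrite (pull_res hi (preim_sub (f := phi) hi)) (pull_res hj (preim_sub (f := phi) hj)).
  rewrite -!rmorphD -!tP.
  have hW : preim phi W `<=` preim phi V by move=> x /hi /hF.
  by rewrite !(res_comp _ _ hW).
have [i j W hi hj|r [rP _]] := sec_glue hF cov (s := fun i => (t i).1.1.1).
  by case: (comp i j W hi hj).
have [i j W hi hj|m [mP _]] := msec_glue hF cov (m := fun i => (t i).1.1.2).
  by case: (comp i j W hi hj).
have [i j W hi hj|n [nP _]] := msec_glue hF cov (m := fun i => (t i).1.2).
  by case: (comp i j W hi hj).
have [i j W hi hj|l [lP _]] := msec_glue hF cov (m := fun i => (t i).2).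
  by case: (comp i j W hi hj).
exists r, m, n, l; apply: sec_sep => x Vx.
have [i _ Fi] := cov _ Vx.
exists (preim phi (F i)), (preim_sub (f := phi) (hF i)); split=> //.
rewrite tP -(rP i) -(mP i) -(nP i) -(lP i) !phom_res.
by rewrite (pull_res (hF i) (preim_sub (f := phi) (hF i))) -!rmorphD.
Qed.
End Cover.

(** * The action of S_3 *)

Lemma mcomp_pullE (k : fieldType) (X Y Z : space k) (g : smorphism Y Z) (f : smorphism X Y)
    (V : opens Z) (s : sec V) (W : opens X) (h : W `<=` preim (mcomp g f) V)
    (h' : W `<=` preim f (preim g V)) :
  res h (pull (mcomp g f) V s) = res h' (pull f (preim g V) (pull g V s)).
Proof. by rewrite /= /mcomp_pull /= (res_comp _ _ h'). Qed.

(** n elements that span a free module of rank n form a basis: the transition matrices satisfy T S =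
    1, and over a commutative ring a one-sided inverse of a square matrix is two-sided. *)
Lemma spanning_free (R B : comPzRingType) (f : {rmorphism R -> B}) n (b t : 'I_n -> B) :
  (forall s, exists! a : 'rV[R]_n, s = \sum_i f (a 0 i) * b i) ->
  (forall s, exists a : 'rV[R]_n, s = \sum_i f (a 0 i) * t i) ->
  forall r : 'rV[R]_n, \sum_i f (r 0 i) * t i = 0 -> r = 0.
Proof.
move=> bb tt r r0.
have uniq (a a' : 'rV[R]_n) : \sum_i f (a 0 i) * b i = \sum_i f (a' 0 i) * b i -> a = a'.
  move=> E; have [x [_ xu]] := bb (\sum_i f (a 0 i) * b i).
  by rewrite -(xu a) // -(xu a').
have Sex i : exists a : 'rV[R]_n, t i = \sum_j f (a 0 j) * b j.
  by have [a [ea _]] := bb (t i); exists a.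
pose S : 'M[R]_n := \matrix_(i, j) projT1 (cid (Sex i)) 0 j.
have SE i : t i = \sum_j f (S i j) * b j.
  by rewrite [LHS](projT2 (cid (Sex i))); apply: eq_bigr => j _; rewrite mxE.
have Tex i : exists a : 'rV[R]_n, b i = \sum_j f (a 0 j) * t j by exact: tt.
pose T : 'M[R]_n := \matrix_(i, j) projT1 (cid (Tex i)) 0 j.
have TE i : b i = \sum_j f (T i j) * t j.
  by rewrite [LHS](projT2 (cid (Tex i))); apply: eq_bigr => j _; rewrite mxE.
have mulE (a : 'rV[R]_n) : \sum_i f (a 0 i) * t i = \sum_j f ((a *m S) 0 j) * b j.
  under eq_bigr do rewrite SE mulr_sumr.
  rewrite exchange_big; apply: eq_bigr => j _.
  rewrite mxE rmorph_sum mulr_suml; apply: eq_bigr => i _.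
  by rewrite rmorphM mulrA.
have TS : T *m S = 1%:M.
  apply/row_matrixP => i; apply: uniq; rewrite row_mul -mulE.
  transitivity (b i).
    by rewrite [RHS]TE; apply: eq_bigr => j _; rewrite [row i T 0 j]mxE.
  rewrite (bigD1 i) //= !mxE eqxx rmorph1 mul1r big1 ?addr0 // => j ji.
  by rewrite !mxE eq_sym (negbTE ji) rmorph0 mul0r.
have rS : r *m S = 0.
  apply: uniq; rewrite -mulE r0 big1 // => i _.
  by rewrite mxE rmorph0 mul0r.
by rewrite -[r]mulmx1 -(mulmx1C TS) mulmxA rS mul0mx.
Qed.

Section Action.
Variables (k : fieldType) (X Y : space k) (phi : smorphism X Y).
Variables (M L : modsheaf Y) (w : alternating M L).
Variables (zeta eta : pushhom phi M) (lam : pushhom phi L).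
Hypothesis two0 : 2%:R != 0 :> k.
Hypothesis three0 : 3%:R != 0 :> k.
Hypothesis lamP : forall (U : opens Y) m n,
  lam U (w U m n) = zeta U m * eta U n - zeta U n * eta U m.
Hypothesis dec_uniq : forall (V : opens Y) r m n l r' m' n' l',
  pull phi V r + zeta V m + eta V n + lam V l =
  pull phi V r' + zeta V m' + eta V n' + lam V l' ->
  [/\ r = r', m = m', n = n' & l = l'].
Hypothesis dec_exists : forall (V : opens Y) (s : sec (preim phi V)),
  exists r m n l, s = pull phi V r + zeta V m + eta V n + lam V l.

Definition normal_chart (U : opens Y) (m : 'I_2 -> msec M U) (c : 'I_4 -> sec U) : Prop :=
  forall (V : opens Y) (h : V `<=` U),
  let z i := zeta V (mres h (m i)) in let w' i := eta V (mres h (m i)) in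
  normal_rel (pull phi V) (res h (c ord0)) (res h (c (inord 1))) (res h (c (inord 2)))
    (res h (c (inord 3))) (z ord0) (z ord_max) (w' ord0) (w' ord_max) /\
  forall s, in_span (pull phi V) (z ord0) (z ord_max) (w' ord0) (w' ord_max) s.

Hypothesis charts : forall y : Y, exists (U : opens Y) (m : 'I_2 -> msec M U)
  (c : 'I_4 -> sec U), [/\ U y, is_basis m & normal_chart m c].

Section Swap.
Variable o : k.
Hypothesis o3 : o ^+ 3 = 1.

Let sw_ex (V : opens Y) (b : sec (preim phi V)) :
  exists t : sec V * msec M V * msec M V * msec L V,
  b = pull phi V t.1.1.1 + zeta V t.1.1.2 + eta V t.1.2 + lam V t.2.
Proof. by have [r [m [n [l E]]]] := dec_exists b; exists (r, m, n, l). Qed.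

(** The candidate for a transposition: z(m) goes to o w(m), w(n) to o^2 z(n), and [lam] changes
    sign. The three cube roots of unity o give the three transpositions. *)
Definition sw (V : opens Y) (b : sec (preim phi V)) : sec (preim phi V) :=
  let t := projT1 (cid (sw_ex b)) in
  pull phi V t.1.1.1 + zeta V (scal V (o ^+ 2) *: t.1.2) + eta V (scal V o *: t.1.1.2)
  + lam V (- t.2).

Lemma swE (V : opens Y) r m n l :
  sw (pull phi V r + zeta V m + eta V n + lam V l) =
  pull phi V r + zeta V (scal V (o ^+ 2) *: n) + eta V (scal V o *: m) + lam V (- l).
Proof.
rewrite /sw; case: cid => [[[[r' m'] n'] l']] /= E.
by have [-> -> -> ->] := dec_uniq E.
Qed.

Lemma sw_zmod V : zmod_morphism (@sw V).
Proof.
move=> b b'; have [r [m [n [l ->]]]] := dec_exists b.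
have [r' [m' [n' [l' ->]]]] := dec_exists b'.
transitivity (sw (pull phi V (r - r') + zeta V (m - m') + eta V (n - n') + lam V (l - l'))).
  by congr sw; rewrite rmorphB !phomB; ring.
by rewrite !swE rmorphB !scalerBr !phomN !phomB; ring.
Qed.

Lemma sw_res (U V : opens Y) (h : V `<=` U) (s : sec (preim phi U)) :
  sw (res (preim_sub (f := phi) h) s) = res (preim_sub (f := phi) h) (sw s).
Proof.
have [r [m [n [l ->]]]] := dec_exists s.
transitivity (sw (pull phi V (res h r) + zeta V (mres h m) + eta V (mres h n)
    + lam V (mres h l))).
  by congr sw; rewrite !phom_res (pull_res h (preim_sub (f := phi) h)) -!rmorphD.
rewrite !swE !rmorphD -!phom_res -(pull_res h) !mresZ !res_scal.
by rewrite -(scaleN1r l) mresZ rmorphN1 scaleN1r.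
Qed.

Lemma sw_pull (V : opens Y) r : sw (pull phi V r) = pull phi V r.
Proof.
transitivity (sw (pull phi V r + zeta V 0 + eta V 0 + lam V 0)).
  by congr sw; rewrite !phom0 !addr0.
by rewrite swE oppr0 !scaler0 !phom0 !addr0.
Qed.

Lemma normal_rel_scale (R B : comPzRingType) (f : {rmorphism R -> B}) c0 c1 c2 c3 z1 z2 w1 w2
    (s t : B) : s * s = t -> t * t = s -> s * t = 1 ->
  normal_rel f c0 c1 c2 c3 z1 z2 w1 w2 ->
  normal_rel f c0 c1 c2 c3 (s * z1) (s * z2) (t * w1) (t * w2).
Proof.
move=> ss tt st [[q1 q2 q3] [s1 s2 s3] [p1 p2 p3]].
split; split.
- by rewrite mulrACA ss q1; ring.
- by rewrite mulrACA ss q2; ring.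
- by rewrite mulrACA ss q3; ring.
- by rewrite mulrACA st s1 mul1r.
- by rewrite mulrACA [s * z2 * _]mulrACA st -s2; ring.
- by rewrite mulrACA st s3 mul1r.
- by rewrite mulrACA tt p1; ring.
- by rewrite mulrACA tt p2; ring.
- by rewrite mulrACA tt p3; ring.
Qed.

Lemma sw_mul (V : opens Y) (b b' : sec (preim phi V)) : sw (b * b') = sw b * sw b'.
Proof.
apply: sec_sep => x Vx; have [U [m [c [Uy _ nc]]]] := charts (phi x).
pose W := opensI V U.
have hV : W `<=` V by move=> y [].
have hU : W `<=` U by move=> y [].
exists (preim phi W), (preim_sub (f := phi) hV); split=> //.
rewrite rmorphM -!sw_res rmorphM.
move: (res _ b) (res _ b') => {b}b {b'}b'.
have [nr sp] := nc W hU.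
set z1 := zeta W _ in nr sp; set z2 := zeta W _ in nr sp.
set w1 := eta W _ in nr sp; set w2 := eta W _ in nr sp.
pose s := scal (preim phi W) o; pose t := scal (preim phi W) (o ^+ 2).
have ss : s * s = t by rewrite -rmorphM.
have st : s * t = 1 by rewrite -rmorphM -exprS o3 rmorph1.
have tt : t * t = s by rewrite -{1}ss -mulrA st mulr1.
have nr' := normal_rel_scale ss tt st nr.
have hK : 2%:R * scal W (2%:R^-1) = 1.
  by rewrite -(rmorph_nat (scal W)) -rmorphM mulfV // rmorph1.
(* The relations persist for o z and o^2 w, and in these coordinates [sw] is the plain exchange. *)
apply: (swap_multiplicative hK nr') => [b1|a0 a1 a2 a3 a4 a5].
  have [a0 [a1 [a2 [a3 [a4 [a5 ->]]]]]] := sp b1.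
  exists a0, (a1 * scal W (o ^+ 2)), (a2 * scal W (o ^+ 2)), (a3 * scal W o), (a4 * scal W o), a5.
  rewrite /lincomb !rmorphM !pull_scal -/s -/t.
  transitivity (pull phi W a0 + pull phi W a1 * (s * t) * z1 + pull phi W a2 * (s * t) * z2
    + pull phi W a3 * (s * t) * w1 + pull phi W a4 * (s * t) * w2
    + pull phi W a5 * (s * t) * (z1 * w2 - z2 * w1)); last by ring.
  by rewrite st !mulr1.
have lE b0 b1 b2 b3 b4 b5 :
    lincomb (pull phi W) (s * z1) (s * z2) (t * w1) (t * w2) b0 b1 b2 b3 b4 b5 =
    pull phi W b0 + zeta W (scal W o *: (b1 *: mres hU (m ord0) + b2 *: mres hU (m ord_max)))
    + eta W (scal W (o ^+ 2) *: (b3 *: mres hU (m ord0) + b4 *: mres hU (m ord_max)))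
    + lam W (b5 *: w W (mres hU (m ord0)) (mres hU (m ord_max))).
  rewrite !phomZ !phomD !phomZ lamP !pull_scal -/s -/t -/z1 -/z2 -/w1 -/w2.
  rewrite /lincomb.
  transitivity (pull phi W b0 + pull phi W b1 * (s * z1) + pull phi W b2 * (s * z2) +
    pull phi W b3 * (t * w1) + pull phi W b4 * (t * w2)
    + pull phi W b5 * ((s * t) * (z1 * w2 - z2 * w1))); first by ring.
  by rewrite st; ring.
rewrite !lE swE; congr (_ + zeta W _ + eta W _ + lam W _).
- by rewrite scalerA -rmorphM -exprD (exprD o 3 1) o3 mul1r.
- by rewrite scalerA -rmorphM.
- by rewrite scaleNr.
Qed.

Lemma sw_monoid V : monoid_morphism (@sw V).
Proof. by split; [rewrite -(rmorph1 (pull phi V)) sw_pull|exact: sw_mul]. Qed.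

Definition swap_end : algend phi :=
  @Algend k X Y phi (fun V => rmorphism_of (@sw_zmod V) (@sw_monoid V))
    sw_res sw_pull.
End Swap.

(** * Lifting permutations of the three conjugates *)

Variable om : k.
Hypothesis omE : om ^+ 2 + om + 1 = 0.

Lemma om3 : om ^+ 3 = 1.
Proof.
apply/eqP; rewrite -subr_eq0; apply/eqP.
by transitivity ((om - 1) * (om ^+ 2 + om + 1)); [ring|rewrite omE mulr0].
Qed.

Lemma om_mod n n' : n = n' %[mod 3] -> om ^+ n = om ^+ n'.
Proof.
move=> E; rewrite (divn_eq n 3) (divn_eq n' 3) E !exprD ![(_ * 3)%N]mulnC !exprM om3.
by rewrite !expr1n.
Qed.

(* theta_i = om^i z + om^(-i) w : the three conjugates of z + w. *)
Definition theta (i : 'I_3) : pushhom phi M := pushcomb zeta eta (om ^+ i) (om ^+ (2 * i)).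

Lemma thetaE i V m :
  theta i V m = scal _ (om ^+ i) * zeta V m + scal _ (om ^+ (2 * i)) * eta V m.
Proof. by []. Qed.

Lemma theta_sum i j l V m : i != j -> i != l -> j != l ->
  theta i V m + theta j V m + theta l V m = 0.
Proof.
have S1 : 1 + om + om ^+ 2 = 0 by rewrite -omE; ring.
have S2 : 1 + om ^+ 2 + om ^+ 4 = 0.
  rewrite (_ : om ^+ 4 = om); last by apply: (@om_mod 4 1).
  by rewrite -omE; ring.
move=> ij il jl; rewrite !thetaE.
have [E1 E2] : om ^+ i + om ^+ j + om ^+ l = 0 /\
    om ^+ (2 * i) + om ^+ (2 * j) + om ^+ (2 * l) = 0.
  move: ij il jl; case: i => [[|[|[|//]]] ?]; case: j => [[|[|[|//]]] ?];
    case: l => [[|[|[|//]]] ?] //= _ _ _;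
    by split; rewrite ?muln0 ?expr0 ?expr1 /=; [rewrite -S1; ring|rewrite -S2; ring].
transitivity (scal (preim phi V) (om ^+ i + om ^+ j + om ^+ l) * zeta V m
  + scal (preim phi V) (om ^+ (2 * i) + om ^+ (2 * j) + om ^+ (2 * l)) * eta V m).
  by ring.
by rewrite E1 E2 rmorph0 !mul0r addr0.
Qed.

(** Fourier inversion on Z/3: with 3 invertible, z and w are recovered from the three conjugates, so
    an endomorphism may be tested on these. *)
Lemma zeta_theta V m : scal _ 3%:R * zeta V m =
  theta 0 V m + scal _ (om ^+ 2) * theta 1 V m + scal _ om * theta 2%:R V m.
Proof.
have S : 1 + om + om ^+ 2 = 0 by rewrite -omE; ring.
rewrite !thetaE /= !expr0 expr1 (_ : om ^+ 4 = om); last by apply: (@om_mod 4 1).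
transitivity (scal (preim phi V) (1 + om ^+ 3 + om ^+ 3) * zeta V m +
  scal (preim phi V) (1 + om ^+ 4 + om ^+ 2) * eta V m); last by ring.
rewrite (_ : om ^+ 4 = om); last by apply: (@om_mod 4 1).
by rewrite S om3 rmorph0 mul0r addr0; congr (scal _ _ * _); ring.
Qed.

Lemma eta_theta V m : scal _ 3%:R * eta V m =
  theta 0 V m + scal _ om * theta 1 V m + scal _ (om ^+ 2) * theta 2%:R V m.
Proof.
have S : 1 + om ^+ 2 + om = 0 by rewrite -omE; ring.
rewrite !thetaE /= !expr0 expr1.
transitivity (scal (preim phi V) (1 + om ^+ 3 + om ^+ 3 * om ^+ 3) * eta V m +
  scal (preim phi V) (1 + om ^+ 2 + om ^+ 3 * om) * zeta V m); last by ring.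
rewrite om3 !mul1r S rmorph0 mul0r addr0.
by congr (scal _ _ * _); ring.
Qed.

Lemma algend_scal (sigma : algend phi) V a x :
  sigma V (scal _ a * x) = scal _ a * sigma V x.
Proof. by rewrite rmorphM -pull_scal aend_pull. Qed.

Lemma algend_ext (sigma tau : algend phi) :
  (forall V i m, sigma V (theta i V m) = tau V (theta i V m)) ->
  (forall V l, sigma V (lam V l) = tau V (lam V l)) ->
  forall V b, sigma V b = tau V b.
Proof.
move=> h1 h2 V b.
have c3 (x y : sec (preim phi V)) : scal _ 3%:R * x = scal _ 3%:R * y -> x = y.
  move=> E; rewrite -[x]mul1r -[y]mul1r -(rmorph1 (scal (preim phi V))) -(mulVf three0).
  by rewrite !rmorphM -!mulrA E.
have hz m : sigma V (zeta V m) = tau V (zeta V m).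
  apply: c3; rewrite -!algend_scal zeta_theta.
  move: (h1 V 0 m) (h1 V 1 m) (h1 V 2%:R m).
  move: (theta 0 V m) (theta 1 V m) (theta 2%:R V m) => t0 t1 t2 E0 E1 E2.
  by rewrite !rmorphD !algend_scal E0 E1 E2.
have he m : sigma V (eta V m) = tau V (eta V m).
  apply: c3; rewrite -!algend_scal eta_theta.
  move: (h1 V 0 m) (h1 V 1 m) (h1 V 2%:R m).
  move: (theta 0 V m) (theta 1 V m) (theta 2%:R V m) => t0 t1 t2 E0 E1 E2.
  by rewrite !rmorphD !algend_scal E0 E1 E2.
have [r [m [n [l ->]]]] := dec_exists b.
by rewrite !rmorphD !aend_pull hz he h2.
Qed.

(** The inverse of s is forced by the product of permutations, s followed by t: with it, s * t
    corresponds to sigma after tau, which is the order of pullbacks under [act t] after [act s]. *)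
Definition good (s : 'S_3) (sigma : algend phi) : Prop :=
  (forall V i m, sigma V (theta i V m) = theta (s^-1%g i) V m) /\
  forall V l, sigma V (lam V l) = (-1) ^+ s * lam V l.

Lemma good_uniq s sigma tau : good s sigma -> good s tau ->
  forall V b, sigma V b = tau V b.
Proof.
by move=> [h1 h2] [h1' h2']; apply: algend_ext => [V i m|V l]; rewrite ?h1 ?h1' ?h2 ?h2'.
Qed.

Definition algend_id : algend phi :=
  @Algend k X Y phi (fun V => idfun) (fun _ _ _ _ => erefl) (fun _ _ => erefl).

Lemma good_one : good 1%g algend_id.
Proof. by split=> [V i m|V l] /=; rewrite ?invg1 ?perm1 // odd_perm1 mul1r. Qed.

Section Comp.
Variables sigma tau : algend phi.
Lemma algend_comp_res (U V : opens Y) (h : V `<=` U) (s : sec (preim phi U)) :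
  (sigma V \o tau V) (res (preim_sub (f := phi) h) s) =
  res (preim_sub (f := phi) h) ((sigma U \o tau U) s).
Proof. by rewrite /= !aend_res. Qed.
Lemma algend_comp_pull V (a : sec V) : (sigma V \o tau V) (pull phi V a) = pull phi V a.
Proof. by rewrite /= !aend_pull. Qed.
Definition algend_comp : algend phi :=
  @Algend k X Y phi (fun V => sigma V \o tau V) algend_comp_res algend_comp_pull.
End Comp.

Lemma good_mul s t sigma tau : good s sigma -> good t tau ->
  good (s * t)%g (algend_comp sigma tau).
Proof.
move=> [h1 h2] [h1' h2']; split=> [V i m|V l] /=.
  by rewrite h1' h1 invMg permM.
rewrite h2' odd_permM rmorphM rmorphXn rmorphN1 h2 mulrA; congr (_ * _).
by rewrite signr_addb mulrC.
Qed.

(** On Z/3 the transposition of j and l is the reflection sending i to j + l - i. The left sides are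
    the exponents of [om] at z and w after [sw] with o = om^(2 (j + l)) is applied to theta_i. *)
Lemma tperm_mod (i j l : 'I_3) : j != l ->
  (4 * (j + l) + 2 * i = tperm j l i %[mod 3])%N /\
  (2 * (j + l) + i = 2 * tperm j l i %[mod 3])%N.
Proof.
case: tpermP => [->|->|/eqP + /eqP].
- move: j l => [[|[|[|//]]] ?] [[|[|[|//]]] ?] //.
- move: j l => [[|[|[|//]]] ?] [[|[|[|//]]] ?] //.
- move: i j l => [[|[|[|//]]] ?] [[|[|[|//]]] ?] [[|[|[|//]]] ?] //.
Qed.

Lemma tperm_o3 (j l : 'I_3) : (om ^+ (2 * (j + l))) ^+ 3 = 1.
Proof. by rewrite exprAC om3 expr1n. Qed.

Lemma good_tperm (j l : 'I_3) : j != l -> good (tperm j l) (swap_end (tperm_o3 j l)).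
Proof.
move=> jl; pose o := om ^+ (2 * (j + l)).
split=> [V i m|V n].
  have [E1 E2] := tperm_mod i jl.
  rewrite tpermV !thetaE -(om_mod E1) -(om_mod E2).
  transitivity (sw o (pull phi V 0 + zeta V (scal V (om ^+ i) *: m)
    + eta V (scal V (om ^+ (2 * i)) *: m) + lam V 0)).
    by rewrite -[LHS]/(sw o _); congr (sw o); rewrite rmorph0 !phomZ !pull_scal phom0 add0r addr0.
  rewrite swE rmorph0 oppr0 phom0 add0r addr0 !phomZ !pull_scal !mulrA -!rmorphM.
  congr (scal _ _ * _ + scal _ _ * _); rewrite /o -?exprM -exprD.
    by congr (_ ^+ (_ + _)); rewrite mulnC mulnA.
  by [].
transitivity (sw o (pull phi V 0 + zeta V 0 + eta V 0 + lam V n)).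
  by rewrite -[LHS]/(sw o _); congr (sw o); rewrite rmorph0 !phom0 !add0r.
by rewrite swE rmorph0 !scaler0 !phom0 !add0r odd_tperm jl expr1 mulN1r phomN.
Qed.

(** Transpositions generate. The factorization chosen does not matter, because [good_uniq] makes the
    lift depend on s alone. *)
Lemma good_exists s : exists sigma, good s sigma.
Proof.
have [ts -> /allP dts] := prod_tpermP s.
elim: ts dts => [|t ts IH] dts.
  by rewrite big_nil; exists algend_id; exact: good_one.
have [|tau gtau] := IH; first by move=> u uts; apply: dts; rewrite inE uts orbT.
have gsigma := good_tperm (dts t (mem_head _ _)).
by rewrite big_cons; eexists; exact: (good_mul gsigma gtau).
Qed.

Definition sig (s : 'S_3) : algend phi := projT1 (cid (good_exists s)).

Lemma sigP s : good s (sig s).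
Proof. exact: projT2 (cid (good_exists s)). Qed.

Hypothesis aff : affine_morphism phi.

Definition S3_act (s : 'S_3) : smorphism X X := endo_morphism aff (sig s).

Lemma S3_act_over (s : 'S_3) : eqmor (mcomp phi (S3_act s)) phi.
Proof. exact: endo_morphism_over. Qed.

Lemma S3_act_phi s x : phi (S3_act s x) = phi x.
Proof. exact: (S3_act_over s).1. Qed.

Lemma S3_act_pull s (V : opens Y) (b : sec (preim phi V)) (W : opens X)
    (h : W `<=` preim (S3_act s) (preim phi V)) (h' : W `<=` preim phi V) :
  res h (pull (S3_act s) _ b) = res h' (sig s V b).
Proof.
have hs : preim (S3_act s) (preim phi V) `<=` preim phi V.
  by move=> x; rewrite /in_opens /= /preimage /= (S3_act_phi s x).
have -> : pull (S3_act s) (preim phi V) b = res hs (sig s V b).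
  exact: endo_pull_preim.
by rewrite (res_comp _ _ h').
Qed.

Lemma S3_action : action_over phi S3_act.
Proof.
split=> [|s t|s]; last exact: S3_act_over.
  apply: (endo_uniq aff) => [x|//|V b W hh hh']; first exact: S3_act_phi.
  have hW : W `<=` preim phi V by [].
  rewrite (S3_act_pull _ _ hW) (good_uniq (sigP 1%g) good_one) /=.
  by rewrite /mid_pull (res_comp _ _ hW).
apply: (endo_uniq aff) => [x|x|V b W hh hh']; first exact: S3_act_phi.
  by rewrite /= !S3_act_phi.
have hW : W `<=` preim phi V.
  by move=> x /hh; rewrite /in_opens /= /preimage /= (S3_act_phi _ x).
rewrite (S3_act_pull _ _ hW).
rewrite (good_uniq (sigP (s * t)%g) (good_mul (sigP s) (sigP t))).
have ht : preim (S3_act t) (preim phi V) `<=` preim phi V.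
  by move=> x; rewrite /in_opens /= /preimage /= (S3_act_phi t x).
have hs' : W `<=` preim (S3_act s) (preim phi V) by move=> x /hh'; exact: ht.
rewrite (mcomp_pullE _ _ (hh' : W `<=` preim (S3_act s) (preim (S3_act t) (preim phi V)))).
have -> : pull (S3_act t) (preim phi V) b = res ht (sig t V b) by exact: endo_pull_preim.
rewrite (pull_res ht (preim_sub (f := S3_act s) ht)).
by rewrite (res_comp _ _ hs') (S3_act_pull _ _ hW).
Qed.

Lemma S3_sact s V b : sact S3_act (preim phi V) s b = sig s V b.
Proof.
have h : preim phi V `<=` preim (S3_act s) (preim phi V).
  by move=> x; rewrite /in_opens /= /preimage /= (S3_act_phi s x).
have hV : preim phi V `<=` preim phi V by [].
by rewrite (sactE h) (S3_act_pull _ _ hV) res_id.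
Qed.


Lemma pull_phi_inj V : injective (pull phi V).
Proof.
move=> r r' E; have [|-> //] := @dec_uniq V r 0 0 0 r' 0 0 0.
by rewrite !phom0 E.
Qed.

Lemma theta_zero V i r m : pull phi V r + theta i V m = 0 -> r = 0 /\ m = 0.
Proof.
move=> E; have [|-> E1 _ _] := @dec_uniq V r (scal V (om ^+ i) *: m)
    (scal V (om ^+ (2 * i)) *: m) 0 0 0 0 0.
  by rewrite !phomZ !pull_scal !phom0 !addr0 rmorph0 -E thetaE addrA.
split=> //; rewrite -[m]scale1r -(rmorph1 (scal V)) -(expr1n _ i) -om3 -exprM.
by rewrite mulSn addnC exprD rmorphM -scalerA E1 scaler0.
Qed.

Lemma tperm_invariant (i j l : 'I_3) V b : i != j -> i != l -> j != l ->
  sig (tperm j l) V b = b -> exists r m, b = pull phi V r + theta i V m.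
Proof.
(* The three indices sum to 0 mod 3, so 2 (j + l) = - 2 i = i. *)
move=> ij il jl; have oE : om ^+ (2 * (j + l)) = om ^+ i.
  apply: om_mod; move: ij il jl.
  by move: i j l => [[|[|[|//]]] ?] [[|[|[|//]]] ?] [[|[|[|//]]] ?].
rewrite (good_uniq (sigP _) (good_tperm jl)).
have [r [m [n [l0 ->]]]] := dec_exists b.
rewrite -[aend _ _ _]/(sw (om ^+ (2 * (j + l))) _) swE => /dec_uniq [_ Em _ El].
have l00 : l0 = 0.
  have E2 : l0 + l0 = 0 by rewrite -[X in X + _]El addNr.
  rewrite -[l0]scale1r -(rmorph1 (scal V)) -(mulVf two0) rmorphM -scalerA.
  by rewrite rmorph_nat scaler_nat (mulr2n l0) E2 scaler0.
(* Invariance reads m = o^2 n with o = om^i, and z(o^2 n) + w(n) is theta_i applied to o n. *)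
exists r, (scal V (om ^+ i) *: n); rewrite l00 phom0 addr0 -Em oE thetaE.
rewrite !phomZ !pull_scal !mulrA -!rmorphM -addrA -exprD -exprM; congr (_ + (scal _ _ * _ + _)).
  by congr (_ ^+ _); rewrite mulnC mul2n -addnn.
rewrite -exprD (_ : 2 * i + i = 3 * i)%N; last by rewrite -[X in (_ + X)%N]mul1n -mulnDl.
by rewrite exprM om3 expr1n rmorph1 mul1r.
Qed.

Lemma sig_theta_fix (s : 'S_3) (i : 'I_3) V m : s i = i ->
  sig s V (theta i V m) = theta i V m.
Proof. by move=> si; rewrite (sigP s).1 -{1}si permK. Qed.

Lemma sig_lam_even (s : 'S_3) V l : ~~ odd_perm s -> sig s V (lam V l) = lam V l.
Proof. by move=> /negbTE es; rewrite (sigP s).2 es mul1r. Qed.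

Lemma I3_third (i j l x : 'I_3) : i != j -> i != l -> j != l -> x != i -> x != j -> x = l.
Proof.
move=> ij il jl xi xj; apply: val_inj; move: ij il jl xi xj.
by move: i j l x => [[|[|[|//]]] ?] [[|[|[|//]]] ?] [[|[|[|//]]] ?] [[|[|[|//]]] ?].
Qed.

(** A permutation of three points that fixes one of them is an involution or trivial. *)
Lemma order3_no_fix (s : 'S_3) i : #[s]%g = 3%N -> s i != i.
Proof.
move=> os; apply/eqP => si.
have s2 : (s * s)%g = 1%g.
  apply/permP => j; rewrite permM perm1.
  have [->|ji] := eqVneq j i; first by rewrite !si.
  have sj : s j != i by rewrite -[X in _ != X]si (inj_eq perm_inj).
  have [sjj|sjj] := eqVneq (s j) j; last first.
    have ssj : s (s j) != i by rewrite -[X in _ != X]si (inj_eq perm_inj).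
    have ssj' : s (s j) != s j by rewrite (inj_eq perm_inj).
    by apply: (@I3_third i (s j) j); rewrite // eq_sym.
  by rewrite !sjj.
have := expg_order s; rewrite os 2!expgS expg1 mulgA s2 mul1g => s1.
by move: os; rewrite s1 order1.
Qed.

Lemma cycle3_invariant (s : 'S_3) V b : #[s]%g = 3%N -> sig s V b = b ->
  exists r l, b = pull phi V r + lam V l.
Proof.
move=> os sb; have os' : #[s^-1]%g = 3%N by rewrite orderV.
have es : ~~ odd_perm s.
  have := congr1 (@odd_perm _) (expg_order s); rewrite os 2!expgS expg1 !odd_permM odd_perm1.
  by case: odd_perm.
(* The trace over the 3-cycle sums the three conjugates and so vanishes on them, hence on z(M) and
   w(M), while it multiplies invariants by 3. *)
have tr i m : theta i V m + sig s V (theta i V m) + sig s V (sig s V (theta i V m)) = 0.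
  rewrite !(sigP s).1; apply: theta_sum.
  - by rewrite eq_sym order3_no_fix.
  - apply/eqP => E; have := expg_order (s^-1)%g; rewrite os' => /permP /(_ i).
    rewrite 2!expgS expg1 !permM perm1 -E => /eqP.
    by rewrite (negbTE (order3_no_fix i os')).
  - by rewrite (inj_eq perm_inj) eq_sym order3_no_fix.
have c3 (x y : sec (preim phi V)) : scal _ 3%:R * x = scal _ 3%:R * y -> x = y.
  move=> E; rewrite -[x]mul1r -[y]mul1r -(rmorph1 (scal (preim phi V))) -(mulVf three0).
  by rewrite !rmorphM -!mulrA E.
pose T (x : sec (preim phi V)) := x + sig s V x + sig s V (sig s V x).
have TD x y : T (x + y) = T x + T y by rewrite /T !rmorphD; ring.
have TZ a x : T (scal _ a * x) = scal _ a * T x by rewrite /T !algend_scal; ring.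
have T3 x : sig s V x = x -> T x = scal _ 3%:R * x.
  by move=> sx; rewrite /T !sx rmorph_nat; ring.
have Tt i m : T (theta i V m) = 0 by exact: tr.
have Tz m : T (zeta V m) = 0.
  apply: c3; rewrite -TZ zeta_theta; move: (Tt 0 m) (Tt 1 m) (Tt 2%:R m).
  move: (theta 0 V m) (theta 1 V m) (theta 2%:R V m) => t0 t1 t2 E0 E1 E2.
  by rewrite !TD !TZ E0 E1 E2 !mulr0 !addr0.
have Te m : T (eta V m) = 0.
  apply: c3; rewrite -TZ eta_theta; move: (Tt 0 m) (Tt 1 m) (Tt 2%:R m).
  move: (theta 0 V m) (theta 1 V m) (theta 2%:R V m) => t0 t1 t2 E0 E1 E2.
  by rewrite !TD !TZ E0 E1 E2 !mulr0 !addr0.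
have := T3 b sb; have [r [m [n [l E]]]] := dec_exists b.
rewrite {1}E !TD Tz Te !addr0 (T3 (pull phi V r)) ?aend_pull // (T3 (lam V l)).
  by rewrite -mulrDr => /c3 <-; exists r, l.
exact: sig_lam_even.
Qed.

Lemma S3_invariant V b : (forall s, sig s V b = b) -> exists r, b = pull phi V r.
Proof.
move=> inv.
have [||| r [m E]] := @tperm_invariant 0 1 2%:R V b _ _ _ (inv _) => //.
have [||| r' [m' E']] := @tperm_invariant 1 0 2%:R V b _ _ _ (inv _) => //.
have := E; rewrite E' !thetaE /= expr0 expr1 rmorph1 !mul1r => E2.
have [|_ E3 E4 _] := @dec_uniq V r' (scal V om *: m') (scal V (om ^+ 2) *: m') 0
  r m m 0.
  by rewrite !phomZ !pull_scal !phom0 !addr0 -addrA E2 addrA.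
have m0 : m' = 0.
  have : scal V (om - om ^+ 2) *: m' = 0 by rewrite rmorphB scalerBl E3 E4 subrr.
  (* Two transpositions give m = om m' = om^2 m'; the difference of the two roots is invertible
     because its square is -3. *)
  have u : (om - om ^+ 2) * (om - om ^+ 2) = - 3%:R.
    transitivity (om ^+ 3 * om - 2%:R * om ^+ 3 + om ^+ 2); first by ring.
    rewrite om3; transitivity ((om ^+ 2 + om + 1) - 3%:R); first by ring.
    by rewrite omE add0r.
  move=> /(congr1 (fun x => scal V (- 3%:R^-1 * (om - om ^+ 2)) *: x)).
  by rewrite scalerA -rmorphM -mulrA u mulrNN mulVf // rmorph1 scale1r scaler0.
by exists r'; rewrite m0 !phom0 !mulr0 !addr0.
Qed.


(** * The quotients of X by subgroups of S_3 *)

Hypothesis nat0 : forall n, n.+1%:R != 0 :> k.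

Let act1 : eqmor (S3_act 1%g) (mid X). Proof. by case: S3_action. Qed.
Let actM s t : eqmor (S3_act (s * t)%g) (mcomp (S3_act t) (S3_act s)).
Proof. by case: S3_action. Qed.

Lemma card_inv (H : {group 'S_3}) : #|H|%:R^-1 * #|H|%:R = 1 :> k.
Proof. by rewrite mulVf //; move: (cardG_gt0 H); case: #|_|. Qed.

Lemma S3_is_quotient : is_quotient S3_act [set: 'S_3]%G phi.
Proof.
have qact g x : g \in [set: 'S_3]%G -> phi (S3_act g x) = phi x by move=> _; exact: S3_act_phi.
apply: (affine_is_quotient act1 actM qact pull_phi_inj _ (card_inv _) aff) => V s.
rewrite invariant_sactE; last exact: preim_stable.
split=> [inv|[t <-] g _]; last by rewrite S3_sact aend_pull.
have [|r ->] := @S3_invariant V s; last by exists r.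
by move=> g; rewrite -S3_sact; apply: inv; rewrite inE.
Qed.

Lemma S3_galois : covering_map phi 6 -> galois_branched_cover phi S3_act.
Proof. by move=> cov; split; [exists 6%N|exact: S3_action|exact: S3_is_quotient]. Qed.

Lemma S3_quotient (H : {group 'S_3}) :
  exists (Z : scheme k) (q : smorphism X Z) (f2 : smorphism Z Y),
    is_quotient S3_act H q /\ eqmor (mcomp f2 q) phi.
Proof.
have fact g : eqmor (mcomp phi (S3_act g)) phi by exact: S3_act_over.
pose q := quotient_proj H act1 actM.
pose f2 := quotient_mor H act1 actM fact.
have quo : is_quotient S3_act H q by exact: quotient_projP.
have comp : eqmor (mcomp f2 q) phi by exact: quotient_mor_comp.
have [qs qf _ qi qinv] := quo.
have loc (z : quotient_space H act1 actM) :
    exists U : opens (quotient_space H act1 actM), U z /\ affine U.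
  have [x qx] := qs z; have [V [Vx affV affW]] := aff (phi x).
  exists (preim f2 V); split.
    have e : f2 z = phi x by rewrite -qx; exact: comp.1 x.
    by rewrite -e in Vx.
  apply: (quotient_affine act1 actM _ qi qinv (card_inv H) qs qf).
    by move=> g x' Hg; apply/esym/qf; exists g.
  by rewrite (preim_quotient comp).
by exists (Scheme loc), q, f2.
Qed.

Lemma tperm_quotient (i j l : 'I_3) : i != j -> i != l -> j != l ->
  finite_morphism phi ->
  exists (Z : scheme k) (q : smorphism X Z) (f2 : smorphism Z Y),
    [/\ is_quotient S3_act <[tperm j l]>%G q, eqmor (mcomp f2 q) phi,
        covering_map f2 3 & splits_as f2 M].
Proof.
move=> ij il jl fin; pose H := <[tperm j l]>%G.
have [Z [q [f2 [quo comp]]]] := S3_quotient H.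
have Hfix g : g \in H -> g i = i.
  move=> /cycleP [n ->]; elim: n => [|n IH]; first by rewrite perm1.
  by rewrite expgS permM tpermD 1?eq_sym // [i == _]eq_sym.
have thi (U : opens Y) m g : g \in H -> sact S3_act (preim phi U) g (theta i U m) = theta i U m.
  by move=> Hg; rewrite S3_sact; exact: sig_theta_fix (Hfix g Hg).
have inv (U : opens Y) (s : sec (preim phi U)) :
    (forall g, g \in H -> sact S3_act (preim phi U) g s = s) ->
    exists r m, s = pull phi U r + theta i U m.
  move=> sH; apply: (tperm_invariant ij il jl).
  by rewrite -S3_sact; apply: sH; exact: cycle_id.
exists Z, q, f2; split=> //.
  split; first exact: (quotient_finite S3_action quo comp (card_inv H) fin).
  apply: (quotient_locally_free S3_action quo comp) => y.
  have [U [m [c [Uy bm _]]]] := charts y.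
  exists U, (fun x : 'I_3 => if x == 0 then 1
    else if x == 1 then theta i U (m ord0) else theta i U (m ord_max)); split=> //.
    move=> x g Hg; case: ifP => _; first exact: rmorph1.
    by case: ifP => _; exact: thi.
  move=> V h s sH; have [r [n ->]] := inv V s sH.
  have [a [ea ua]] := bm V h n.
  have sumE (t : 'rV[sec V]_3) : \sum_(x < 3) pull phi V (t 0 x) *
      res (preim_sub (f := phi) h) (if x == 0 then 1
        else if x == 1 then theta i U (m ord0) else theta i U (m ord_max)) =
      pull phi V (t 0 0) + theta i V (t 0 1 *: mres h (m ord0)
        + t 0 2%:R *: mres h (m ord_max)).
    rewrite phomD !phomZ !phom_res !big_ord_recl big_ord0 /= rmorph1 mulr1 addr0.
    by congr (_ + (pull phi V (t 0 _) * _ + pull phi V (t 0 _) * _)); exact: val_inj.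
  have l2 : lift ord0 (ord0 : 'I_1) = ord_max :> 'I_2 by exact: val_inj.
  exists (\row_(x < 3) if x == 0 then r else if x == 1 then a 0 ord0 else a 0 ord_max).
  split; first by rewrite sumE !mxE /= ea !big_ord_recl big_ord0 addr0 l2.
  move=> t; rewrite sumE => E.
  have [|r0 n0] := @theta_zero V i (r - t 0 0)
      (n - (t 0 1 *: mres h (m ord0) + t 0 2%:R *: mres h (m ord_max))).
    by rewrite rmorphB phomB addrACA E -opprD subrr.
  have at' : a = \row_(x < 2) if x == ord0 then t 0 1 else t 0 2%:R.
    apply: ua; rewrite (subr0_eq n0) !big_ord_recl big_ord0 addr0 l2 !mxE /=.
    by [].
  apply/rowP => x; rewrite mxE at' !mxE /= (subr0_eq r0).
  by elim/I3_ind: x.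
apply: (quotient_splits S3_action quo comp (j := theta i)) => //.
by move=> U r m; exact: theta_zero.
Qed.

Lemma cycle3_quotient (s : 'S_3) : #[s]%g = 3%N -> covering_map phi 6 ->
  exists (Z : scheme k) (q : smorphism X Z) (f2 : smorphism Z Y),
    [/\ is_quotient S3_act <[s]>%G q, eqmor (mcomp f2 q) phi,
        covering_map f2 2 & splits_as f2 L].
Proof.
move=> os [fin free6]; pose H := <[s]>%G.
have [Z [q [f2 [quo comp]]]] := S3_quotient H.
have es : ~~ odd_perm s.
  have := congr1 (@odd_perm _) (expg_order s); rewrite os 2!expgS expg1 !odd_permM odd_perm1.
  by case: odd_perm.
have Heven g : g \in H -> ~~ odd_perm g.
  move=> /cycleP [n ->]; elim: n => [|n IH]; first by rewrite odd_perm1.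
  by rewrite expgS odd_permM (negbTE es) (negbTE IH).
have lami (U : opens Y) n g : g \in H -> sact S3_act (preim phi U) g (lam U n) = lam U n.
  by move=> Hg; rewrite S3_sact; exact: sig_lam_even (Heven g Hg).
have inv (U : opens Y) (b : sec (preim phi U)) :
    (forall g, g \in H -> sact S3_act (preim phi U) g b = b) ->
    exists r n, b = pull phi U r + lam U n.
  move=> sH; apply: (cycle3_invariant os).
  by rewrite -S3_sact; apply: sH; exact: cycle_id.
have lam_zero (U : opens Y) r n : pull phi U r + lam U n = 0 -> r = 0 /\ n = 0.
  move=> E; have [|-> _ _ ->] := @dec_uniq U r 0 0 n 0 0 0 0; last by [].
  by rewrite !phom0 !addr0 rmorph0.
exists Z, q, f2; split=> //.
  split; first exact: (quotient_finite S3_action quo comp (card_inv H) fin).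
  apply: (quotient_locally_free S3_action quo comp) => y.
  have [U1 [m [c [U1y _ nc]]]] := charts y.
  have [U2 [b6 [U2y b6P]]] := free6 y.
  pose U := opensI U1 U2.
  have h1 : U `<=` U1 by move=> z [].
  have h2 : U `<=` U2 by move=> z [].
  pose w0 := w U (mres h1 (m ord0)) (mres h1 (m ord_max)).
  exists U, (fun x : 'I_2 => if x == 0 then 1 else lam U w0); split=> //.
    move=> x g Hg; case: ifP => _; first exact: rmorph1.
    exact: lami.
  move=> V h b bH; have [r [n ->]] := inv V b bH.
  have hV1 : V `<=` U1 by move=> z /h /h1.
  have hV2 : V `<=` U2 by move=> z /h /h2.
  have w0E : mres h w0 = w V (mres hV1 (m ord0)) (mres hV1 (m ord_max)).
    by rewrite /w0 -alt_res !(mres_comp _ _ hV1).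
  have [nr sp] := nc V hV1.
  have [t et] : exists t, n = t *: mres h w0.
    have [a0 [a1 [a2 [a3 [a4 [a5 E]]]]]] := sp (lam V n).
    exists a5; have [|_ _ _ ->] // := @dec_uniq V 0 0 0 n a0
      (a1 *: mres hV1 (m ord0) + a2 *: mres hV1 (m ord_max))
      (a3 *: mres hV1 (m ord0) + a4 *: mres hV1 (m ord_max)) (a5 *: mres h w0).
    rewrite rmorph0 !phom0 !add0r E w0E !phomZ lamP !phomD !phomZ /lincomb; ring.
  (* Freeness of the generator of L comes from the rank: 1, z_1, z_2, w_1, w_2 and
     [lam V (mres h w0)] are six elements spanning a module that is free of rank 6. *)
  have free t' : t' *: mres h w0 = 0 -> t' = 0.
    move=> E.
    pose T (x : 'I_6) : sec (preim phi V) := nth 0 [:: 1; zeta V (mres hV1 (m ord0));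
      zeta V (mres hV1 (m ord_max)); eta V (mres hV1 (m ord0));
      eta V (mres hV1 (m ord_max)); lam V (mres h w0)] x.
    have /(congr1 (fun A : 'rV_6 => A 0 ord_max)) : \row_(x < 6) (if x == ord_max then t' else 0) = 0.
      apply: (spanning_free (f := pull phi V) (b := fun x => res (preim_sub (f := phi) hV2) (b6 x))
        (t := T)); first by move=> x; exact: b6P.
        move=> x; have [a0 [a1 [a2 [a3 [a4 [a5 ->]]]]]] := sp x.
        exists (\row_(x < 6) nth 0 [:: a0; a1; a2; a3; a4; a5] x).
        rewrite !big_ord_recl big_ord0 !mxE /T /= /lincomb w0E lamP; ring.
      rewrite (bigD1 ord_max) //= big1 ?addr0 => [|x xm].
        by rewrite mxE eqxx /T /= -phomZ E phom0.
      by rewrite mxE (negbTE xm) rmorph0 mul0r.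
    by rewrite !mxE eqxx.
  have sumE (a : 'rV[sec V]_2) : \sum_(x < 2) pull phi V (a 0 x) *
      res (preim_sub (f := phi) h) (if x == 0 then 1 else lam U w0) =
      pull phi V (a 0 ord0) + lam V (a 0 ord_max *: mres h w0).
    rewrite phomZ phom_res !big_ord_recl big_ord0 /= rmorph1 mulr1 addr0.
    by congr (_ + pull phi V (a 0 _) * _); exact: val_inj.
  exists (\row_(x < 2) if x == ord0 then r else t); split; first by rewrite sumE !mxE /= et.
  move=> a; rewrite sumE => E.
  have [|r0 n0] := @lam_zero V (r - a 0 ord0) ((t - a 0 ord_max) *: mres h w0).
    by rewrite rmorphB scalerBl phomB -et addrACA E -opprD subrr.
  have l2 : lift ord0 (ord0 : 'I_1) = ord_max :> 'I_2 by exact: val_inj.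
  apply/rowP => x; rewrite mxE (subr0_eq r0) (subr0_eq (free _ n0)).
  by case: x => [[|[|//]] ?] /=; congr (a 0 _); exact: val_inj.
exact: (quotient_splits S3_action quo comp (j := lam)).
Qed.

End Action.

Local Close Scope classical_set_scope.

Theorem theorem3p5 (k : closedFieldType) (char0 : [pchar k] =i pred0)
    (X Y : scheme k) (phi : smorphism X Y)
    (M L : modsheaf Y) (w : alternating M L)
    (jz jw : pushhom phi M) (jl : pushhom phi L)
    (Phi : quadhom M) (e : 'I_4 -> k) :
  covering_map phi 6 ->
  gorenstein_fibres phi ->
  locally_free M 2 ->
  is_wedge2 w ->
  splits_by jz jw jl ->
  Delta_tc e != 0 ->
  (forall y : Y, exists (U : opens Y) (m : 'I_2 -> msec M U)
     (c : 'I_4 -> sec U) (d : 'cV[sec U]_(3 + 3 + 3)),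
     U y /\ defined_on jz jw Phi e m c d) ->
  exists act : 'S_3 -> smorphism X X,
    [/\ galois_branched_cover phi act,
        forall (U : opens Y) (m : 'I_2 -> msec M U) (c : 'I_4 -> sec U)
            (d : 'cV[sec U]_(3 + 3 + 3)),
          defined_on jz jw Phi e m c d ->
          exists2 g : 'M[k]_2, g \in unitmx &
            normal_form_on (changed_zw jz jw g m) c,
        forall i j : 'I_3, i != j ->
          exists (X2 : scheme k) (q : smorphism X X2) (phi2 : smorphism X2 Y),
            [/\ is_quotient act <[tperm i j]>%G q, eqmor (mcomp phi2 q) phi,
                covering_map phi2 3 & splits_as phi2 M] &
        forall s : 'S_3, #[s]%g = 3%N ->
          exists (X3 : scheme k) (q : smorphism X X3) (phi3 : smorphism X3 Y),
            [/\ is_quotient act <[s]>%G q, eqmor (mcomp phi3 q) phi,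
                covering_map phi3 2 & splits_as phi3 L]].
Proof.
move=> cov _ _ wedge splits disc charts.
have nat0 n : n.+1%:R != 0 :> k by rewrite ((pcharf0P k).1 char0).
pose e0 := e ord0; pose e1 := e (inord 1); pose e2 := e (inord 2); pose e3 := e (inord 3).
(* [Delta_tc] is the discriminant of the Hessian quadratic form. *)
have disc' : (e0 * e3 - e1 * e2) ^+ 2
    - 4%:R * (e0 * e2 - e1 ^+ 2) * (e1 * e3 - e2 ^+ 2) != 0.
  move: disc; rewrite /Delta_tc -/e0 -/e1 -/e2 -/e3.
  by congr (_ != 0); ring.
have [a [b [a' [b' [det0 [A1 A2] [A3 A4] [A5 A6]]]]]] := product_normal_form disc'.
have uu1 : a ^+ 2 * e1 - 2%:R * a * b * e2 + b ^+ 2 * e3 = a' by rewrite -A1; ring.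
have uu2 : a ^+ 2 * e0 - 2%:R * a * b * e1 + b ^+ 2 * e2 = b' by rewrite -A2; ring.
have vv1 : a' ^+ 2 * e1 - 2%:R * a' * b' * e2 + b' ^+ 2 * e3 = a by rewrite -[RHS]A5; ring.
have vv2 : a' ^+ 2 * e0 - 2%:R * a' * b' * e1 + b' ^+ 2 * e2 = b by rewrite -[RHS]A6; ring.
have [lam lamP] := wedge_pushhom jz jw wedge a b a' b'.
have decu := dec_uniq splits (nat0 1%N) det0 uu1 uu2 A3 A4 vv1 vv2 lamP charts.
have dece := dec_exists splits (nat0 1%N) det0 uu1 uu2 A3 A4 vv1 vv2 lamP charts.
have ncharts (y : Y) : exists (U : opens Y) (m : 'I_2 -> msec M U) (c : 'I_4 -> sec U),
    [/\ U y, is_basis m & normal_chart (new_z jz jw a b) (new_w jz jw a' b') m c].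
  have [U [m [c [d [Uy def]]]]] := charts y; exists U, m, c; split=> //; first by case: def.
  move=> V h.
  exact: (chart_relations splits (nat0 1%N) det0 uu1 uu2 A3 A4 vv1 vv2 h def).
have [om omE] : exists om : k, om ^+ 2 + om + 1 = 0.
  have [x ex] := @solve_monicpoly k 2 (fun=> -1) isT.
  exists x; move: ex; rewrite !big_ord_recl big_ord0 /= expr0 expr1 => ->; ring.
have aff := finite_affine cov.1.
exists (S3_act (nat0 1%N) lamP decu dece ncharts omE aff); split.
- exact: (S3_galois _ (nat0 2%N)).
- move=> U m c d def.
  (* The rows are the vectors u = (a, b) and v = (a', b') of the normalized product. *)
  pose g : 'M[k]_2 := \matrix_(i, j) if i == ord0 then (if j == ord0 then a else b)
    else (if j == ord0 then a' else b').
  exists g.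
    rewrite unitmxE unitfE (expand_det_row _ ord0) !big_ord_recl big_ord0.
    rewrite /cofactor !det_mx11 !mxE /= addr0 expr0 mul1r expr1 mulN1r mulrN.
    by [].
  have := chart_normal_form splits (nat0 1%N) det0 uu1 uu2 A3 A4 vv1 vv2 def.
  congr (normal_form_on _ _); rewrite /changed_zw /zw; apply/funext => i.
  by case: fintype.split => l; rewrite !mxE.
- move=> i j ij.
  (* The index fixed by the transposition; M embeds into the invariants by theta_l. *)
  have [l [li lj]] : exists l : 'I_3, l != i /\ l != j.
    move: i j ij => [[|[|[|//]]] ?] [[|[|[|//]]] ?] // _;
      by [exists 0 | exists 1 | exists 2%:R].
  exact: (tperm_quotient _ (nat0 2%N) lamP decu dece ncharts omE aff nat0 li lj ij cov.1).
- move=> s os.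
  exact: (cycle3_quotient _ (nat0 2%N) lamP decu dece ncharts omE aff nat0 os cov).
Qed.
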